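(* Let $F$ be a 2-field with $\operatorname{cd}_2(F)\leq 2$. For every two isomorphic tensor products of quaternion algebras over $F$, $\bigotimes_{i=1}^n Q_i$ and $\bigotimes_{i=1}^n Q_i'$, there exist quaternion $F$-algebras $Q_i'',Q_i'''$ ($1\le i\le n$) such that the chain $\bigotimes_{i=1}^n Q_i,\ \bigotimes_{i=1}^n Q_i'',\ \bigotimes_{i=1}^n Q_i''',\ \bigotimes_{i=1}^n Q_i'$ consists of mutually isomorphic algebras and every two adjacent tensor products in it share a common slot.
   Context: A 2-field is a field with no nontrivial finite extensions of odd degree. We say $\operatorname{cd}_2(F)\leq 2$ if $I_q^3L=0$ for every finite field extension $L/F$, where $I_q^3L$ is the kernel of the Clifford invariant on the group $I_q^2L$ of Witt classes of even-dimensional nonsingular quadratic forms over $L$ with trivial discriminant (Arf invariant in characteristic 2). Quaternion algebras: if $\operatorname{char}(F)=2$, $[\alpha,\beta)=F[x,y:x^2+x=\alpha,y^2=\beta,yxy^{-1}=x+1]$ with $\alpha\in F,\beta\in F^\times$; if $\operatorname{char}(F)\neq2$, $(\alpha,\beta)=F[x,y:x^2=\alpha,y^2=\beta,yxy^{-1}=-x]$ with $\alpha,\beta\in F^\times$. Two quaternion algebras $Q,Q'$ share a common slot if for some $a,b,c$: either $Q\cong[a,b)$ and $Q'\cong[a,c)$, or $Q\cong[a,b)$ and $Q'\cong[c,b)$ (characteristic 2); or $Q\cong(a,b)$ and $Q'\cong(a,c)$ (characteristic not 2). Two tensor products $\bigotimes_{i=1}^nQ_i$ and $\bigotimes_{i=1}^nQ_i'$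 share a common slot if there exist $i,j$ such that $Q_i$ and $Q_j'$ share a common slot. *)

(* Defs.v *)
From HB Require Import structures.
From mathcomp Require Import all_boot all_order all_algebra all_field.
Set Implicit Arguments. Unset Strict Implicit. Unset Printing Implicit Defensive.
Import Order.TTheory GRing.Theory Num.Theory.
Local Open Scope ring_scope.

(* Finite-dimensional (associative unital) algebras over a field K, given by *)
(* a finite basis and structure constants.  Elements are coordinate vectors. *)
Record scalg (K : fieldType) := SCAlg {
  sc_basis : finType;
  sc_const : sc_basis -> sc_basis -> sc_basis -> K; (* coeff of e_k in e_i*e_j *)
  sc_one : {ffun sc_basis -> K} }.

Notation sc_elt K A := {ffun @sc_basis K A -> GRing.Field.sort K}.

Definition sc_scale (K : fieldType) (B : finType) (a : K) (x : {ffun B -> K}) :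
  {ffun B -> K} := [ffun i => a * x i].

Definition sc_mul (K : fieldType) (A : scalg K) (u v : sc_elt K A) : sc_elt K A :=
  [ffun k => \sum_i \sum_j u i * v j * sc_const i j k].

Definition sc_ok (K : fieldType) (A : scalg K) : Prop :=
  (forall x y z : sc_elt K A, sc_mul (sc_mul x y) z = sc_mul x (sc_mul y z)) /\
  (forall x : sc_elt K A, sc_mul (sc_one A) x = x /\ sc_mul x (sc_one A) = x).

Definition sc_hom (K : fieldType) (A B : scalg K) (f : sc_elt K A -> sc_elt K B) : Prop :=
  (forall (a : K) (x y : sc_elt K A), f (sc_scale a x + y) = sc_scale a (f x) + f y) /\
  (forall x y : sc_elt K A, f (sc_mul x y) = sc_mul (f x) (f y)) /\
  f (sc_one A) = sc_one B.

Definition sc_iso (K : fieldType) (A B : scalg K) : Prop :=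
  exists f : sc_elt K A -> sc_elt K B, sc_hom f /\ bijective f.

Definition matalg (K : fieldType) (N : nat) : scalg K :=
  @SCAlg K ('I_N * 'I_N)%type
    (fun p q r => ((p.2 == q.1) && (r.1 == p.1) && (r.2 == q.2))%:R)
    [ffun p => (p.1 == p.2)%:R].

(* Quaternion algebras.  Basis e0 = 1, e1 = x, e2 = y, e3 = xy.              *)
Definition char2 (K : fieldType) : bool := 2 \in [pchar K].

Definition unit_seq (K : fieldType) (k : nat) : seq K :=
  [seq (l == k)%:R | l <- iota 0 4].

(* characteristic 2: [a,b) = F[x,y : x^2+x=a, y^2=b, yxy^-1 = x+1]
   (signs are irrelevant in characteristic 2) *)
Definition qtab2 (K : fieldType) (a b : K) (i j : nat) : seq K :=
  match i, j with
  | 0, _ => unit_seq K j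
  | _, 0 => unit_seq K i
  | 1, 1 => [:: a; 1; 0; 0]
  | 1, 2 => [:: 0; 0; 0; 1]
  | 1, 3 => [:: 0; 0; a; 1]
  | 2, 1 => [:: 0; 0; 1; 1]
  | 2, 2 => [:: b; 0; 0; 0]
  | 2, 3 => [:: b; b; 0; 0]
  | 3, 1 => [:: 0; 0; a; 0]
  | 3, 2 => [:: 0; b; 0; 0]
  | _, _ => [:: a * b; 0; 0; 0]
  end.

(* characteristic not 2: (a,b) = F[x,y : x^2=a, y^2=b, yxy^-1 = -x] *)
Definition qtab (K : fieldType) (a b : K) (i j : nat) : seq K :=
  match i, j with
  | 0, _ => unit_seq K j
  | _, 0 => unit_seq K i
  | 1, 1 => [:: a; 0; 0; 0]
  | 1, 2 => [:: 0; 0; 0; 1]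
  | 1, 3 => [:: 0; 0; a; 0]
  | 2, 1 => [:: 0; 0; 0; -1]
  | 2, 2 => [:: b; 0; 0; 0]
  | 2, 3 => [:: 0; - b; 0; 0]
  | 3, 1 => [:: 0; 0; - a; 0]
  | 3, 2 => [:: 0; b; 0; 0]
  | _, _ => [:: - (a * b); 0; 0; 0]
  end.

Definition qconst (K : fieldType) (p : K * K) (i j k : 'I_4) : K :=
  nth 0 ((if char2 K then qtab2 p.1 p.2 else qtab p.1 p.2) i j) k.

Definition quat_ok (K : fieldType) (p : K * K) : bool :=
  if char2 K then p.2 != 0 else (p.1 != 0) && (p.2 != 0).

Definition quat (K : fieldType) (p : K * K) : scalg K :=
  @SCAlg K 'I_4 (qconst p) [ffun i => (i == ord0)%:R].

(* tensor product Q_1 (x) ... (x) Q_n of quaternion algebras, with the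
   product basis e_{i_1} (x) ... (x) e_{i_n} *)
Definition tens (K : fieldType) (n : nat) (Q : 'I_n -> K * K) : scalg K :=
  @SCAlg K {ffun 'I_n -> 'I_4}
    (fun i j k => \prod_(t < n) qconst (Q t) (i t) (j t) (k t))
    [ffun i => (i == [ffun => ord0])%:R].

Definition common_slot (K : fieldType) (p p' : K * K) : Prop :=
  if char2 K then
    exists a b c : K,
      (quat_ok (a, b) /\ quat_ok (a, c) /\
         sc_iso (quat p) (quat (a, b)) /\ sc_iso (quat p') (quat (a, c))) \/
      (quat_ok (a, b) /\ quat_ok (c, b) /\
         sc_iso (quat p) (quat (a, b)) /\ sc_iso (quat p') (quat (c, b)))
  else
    exists a b c : K,
      quat_ok (a, b) /\ quat_ok (a, c) /\
      sc_iso (quat p) (quat (a, b)) /\ sc_iso (quat p') (quat (a, c)).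

Definition tens_common_slot (K : fieldType) (n : nat) (Q Q' : 'I_n -> K * K) : Prop :=
  exists i j : 'I_n, common_slot (Q i) (Q' j).

Definition qf (K : fieldType) (m : nat) (A : 'M[K]_m) (v : 'rV[K]_m) : K :=
  (v *m A *m v^T) 0 0.

(* polar bilinear form b_q(u,v) = q(u+v) - q(u) - q(v) *)
Definition polar (K : fieldType) (m : nat) (A : 'M[K]_m) (u v : 'rV[K]_m) : K :=
  (u *m (A + A^T) *m v^T) 0 0.

Definition nonsingular (K : fieldType) (m : nat) (A : 'M[K]_m) : bool :=
  \det (A + A^T) != 0.

Definition isometric (K : fieldType) (m : nat) (A B : 'M[K]_m) : Prop :=
  exists P : 'M[K]_m, P \in unitmx /\ forall v, qf A (v *m P) = qf B v.

(* the form x_0 x_1 + x_2 x_3 + ... *)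
Definition hypmx (K : fieldType) (N : nat) : 'M[K]_N :=
  \matrix_(i, j) (~~ odd i && (j == i.+1 :> nat))%:R.

Definition hyperbolic (K : fieldType) (m : nat) (A : 'M[K]_m) : Prop :=
  ~~ odd m /\ isometric A (hypmx K m).

Definition witt_zero (K : fieldType) (m : nat) (A : 'M[K]_m) : Prop :=
  exists r : nat, hyperbolic (block_mx A 0 0 (hypmx K (r + r))).

(* trivial discriminant (char <> 2): (-1)^(m/2) det is a square;
   trivial Arf invariant (char 2): sum q(e_i) q(f_i) in {t^2+t} for a
   symplectic basis (e_i, f_i) of the polar form *)
Definition disc_trivial (K : fieldType) (m : nat) (A : 'M[K]_m) : Prop :=
  if char2 K then
    exists (e f : 'I_(m./2) -> 'rV[K]_m),
      (forall i j, polar A (e i) (f j) = (i == j)%:R) /\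
      (forall i j, polar A (e i) (e j) = 0) /\
      (forall i j, polar A (f i) (f j) = 0) /\
      exists t : K, \sum_i qf A (e i) * qf A (f i) = t ^+ 2 + t
  else
    exists s : K, s ^+ 2 = (-1) ^+ (m./2) * \det (A + A^T).

Definition clifford_pair (K : fieldType) (m : nat) (A : 'M[K]_m)
    (C : scalg K) (j : 'rV[K]_m -> sc_elt K C) : Prop :=
  sc_ok C /\
  (forall (a : K) u v, j (a *: u + v) = sc_scale a (j u) + j v) /\
  (forall v, sc_mul (j v) (j v) = sc_scale (qf A v) (sc_one C)) /\
  forall (D : scalg K) (j' : 'rV[K]_m -> sc_elt K D),
    sc_ok D ->
    (forall (a : K) u v, j' (a *: u + v) = sc_scale a (j' u) + j' v) ->
    (forall v, sc_mul (j' v) (j' v) = sc_scale (qf A v) (sc_one D)) ->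
    exists phi : sc_elt K C -> sc_elt K D,
      (sc_hom phi /\ forall v, phi (j v) = j' v) /\
      forall psi : sc_elt K C -> sc_elt K D,
        sc_hom psi -> (forall v, psi (j v) = j' v) -> forall x, psi x = phi x.

Arguments clifford_pair {K m} A C j.

(* trivial Clifford invariant: the Clifford algebra (central simple of
   dimension 2^m, m even) is split, i.e. isomorphic to M_{2^(m/2)}(K) *)
Definition clifford_trivial (K : fieldType) (m : nat) (A : 'M[K]_m) : Prop :=
  exists (C : scalg K) (j : 'rV[K]_m -> sc_elt K C),
    clifford_pair A C j /\ sc_iso C (matalg K (2 ^ m./2)).

(* I_q^3 K = 0 : every class in I_q^2 K (even-dim. nonsingular forms with
   trivial discriminant/Arf invariant) with trivial Clifford invariant is 0
   in the Witt group *)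
Definition I3_zero (K : fieldType) : Prop :=
  forall (m : nat) (A : 'M[K]_m),
    ~~ odd m -> nonsingular A -> disc_trivial A -> clifford_trivial A ->
    witt_zero A.

Definition cd2_le2 (F : fieldType) : Prop :=
  forall L : fieldExtType F, I3_zero L.

Definition two_field (F : fieldType) : Prop :=
  forall L : fieldExtType F, odd (\dim (fullv : {vspace L})) ->
    \dim (fullv : {vspace L}) = 1%N.

(* Main.v *)
(** Let [A] be the tensor product of the [Q i], and let the [i]-th factor have the
first slot [a i]. The form [q = N_omega perp (perp_i - b i N_(a i))] (with suitable
scalars [b i], where [N_omega] is a norm form whose discriminant cancels that of the
rest) has dimension [2n + 2] and trivial discriminant, and it comes with two linear
maps [s, t : V -> A] such that [s v * t v = t v * s v = q v] (the half-spin
representations). Conversely, for an orthogonal splitting of [V] into binary blocks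
[c N_d] and a vector [g] in the last of them, the elements [s v * t g] with [v] in
the other blocks satisfy the Clifford relations of a form of dimension [2n], and so
present [A] as a tensor product of [n] quaternion algebras whose first slots are
the [d]; the first block contributes a second slot [- q v * q g].

If [q'] is attached in the same way to the [Q' i], then [q perp - q'] has trivial
discriminant, and left and right multiplications make [A ^ 4] a module over its
Clifford algebra, which is therefore split. Hence [I_q^3 F = 0] makes
[q perp - q'] hyperbolic. If [n >= 2], splitting off the blocks of [a 0] from [q] and
of [a' 0] from [q'] leaves a totally isotropic subspace of dimension at least
[2n - 2 >= 2]: either it exhibits a binary block with a common [d], or orthogonal pairs
[v, g] and [v', g'] with [q v * q g = q' v' * q' g'], or isotropic vectors, which
make every product available. The two decompositions obtained from these data
share a slot with each other, and keep the slots [a 0] and [a' 0]. *)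
From HB Require Import structures.
From mathcomp Require Import all_boot all_order all_algebra all_field.
From mathcomp Require Import ssrAC ring zify.
Require Import Defs.
Set Implicit Arguments. Unset Strict Implicit. Unset Printing Implicit Defensive.
Import Order.TTheory GRing.Theory Num.Theory.
Local Open Scope ring_scope.

(** * Algebras given by structure constants *)

(** As far as possible the characteristic is not split: quaternion algebras are written with
    [x^2 = x + a] and binary forms as [c (u^2 + u v - d v^2)], so that [1 + 4 a] serves as
    discriminant everywhere. In characteristic 2 the polar form is alternating, hence forms are cut
    into binary blocks instead of being diagonalised. The theory of central simple algebras is
    replaced by explicit generators and counting: a homomorphism out of a tensor product of
    quaternion algebras is given by commuting quaternion pairs, is injective by a trace computation,
    and is an isomorphism once the dimensions agree. In particular [A ^ 4] has dimension
    [2 ^ (2 n + 2)], exactly the degree of the Clifford algebra of [q perp - q']. Dimension 2 is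
    required of the isotropic subspace because a slot is either the discriminant of a plane or a
    product of two values; one common value would not determine a slot. For [n = 1] the bound
    [2 n - 2] gives nothing, and the chain is written down directly. *)

Lemma prodr_mulr_comm (R : pzRingType) n (x y : 'I_n -> R) :
    (forall s t, s != t -> x s * y t = y t * x s) ->
  (\prod_t x t) * (\prod_t y t) = \prod_t (x t * y t).
Proof.
elim: n x y => [|n IH] x y xy; first by rewrite !big_ord0 mulr1.
rewrite !big_ord_recr /= -IH => [|s t st]; last exact/xy.
have xC : GRing.comm (x ord_max) (\prod_(i < n) y (widen_ord (leqnSn n) i)).
  apply: commr_prod => i _; apply: xy.
  by rewrite -val_eqE /= gtn_eqF.
by rewrite !mulrA; congr (_ * _); rewrite -!mulrA xC.
Qed.

Lemma prodr_eq_ffun (R : comPzRingType) n (T : eqType) (f g : {ffun 'I_n -> T}) :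
  \prod_t (f t == g t)%:R = (f == g)%:R :> R.
Proof.
have [->|/eqP fg] := eqVneq f g; first by rewrite big1 // => t _; rewrite eqxx.
have /existsP[t ft] : [exists t, f t != g t].
  rewrite -negb_forall; apply/forallP => E; apply: fg.
  by apply/ffunP => t; apply/eqP/E.
by rewrite (bigD1 t) //= (negbTE ft) mul0r.
Qed.

Section ScAlg.
Variable K : fieldType.
Implicit Types A B C : scalg K.

Lemma sc_ok_const A (o : sc_basis A) :
    (forall i j l k : sc_basis A, \sum_p sc_const i j p * sc_const p l k =
        \sum_p sc_const j l p * sc_const i p k) ->
    (forall j k : sc_basis A, sc_const o j k = (k == j)%:R) ->
    (forall j k : sc_basis A, sc_const j o k = (k == j)%:R) ->
    sc_one A = [ffun i => (i == o)%:R] ->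
  sc_ok A.
Proof.
move=> cA c1l c1r oE; split=> [x y z|x].
  apply/ffunP=> k; rewrite !ffunE.
  transitivity (\sum_i \sum_j \sum_l x i * y j * z l *
      \sum_p sc_const i j p * sc_const p l k).
    under eq_bigr => p _ do under eq_bigr => l _ do rewrite ffunE !mulr_suml.
    under eq_bigr => p _ do rewrite exchange_big /=.
    rewrite exchange_big /=; apply: eq_bigr => i _.
    under eq_bigr => p _ do
      (under eq_bigr => l _ do rewrite !mulr_suml; rewrite exchange_big /=).
    rewrite exchange_big /=; apply: eq_bigr => j _.
    rewrite exchange_big /=; apply: eq_bigr => l _.
    rewrite mulr_sumr; apply: eq_bigr => p _; ring.
  apply: eq_bigr => i _.
  under eq_bigr => j _ do under eq_bigr => l _ do rewrite cA mulr_sumr.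
  under [RHS]eq_bigr => p _ do rewrite ffunE mulr_sumr mulr_suml.
  rewrite [RHS]exchange_big /=; apply: eq_bigr => j _.
  under [RHS]eq_bigr => p _ do rewrite mulr_sumr mulr_suml.
  rewrite [RHS]exchange_big /=; apply: eq_bigr => l _.
  apply: eq_bigr => p _; ring.
split; apply/ffunP => k; rewrite ffunE oE.
  rewrite (bigD1 o) //= [X in _ + X]big1 ?addr0 => [|i /negbTE io]; last first.
    by rewrite big1 // => j _; rewrite ffunE io !mul0r.
  rewrite (bigD1 k) //= big1 ?addr0 => [|j /negbTE jk].
    by rewrite ffunE eqxx c1l eqxx mul1r mulr1.
  by rewrite c1l eq_sym jk mulr0.
rewrite (bigD1 k) //= [X in _ + X]big1 ?addr0 => [|i /negbTE ik]; last first.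
  rewrite big1 // => j _; rewrite ffunE.
  have [->|_] := eqVneq j o; last by rewrite mulr0 mul0r.
  by rewrite c1r eq_sym ik mulr0.
rewrite (bigD1 o) //= big1 ?addr0 => [|j /negbTE jo].
  by rewrite ffunE eqxx c1r eqxx !mulr1.
by rewrite ffunE jo mulr0 mul0r.
Qed.

Lemma sc_mulDl A (x y z : sc_elt K A) : sc_mul (x + y) z = sc_mul x z + sc_mul y z.
Proof.
apply/ffunP=> k; rewrite !ffunE -big_split; apply: eq_bigr => i _ /=.
by rewrite -big_split; apply: eq_bigr => j _; rewrite /= ffunE !mulrDl.
Qed.

Lemma sc_mulDr A (x y z : sc_elt K A) : sc_mul x (y + z) = sc_mul x y + sc_mul x z.
Proof.
apply/ffunP=> k; rewrite !ffunE -big_split; apply: eq_bigr => i _ /=.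
by rewrite -big_split; apply: eq_bigr => j _; rewrite /= ffunE mulrDr mulrDl.
Qed.

Lemma sc_mulZl A a (x y : sc_elt K A) :
  sc_mul (sc_scale a x) y = sc_scale a (sc_mul x y).
Proof.
apply/ffunP=> k; rewrite !ffunE mulr_sumr; apply: eq_bigr => i _ /=.
by rewrite mulr_sumr; apply: eq_bigr => j _; rewrite /= ffunE !mulrA.
Qed.

Lemma sc_mulZr A a (x y : sc_elt K A) :
  sc_mul x (sc_scale a y) = sc_scale a (sc_mul x y).
Proof.
apply/ffunP=> k; rewrite !ffunE mulr_sumr; apply: eq_bigr => i _ /=.
by rewrite mulr_sumr; apply: eq_bigr => j _; rewrite /= ffunE; ring.
Qed.

End ScAlg.

(** The zero algebra is excluded so that coordinate vectors can carry the ring structures of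
    MathComp, which ask for [1 != 0]. The type [sca] is convertible to [sc_elt], so results pass
    between the two without transport. *)
Record nzscalg (K : fieldType) := NzSCAlg {
  scbase :> scalg K;
  _ : sc_ok scbase;
  _ : sc_one scbase != 0 }.

Definition sca (K : fieldType) (A : nzscalg K) : Type :=
  {ffun sc_basis A -> K^o}.

HB.instance Definition _ K (A : nzscalg K) :=
  Vector.copy (sca A) {ffun sc_basis A -> K^o}.

Section ScaRing.
Variables (K : fieldType) (A : nzscalg K).

Fact sca_mulA : associative (@sc_mul K A : sca A -> sca A -> sca A).
Proof. by case: A => ? [? ?] ? x y z. Qed.
Fact sca_mul1l : left_id (sc_one A : sca A) (@sc_mul K A : sca A -> sca A -> sca A).
Proof. by case: A => ? [? h] ? x; case: (h x). Qed.
Fact sca_mul1r : right_id (sc_one A : sca A) (@sc_mul K A : sca A -> sca A -> sca A).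
Proof. by case: A => ? [? h] ? x; case: (h x). Qed.
Fact sca_one_neq0 : (sc_one A : sca A) != 0.
Proof. by case: A. Qed.

HB.instance Definition _ := GRing.Zmodule_isNzRing.Build (sca A)
  sca_mulA sca_mul1l sca_mul1r (@sc_mulDl K A) (fun x y z => @sc_mulDr K A x y z)
  sca_one_neq0.

Lemma sca_scaleE a (x : sca A) : a *: x = sc_scale a x.
Proof. by []. Qed.

Fact sca_scaleAl (a : K) (u v : sca A) : a *: (u * v) = (a *: u) * v.
Proof. by rewrite !sca_scaleE -[LHS]sc_mulZl. Qed.
HB.instance Definition _ := GRing.Lmodule_isLalgebra.Build K (sca A) sca_scaleAl.
Fact sca_scaleAr (a : K) (u v : sca A) : a *: (u * v) = u * (a *: v).
Proof. by rewrite !sca_scaleE -[LHS]sc_mulZr. Qed.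
HB.instance Definition _ := GRing.Lalgebra_isAlgebra.Build K (sca A) sca_scaleAr.

Definition scb (k : sc_basis A) : sca A := [ffun i => (i == k)%:R].

Lemma sca_sum (x : sca A) : x = \sum_k x k *: scb k.
Proof.
apply/ffunP => i; rewrite sum_ffunE (bigD1 i) //= big1 ?addr0.
  by rewrite !ffunE eqxx; rewrite /GRing.scale /= mulr1.
by move=> j /negbTE ji; rewrite !ffunE eq_sym ji scaler0.
Qed.

Lemma dim_sca : \dim {: sca A} = #|sc_basis A|.
Proof. by rewrite dimvf /dim /= muln1. Qed.

End ScaRing.

(** * Tensor products of quaternion algebras *)

Section Tensor.
Variable K : fieldType.
Implicit Types (c : 'I_4 -> 'I_4 -> 'I_4 -> K).

Definition calg c : scalg K := SCAlg c [ffun i => (i == ord0)%:R].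

Definition ctens n (c : 'I_n -> 'I_4 -> 'I_4 -> 'I_4 -> K) : scalg K :=
  @SCAlg K {ffun 'I_n -> 'I_4} (fun i j k => \prod_t c t (i t) (j t) (k t))
    [ffun i => (i == [ffun => ord0])%:R].

Definition assoc_const c :=
  [/\ forall i j l k, \sum_p c i j p * c p l k = \sum_p c j l p * c i p k,
      forall j k, c ord0 j k = (k == j)%:R & forall j k, c j ord0 k = (k == j)%:R].

Lemma calg_ok c : assoc_const c -> sc_ok (calg c).
Proof. by case=> cA cl cr; apply: (@sc_ok_const _ (calg c) ord0). Qed.

Lemma calg_nz c : sc_one (calg c) != 0.
Proof. by apply/eqP => /ffunP/(_ ord0)/eqP; rewrite !ffunE eqxx oner_eq0. Qed.

Lemma ctens_ok n (c : 'I_n -> _) : (forall t, assoc_const (c t)) -> sc_ok (ctens c).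
Proof.
move=> cA; apply: (@sc_ok_const _ (ctens c) [ffun => ord0]) => //=.
- move=> i j l k; under eq_bigr => p _ do rewrite -big_split /=.
  under [RHS]eq_bigr => p _ do rewrite -big_split /=.
  rewrite -(bigA_distr_bigA (fun t p => c t (i t) (j t) p * c t p (l t) (k t))).
  rewrite -(bigA_distr_bigA (fun t p => c t (j t) (l t) p * c t (i t) p (k t))).
  by apply: eq_bigr => t _; case: (cA t).
- move=> j k; rewrite -prodr_eq_ffun; apply: eq_bigr => t _.
  by case: (cA t) => _ cl _; rewrite ffunE cl.
- move=> j k; rewrite -prodr_eq_ffun; apply: eq_bigr => t _.
  by case: (cA t) => _ _ cr; rewrite ffunE cr.
Qed.

Lemma ctens_nz n (c : 'I_n -> _) : sc_one (ctens c) != 0.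
Proof.
by apply/eqP => /ffunP/(_ [ffun => ord0])/eqP; rewrite !ffunE eqxx oner_eq0.
Qed.

Section Pure.
Variables (n : nat) (c : 'I_n -> 'I_4 -> 'I_4 -> 'I_4 -> K).
Hypothesis cA : forall t, assoc_const (c t).

Definition ctensA : nzscalg K := NzSCAlg (ctens_ok cA) (ctens_nz c).
Definition calgA t : nzscalg K := NzSCAlg (calg_ok (cA t)) (calg_nz (c t)).

Definition pure (z : forall t, sca (calgA t)) : sca ctensA :=
  [ffun f : {ffun 'I_n -> 'I_4} => \prod_t z t (f t)].

Lemma pureM z w : pure z * pure w = pure (fun t => z t * w t).
Proof.
apply/ffunP=> k; rewrite !ffunE.
transitivity (\sum_(f : {ffun 'I_n -> 'I_4}) \sum_(g : {ffun 'I_n -> 'I_4})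
   \prod_t (z t (f t) * w t (g t) * c t (f t) (g t) (k t))).
  by apply: eq_bigr => f _; apply: eq_bigr => g _; rewrite !ffunE -!big_split.
transitivity (\sum_(f : {ffun 'I_n -> 'I_4}) \prod_t \sum_j
    z t (f t) * w t j * c t (f t) j (k t)).
  by apply: eq_bigr => f _; rewrite bigA_distr_bigA.
rewrite -(bigA_distr_bigA (fun t i => \sum_j z t i * w t j * c t i j (k t))).
by apply: eq_bigr => t _; rewrite ffunE.
Qed.

Lemma pure1 : pure (fun t => 1) = 1.
Proof.
apply/ffunP=> k; rewrite !ffunE -prodr_eq_ffun.
by apply: eq_bigr => t _; rewrite !ffunE.
Qed.

Definition tinj i (z : sca (calgA i)) : sca ctensA :=
  pure (dfwith (fun t => 1 : sca (calgA t)) z).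

Lemma pure_linear i (w : forall t, sca (calgA t)) :
  linear (fun z : sca (calgA i) => pure (dfwith w z)).
Proof.
move=> k u v; apply/ffunP=> f; rewrite !ffunE.
have E (z : sca (calgA i)) :
    \prod_t dfwith w z t (f t) = z (f i) * \prod_(t | t != i) w t (f t).
  rewrite (bigD1 i) //= dfwith_in; congr (_ * _).
  by apply: eq_bigr => t ti; rewrite dfwith_out // eq_sym.
by rewrite !E !ffunE /GRing.scale /= /GRing.scale /= mulrDl mulrA.
Qed.

Lemma tinj_linear i : linear (@tinj i). Proof. exact: pure_linear. Qed.

HB.instance Definition _ i := GRing.isLinear.Build K _ _ _ (@tinj i) (@tinj_linear i).

Lemma eq_pure z w : (forall t, z t = w t) -> pure z = pure w.
Proof. by move=> E; apply/ffunP=> f; rewrite !ffunE; apply: eq_bigr => t _; rewrite E. Qed.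

Lemma tinjM i : {morph @tinj i : z w / z * w}.
Proof.
move=> z w; rewrite pureM; apply: eq_pure => t.
by have [->|it] := eqVneq t i; rewrite ?dfwith_in // !dfwith_out ?mulr1 // eq_sym.
Qed.

Lemma tinj1 i : tinj (1 : sca (calgA i)) = 1.
Proof.
rewrite -pure1; apply: eq_pure => t.
by have [->|it] := eqVneq t i; rewrite ?dfwith_in // !dfwith_out // eq_sym.
Qed.

Lemma tinj_comm i j (z : sca (calgA i)) (w : sca (calgA j)) :
  i != j -> tinj z * tinj w = tinj w * tinj z.
Proof.
move=> ij; rewrite !pureM; apply: eq_pure => t.
have [->|it] := eqVneq t i; first by rewrite dfwith_in dfwith_out 1?eq_sym ?mulr1 ?mul1r.
by rewrite [dfwith _ z t]dfwith_out 1?eq_sym // mulr1 mul1r.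
Qed.

End Pure.
End Tensor.

Section Tables.
Variable K : fieldType.

Definition utab (a b : K) (i j : nat) : seq K :=
  match i, j with
  | 0, _ => unit_seq K j
  | _, 0 => unit_seq K i
  | 1, 1 => [:: a; 1; 0; 0]
  | 1, 2 => [:: 0; 0; 0; 1]
  | 1, 3 => [:: 0; 0; a; 1]
  | 2, 1 => [:: 0; 0; 1; -1]
  | 2, 2 => [:: b; 0; 0; 0]
  | 2, 3 => [:: b; - b; 0; 0]
  | 3, 1 => [:: 0; 0; - a; 0]
  | 3, 2 => [:: 0; b; 0; 0]
  | _, _ => [:: - (a * b); 0; 0; 0]
  end.

(* Characteristic-free presentation [x^2 = x + a], [y^2 = b], [y x = (1 - x) y],
   with basis [1, x, y, xy]. *)
Definition uconst (p : K * K) (i j k : 'I_4) : K := nth 0 (utab p.1 p.2 i j) k.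

Lemma uconst_assoc p : assoc_const (uconst p).
Proof.
split.
- rewrite /uconst => i j l k; rewrite !big_ord_recl !big_ord0.
  case: i => [[|[|[|[|//]]]] ?]; case: j => [[|[|[|[|//]]]] ?];
  case: l => [[|[|[|[|//]]]] ?]; case: k => [[|[|[|[|//]]]] ?] /=; ring.
- by move=> [[|[|[|[|//]]]] ?] [[|[|[|[|//]]]] ?].
- by move=> [[|[|[|[|//]]]] ?] [[|[|[|[|//]]]] ?].
Qed.

Lemma qconst_char2 (p : K * K) i j k : char2 K -> qconst p i j k = uconst p i j k.
Proof.
move=> c2; rewrite /qconst c2 /uconst.
have N1 x : - x = x :> K by rewrite oppr_pchar2.
by move: i j k => [[|[|[|[|//]]]] ?] [[|[|[|[|//]]]] ?] [[|[|[|[|//]]]] ?];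
  rewrite /= ?N1.
Qed.

Lemma qconst_assoc p : assoc_const (@qconst K p).
Proof.
have [c2|c2] := boolP (char2 K).
  have [uA ul ur] := uconst_assoc p; split=> *; rewrite ?qconst_char2 //.
  by under eq_bigr do rewrite !qconst_char2 //;
     under [RHS]eq_bigr do rewrite !qconst_char2 //.
rewrite /qconst (negbTE c2); split.
- move=> i j l k; rewrite !big_ord_recl !big_ord0.
  case: i => [[|[|[|[|//]]]] ?]; case: j => [[|[|[|[|//]]]] ?];
  case: l => [[|[|[|[|//]]]] ?]; case: k => [[|[|[|[|//]]]] ?] /=; ring.
- by move=> [[|[|[|[|//]]]] ?] [[|[|[|[|//]]]] ?].
- by move=> [[|[|[|[|//]]]] ?] [[|[|[|[|//]]]] ?].
Qed.

End Tables.

(** * Homomorphisms out of a tensor product of quaternion algebras *)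

Section Engine.
Variables (K : fieldType) (D : algType K) (n : nat).
Variables (c : 'I_n -> 'I_4 -> 'I_4 -> 'I_4 -> K) (cA : forall t, assoc_const (c t)).
Variable E : 'I_n -> 'I_4 -> D.
Hypothesis E0 : forall t, E t ord0 = 1.
Hypothesis EM : forall t k l, E t k * E t l = \sum_m c t k l m *: E t m.
Hypothesis EC : forall s t k l, s != t -> E s k * E t l = E t l * E s k.

Definition tens_map (f : sca (ctensA cA)) : D := \sum_k f k *: \prod_t E t (k t).

Lemma tens_map_pure (z : forall t, sca (calgA cA t)) :
  tens_map (pure z) = \prod_t \sum_k z t k *: E t k.
Proof.
rewrite bigA_distr_bigA; apply: eq_bigr => k _.
by rewrite ffunE; apply/esym/scaler_prod.
Qed.

Lemma tens_map_linear : linear tens_map.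
Proof.
move=> a u v; rewrite /tens_map scaler_sumr -big_split; apply: eq_bigr => k _ /=.
by rewrite !ffunE scalerDl scalerA.
Qed.

Lemma tens_map_monoid : monoid_morphism tens_map.
Proof.
split.
  rewrite -(pure1 cA) tens_map_pure big1 // => t _.
  rewrite (bigD1 ord0) //= ffunE eqxx scale1r E0 big1 ?addr0 // => k /negbTE k0.
  by rewrite ffunE k0 scale0r.
move=> u v; rewrite [RHS]mulr_suml.
transitivity (\sum_i \sum_j (u i * v j) *: ((\prod_t E t (i t)) * \prod_t E t (j t))).
  rewrite /tens_map; under eq_bigr => k _ do rewrite ffunE scaler_suml.
  rewrite exchange_big /=; apply: eq_bigr => i _.
  under eq_bigr => k _ do rewrite scaler_suml.
  rewrite exchange_big /=; apply: eq_bigr => j _.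
  under eq_bigr => k _ do rewrite -scalerA; rewrite -scaler_sumr; congr (_ *: _).
  rewrite prodr_mulr_comm => [|s t st]; last exact: EC.
  under [RHS]eq_bigr => t _ do rewrite EM.
  rewrite bigA_distr_bigA; apply: eq_bigr => k _.
  exact/esym/scaler_prod.
apply: eq_bigr => i _; rewrite mulr_sumr; apply: eq_bigr => j _.
by rewrite -[RHS]scalerAl -[in RHS]scalerAr scalerA.
Qed.

Lemma tens_map_ex : exists phi : {lrmorphism sca (ctensA cA) -> D},
  forall z, phi (pure z) = \prod_t \sum_k z t k *: E t k.
Proof.
pose M1 := GRing.isLinear.Build K _ _ _ tens_map tens_map_linear.
pose M2 := GRing.isMonoidMorphism.Build _ _ tens_map tens_map_monoid.
pose phi : {lrmorphism sca (ctensA cA) -> D} := HB.pack tens_map M1 M2.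
by exists phi => z; apply: tens_map_pure.
Qed.

Section Injective.
Variable V : 'I_n -> 'I_4 -> 'I_4 -> D.
Hypothesis EV : forall s t k k0 j, s != t -> E s k * V t k0 j = V t k0 j * E s k.
Hypothesis dualV : forall t k k0,
  \sum_j E t j * E t k * V t k0 j = (k == k0)%:R.

(** The coefficient [f k0] is recovered from the image: the sum of [E_J * tens_map f * V_J] over all
    multi-indices [J] factors through the [n] slots by the commutation hypotheses, and [dualV] makes
    each factor a Kronecker delta. This stands in for the simplicity of the tensor product. *)
Lemma tens_map_eq0 f : tens_map f = 0 -> f = 0.
Proof.
move=> f0; apply/ffunP => k0; rewrite ffunE.
suff: (f k0)%:A = 0 :> D by move/eqP; rewrite scaler_eq0 oner_eq0 orbF => /eqP.
transitivity (\sum_(J : {ffun 'I_n -> 'I_4})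
    (\prod_t E t (J t)) * tens_map f * \prod_t V t (k0 t) (J t)); last first.
  by rewrite big1 // => J _; rewrite f0 mulr0 mul0r.
transitivity (\sum_k f k *: \prod_t \sum_j E t j * E t (k t) * V t (k0 t) j).
  rewrite (bigD1 k0) //= [X in _ + X]big1 ?addr0.
    by under [in RHS]eq_bigr => t _ do rewrite dualV eqxx; rewrite prodr_const expr1n.
  move=> k /eqP kk0; have /existsP[t kt] : [exists t, k t != k0 t].
    rewrite -negb_forall; apply/forallP => H; apply: kk0.
    by apply/ffunP => t; apply/eqP.
  under eq_bigr => s _ do rewrite dualV.
  suff -> : \prod_s (k s == k0 s)%:R = 0 :> D by rewrite scaler0.
  have -> : \prod_s (k s == k0 s)%:R = (\prod_s (k s == k0 s))%N%:R :> D.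
    by rewrite natr_prod.
  by rewrite (bigD1 t) //= (negbTE kt) mul0n.
under eq_bigr => k _ do rewrite bigA_distr_bigA scaler_sumr.
rewrite exchange_big /=; apply: eq_bigr => J _.
rewrite mulr_sumr mulr_suml; apply: eq_bigr => k _.
rewrite -scalerAr -scalerAl; congr (_ *: _).
rewrite [X in _ = X * _]prodr_mulr_comm => [|s t st]; last exact: EC.
rewrite prodr_mulr_comm // => s t st.
by rewrite -mulrA EV // mulrA EV // mulrA.
Qed.

End Injective.
End Engine.

Lemma linear_inj_bij (K : fieldType) (U V : vectType K) (f : {linear U -> V}) :
  (forall x, f x = 0 -> x = 0) -> \dim {:U} = \dim {:V} -> bijective f.
Proof.
move=> f0 dUV; have fE x : linfun f x = f x by rewrite lfunE.
have ker0 : lker (linfun f) == 0%VS.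
  by apply/lker0P => x y; rewrite !fE => E; apply/eqP; rewrite -subr_eq0;
     apply/eqP/f0; rewrite linearB /= E subrr.
have img : limg (linfun f) = fullv.
  by apply/eqP; rewrite eqEdim subvf /= limg_dim_eq ?dUV // (eqP ker0) capv0.
exists (linfun f)^-1%VF => x; first by rewrite -fE lker0_lfunK.
by rewrite -fE limg_lfunVK // img memvf.
Qed.

Section ScIso.
Variable K : fieldType.

Lemma lrmorphism_hom (A B : nzscalg K) (f : {lrmorphism sca A -> sca B}) :
  @sc_hom K A B f.
Proof.
split; last by split; [exact: (rmorphM f) | exact: (rmorph1 f)].
by move=> a x y; apply: (linearP f).
Qed.

Lemma hom_lrmorphism (A B : nzscalg K) (f : sca A -> sca B) :
  @sc_hom K A B f -> exists g : {lrmorphism sca A -> sca B}, g =1 f.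
Proof.
move=> [fL [fM f1]].
have fL' : linear f by [].
pose M1 := GRing.isLinear.Build K (sca A) (sca B) _ f fL'.
pose M2 := GRing.isMonoidMorphism.Build (sca A) (sca B) f (conj f1 fM).
by exists (HB.pack_for {lrmorphism sca A -> sca B} f M1 M2).
Qed.

Lemma lrmorphism_iso (A B : nzscalg K) (f : {lrmorphism sca A -> sca B}) :
    (forall x, f x = 0 -> x = 0) -> #|sc_basis A| = #|sc_basis B| ->
  sc_iso A B.
Proof.
move=> f0 dAB; exists f; split; first exact: lrmorphism_hom.
by apply: (linear_inj_bij f0); rewrite !dim_sca.
Qed.

Lemma sc_iso_sym (A B : scalg K) : sc_iso A B -> sc_iso B A.
Proof.
move=> [f [[fL [fM f1]] [g fK gK]]]; exists g; split; last by exists f.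
split; first by move=> a x y; apply: (can_inj fK); rewrite fL !gK.
split; first by move=> x y; apply: (can_inj fK); rewrite fM !gK.
by apply: (can_inj fK); rewrite f1 gK.
Qed.

Lemma sc_iso_trans (A B C : scalg K) : sc_iso A B -> sc_iso B C -> sc_iso A C.
Proof.
move=> [f [[fL [fM f1]] fb]] [g [[gL [gM g1]] gb]]; exists (g \o f).
split; last exact: bij_comp.
split; first by move=> a x y /=; rewrite fL gL.
split; first by move=> x y /=; rewrite fM gM.
by rewrite /= f1 g1.
Qed.

Lemma sc_iso_refl (A : scalg K) : sc_iso A A.
Proof. by exists id; split; [|exists id]. Qed.

End ScIso.

Section CAlg.
Variables (K : fieldType) (n : nat) (c : 'I_n -> 'I_4 -> 'I_4 -> 'I_4 -> K).
Variables (cA : forall t, assoc_const (c t)) (t : 'I_n).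

Definition cb (k : 'I_4) : sca (calgA cA t) := scb (k : sc_basis (calgA cA t)).

Lemma cbM k l : cb k * cb l = [ffun m => c t k l m].
Proof.
apply/ffunP => m; rewrite !ffunE.
rewrite (bigD1 k) //= [X in _ + X]big1 ?addr0; last first.
  by move=> q /negbTE qk; apply: big1 => r _; rewrite !ffunE qk !mul0r.
rewrite (bigD1 l) //= big1 ?addr0; last first.
  by move=> q /negbTE ql; rewrite !ffunE ql mulr0 mul0r.
by rewrite !ffunE !eqxx !mul1r.
Qed.

End CAlg.

Section PureProd.
Variables (K : fieldType) (n : nat) (c : 'I_n -> 'I_4 -> 'I_4 -> 'I_4 -> K).
Variable cA : forall t, assoc_const (c t).

Lemma pure_prod (z : forall t, sca (calgA cA t)) : pure z = \prod_t tinj (z t).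
Proof.
suff H (r : seq 'I_n) : uniq r ->
    \prod_(t <- r) tinj (z t) = pure (fun t => if t \in r then z t else 1).
  rewrite /index_enum H; last exact: index_enum_uniq.
  by apply: eq_pure => t; rewrite mem_index_enum.
elim: r => [|s r IH] /=; first by rewrite big_nil pure1.
case/andP=> sr ur; rewrite big_cons IH // pureM; apply: eq_pure => t.
rewrite inE; have [->|ts] := eqVneq t s; last by rewrite dfwith_out 1?eq_sym ?mul1r.
by rewrite dfwith_in (negbTE sr) mulr1.
Qed.

Lemma scb_pure (k : {ffun 'I_n -> 'I_4}) :
  scb (k : sc_basis (ctensA cA)) = pure (fun t => scb (k t : sc_basis (calgA cA t))).
Proof.
apply/ffunP=> f; rewrite !ffunE -prodr_eq_ffun; apply: eq_bigr => t _.
by rewrite ffunE.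
Qed.

End PureProd.

(** * Quaternion pairs and the reduced trace *)

Section Quat.
Variables (K : fieldType) (D : algType K).

Definition qpair (a b : K) (x y : D) :=
  [/\ x * x = x + a%:A, y * y = b%:A & y * x = (1 - x) * y].

Definition qbasis (x y : D) (k : 'I_4) : D := nth 0 [:: 1; x; y; x * y] k.

Lemma qbasisM a b x y k l : qpair a b x y ->
  qbasis x y k * qbasis x y l = \sum_m uconst (a, b) k l m *: qbasis x y m.
Proof.
case=> xx yy yx.
have xxy : x * (x * y) = a *: y + x * y.
  by rewrite mulrA xx mulrDl -scalerAl mul1r addrC.
have yxy : y * (x * y) = b *: 1 - b *: x.
  by rewrite mulrA yx -mulrA yy -scalerAr mulr1 scalerBr.
have xyx : x * y * x = - (a *: y).
  rewrite -mulrA yx mulrA mulrBr mulr1 xx opprD addNKr.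
  by rewrite mulNr -scalerAl mul1r.
have xyy : x * y * y = b *: x by rewrite -mulrA yy -scalerAr mulr1.
have xyxy : x * y * (x * y) = - (a * b) *: 1.
  by rewrite mulrA xyx mulNr -scalerAl yy scalerA scaleNr.
rewrite !big_ord_recl big_ord0 addr0 /qbasis /uconst.
case: k => [[|[|[|[|//]]]] ?]; case: l => [[|[|[|[|//]]]] ?] /=;
  rewrite ?mul1r ?mulr1 ?xx ?yy ?yx ?xxy ?yxy ?xyx ?xyy ?xyxy
    ?scale0r ?add0r ?scale1r ?addr0 ?scaleNr ?scale1r //.
- by rewrite addrC.
- by rewrite mulrBl mul1r.
Qed.

(* Dual basis of [1, x, y, xy] for the reduced trace form. *)
Definition qdual (a b : K) (j k : 'I_4) : K :=
  nth 0 (nth [::] [:: [:: (1 + 2 * a) / (1 + 4 * a); - (1 + 4 * a)^-1; 0; 0];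
     [:: - (1 + 4 * a)^-1; 2 / (1 + 4 * a); 0; 0];
     [:: 0; 0; 2 * a / (b * (1 + 4 * a)); (b * (1 + 4 * a))^-1];
     [:: 0; 0; (b * (1 + 4 * a))^-1; - 2 / (b * (1 + 4 * a))]] j) k.

(** Reduced traces of [1], [x], [y], [xy]. *)
Definition qtrd (k : 'I_4) : K := nth 0 [:: 2; 1; 0; 0] k.

(** This is [Trd (e_k * e'_k0) = delta] for the dual basis [e']; the denominators come from
    inverting the trace form on the planes [1, x] and [y, xy]. *)
Lemma qdual_trd a b k k0 : b != 0 -> 1 + 4 * a != 0 ->
  \sum_p \sum_q qdual a b k0 q * uconst (a, b) k q p * qtrd p = (k == k0)%:R.
Proof.
move=> b0 a0; rewrite !big_ord_recl !big_ord0 /qdual /uconst /qtrd.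
by case: k => [[|[|[|[|//]]]] ?]; case: k0 => [[|[|[|[|//]]]] ?] /=; field;
  rewrite ?b0 ?a0.
Qed.

(** The Casimir identity [sum_j e_j z e'_j = Trd z] at [z = e_l]. *)
Lemma qdual_sum a b l m : b != 0 -> 1 + 4 * a != 0 ->
  \sum_j \sum_p \sum_q uconst (a, b) j l p * qdual a b j q * uconst (a, b) p q m
    = qtrd l * (m == ord0)%:R.
Proof.
move=> b0 a0; rewrite !big_ord_recl !big_ord0 /qdual /uconst /qtrd.
by case: l => [[|[|[|[|//]]]] ?]; case: m => [[|[|[|[|//]]]] ?] /=; field;
  rewrite ?b0 ?a0.
Qed.

(** The product [e'_k0 * e'_j]: the Casimir identity at [z = e_k e'_k0] then returns
    [Trd (e_k e'_k0)], a Kronecker delta. *)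
Definition qcoef a b (x y : D) (k0 j : 'I_4) : D :=
  (\sum_q qdual a b k0 q *: qbasis x y q) * (\sum_q qdual a b j q *: qbasis x y q).

Lemma qcoefE a b x y k k0 : qpair a b x y -> b != 0 -> 1 + 4 * a != 0 ->
  \sum_j qbasis x y j * qbasis x y k * qcoef a b x y k0 j = (k == k0)%:R.
Proof.
move=> xy b0 a0; pose E := qbasis x y.
have EM k1 l : E k1 * E l = \sum_m uconst (a, b) k1 l m *: E m by apply: qbasisM.
have tr l : \sum_j E j * E l * (\sum_q qdual a b j q *: E q) = (qtrd l)%:A.
  transitivity (\sum_m (\sum_j \sum_p \sum_q
     uconst (a, b) j l p * qdual a b j q * uconst (a, b) p q m) *: E m).
    under [RHS]eq_bigr => m _ do rewrite scaler_suml.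
    rewrite [RHS]exchange_big /=; apply: eq_bigr => j _.
    rewrite EM mulr_suml.
    under [RHS]eq_bigr => m _ do rewrite scaler_suml.
    rewrite [RHS]exchange_big /=; apply: eq_bigr => p _.
    under [RHS]eq_bigr => m _ do rewrite scaler_suml.
    rewrite [RHS]exchange_big /= mulr_sumr; apply: eq_bigr => q _.
    rewrite -scalerAr -scalerAl EM !scaler_sumr; apply: eq_bigr => m _.
    by rewrite !scalerA; congr (_ *: _); ring.
  under eq_bigr => m _ do rewrite qdual_sum //.
  rewrite (bigD1 ord0) //= mulr1 big1 ?addr0 // => m /negbTE ->.
  by rewrite mulr0 scale0r.
transitivity (\sum_p (\sum_q qdual a b k0 q * uconst (a, b) k q p * qtrd p)%:A : D).
  transitivity (\sum_p (\sum_q qdual a b k0 q * uconst (a, b) k q p) *: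
      (qtrd p)%:A : D); last first.
    by apply: eq_bigr => p _; rewrite scalerA mulr_suml.
  under [RHS]eq_bigr => p _ do rewrite -tr scaler_sumr.
  rewrite [RHS]exchange_big /=; apply: eq_bigr => j _.
  rewrite /qcoef !mulrA -[E j * E k * _]mulrA.
  have -> : E k * (\sum_q qdual a b k0 q *: E q) =
      \sum_p (\sum_q qdual a b k0 q * uconst (a, b) k q p) *: E p.
    rewrite mulr_sumr; under [RHS]eq_bigr => p _ do rewrite scaler_suml.
    rewrite [RHS]exchange_big /=; apply: eq_bigr => q _.
    rewrite -scalerAr EM scaler_sumr; apply: eq_bigr => p _.
    by rewrite scalerA.
  rewrite [E j * _]mulr_sumr mulr_suml; apply: eq_bigr => p _.
  by rewrite -scalerAr -scalerAl.
by rewrite -scaler_suml qdual_trd // scaler_nat.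
Qed.

Record qsys n (a b : 'I_n -> K) (x y : 'I_n -> D) : Prop := QSys {
  qsys_pair : forall i, qpair (a i) (b i) (x i) (y i);
  qsys_xx : forall i j, x i * x j = x j * x i;
  qsys_xy : forall i j, i != j -> x i * y j = y j * x i;
  qsys_yy : forall i j, y i * y j = y j * y i }.

Lemma qsys_comm n a b x y : @qsys n a b x y -> forall s t k l, s != t ->
  qbasis (x s) (y s) k * qbasis (x t) (y t) l =
  qbasis (x t) (y t) l * qbasis (x s) (y s) k.
Proof.
move=> [_ xx xy yy] s t k l st; have ts : t != s by rewrite eq_sym.
have yx : y s * x t = x t * y s by rewrite xy.
suff {l} H (w : D) : x s * w = w * x s -> y s * w = w * y s ->
    qbasis (x s) (y s) k * w = w * qbasis (x s) (y s) k.
  apply: H; rewrite /qbasis; case: l => [[|[|[|[|//]]]] ?] /=; rewrite ?mulr1 ?mul1r //.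
  - exact: xy.
  - by rewrite mulrA xx -mulrA xy // mulrA.
  - by rewrite mulrA yx -mulrA yy mulrA.
rewrite /qbasis; case: k => [[|[|[|[|//]]]] ?] /= xw yw; rewrite ?mulr1 ?mul1r //.
by rewrite -mulrA yw mulrA xw mulrA.
Qed.

End Quat.

Section TensU.
Variable K : fieldType.

Lemma tensU_assoc n (a b : 'I_n -> K) t : assoc_const (uconst (a t, b t)).
Proof. exact: uconst_assoc. Qed.

Definition tensU n (a b : 'I_n -> K) : nzscalg K := ctensA (tensU_assoc a b).

Definition ub n (a b : 'I_n -> K) i (k : 'I_4) : sca (calgA (tensU_assoc a b) i) :=
  scb (k : sc_basis (calgA (tensU_assoc a b) i)).
Definition ux n (a b : 'I_n -> K) i : sca (tensU a b) := tinj (ub a b i (inord 1)).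
Definition uy n (a b : 'I_n -> K) i : sca (tensU a b) := tinj (ub a b i (inord 2)).

(** Universal property of the tensor product. Injectivity holds because [b i != 0] and
    [1 + 4 a i != 0] make every trace form nondegenerate, so that the dual bases exist. *)
Lemma tensU_map (D : algType K) n (a b : 'I_n -> K) (x y : 'I_n -> D) :
  qsys a b x y -> exists phi : {lrmorphism sca (tensU a b) -> D},
    [/\ forall i, phi (ux a b i) = x i, forall i, phi (uy a b i) = y i &
      (forall i, b i != 0) -> (forall i, 1 + 4 * a i != 0) ->
      forall u, phi u = 0 -> u = 0].
Proof.
move=> xy; have xyC := qsys_comm xy.
pose E t k := qbasis (x t) (y t) k.
have EM t k l : E t k * E t l = \sum_m uconst (a t, b t) k l m *: E t m.
  exact/qbasisM/(qsys_pair xy).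
have [phi phiE] := tens_map_ex (tensU_assoc a b) (fun t => erefl : E t ord0 = 1) EM xyC.
have phi_tinj i k : phi (tinj (ub a b i k)) = E i k.
  rewrite phiE (big_only1 i) //= => [|t ti _].
    rewrite dfwith_in (bigD1 k) //= ffunE eqxx scale1r big1 ?addr0 // => l /negbTE lk.
    by rewrite ffunE lk scale0r.
  rewrite dfwith_out 1?eq_sym // (bigD1 ord0) //= ffunE eqxx scale1r big1 ?addr0 // => l.
  by move/negbTE=> lk; rewrite ffunE lk scale0r.
exists phi; split=> [i|i|b0 a0 u u0].
- by rewrite phi_tinj /E /qbasis inordK.
- by rewrite phi_tinj /E /qbasis inordK.
pose V t := qcoef (a t) (b t) (x t) (y t).
apply: (@tens_map_eq0 _ _ _ _ (tensU_assoc a b) E xyC V).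
- move=> s t k k0 j st; rewrite /V /qcoef.
  have C (w : 'I_4 -> K) : E s k * (\sum_q w q *: E t q) = (\sum_q w q *: E t q) * E s k.
    rewrite mulr_sumr mulr_suml; apply: eq_bigr => q _.
    by rewrite -scalerAr -scalerAl xyC.
  by rewrite mulrA C -mulrA C mulrA.
- by move=> t k k0; apply: qcoefE => //; apply: (qsys_pair xy).
rewrite -[RHS]u0 [in RHS](sca_sum u) linear_sum; apply: eq_bigr => k _.
rewrite linearZ /= scb_pure phiE; congr (_ *: _); apply: eq_bigr => t _.
rewrite (bigD1 (k t)) //= ffunE eqxx scale1r big1 ?addr0 // => l /negbTE lk.
by rewrite ffunE lk scale0r.
Qed.

Lemma tensU_qsys n (a b : 'I_n -> K) : qsys a b (ux a b) (uy a b).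
Proof.
have S i (k l : 'I_4) : ub a b i k * ub a b i l =
    \sum_m uconst (a i, b i) k l m *: ub a b i m.
  apply/ffunP => m; rewrite cbM ffunE sum_ffunE (bigD1 m) //= big1 ?addr0.
    by rewrite !ffunE eqxx /GRing.scale /= mulr1.
  by move=> q /negbTE qm; rewrite !ffunE eq_sym qm scaler0.
have S0 i : ub a b i ord0 = 1 by [].
have I1 : inord 1 = lift ord0 ord0 :> 'I_4 by apply/val_inj; rewrite /= inordK.
have I2 : inord 2 = lift ord0 (lift ord0 ord0) :> 'I_4 by apply/val_inj; rewrite /= inordK.
split=> [i|i j|i j ij|i j].
- rewrite /ux /uy; split; rewrite -!tinjM S !big_ord_recl big_ord0 /uconst !inordK //= ?S0.
  + by rewrite !scale0r !addr0 scale1r -I1 linearD linearZ /= tinj1 addrC.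
  + by rewrite !scale0r !addr0 linearZ /= tinj1.
  rewrite scale0r add0r scale0r add0r scale1r addr0 scaleN1r.
  rewrite mulrBl mul1r -tinjM S !big_ord_recl big_ord0 /uconst !inordK //=.
  by rewrite !scale0r !add0r scale1r addr0 linearB -I2.
- by have [->|ij] := eqVneq i j; last exact: tinj_comm.
- exact: tinj_comm.
- by have [->|ij] := eqVneq i j; last exact: tinj_comm.
Qed.

Lemma tensU_hom_eq (D : algType K) n (a b : 'I_n -> K)
    (phi psi : {lrmorphism sca (tensU a b) -> D}) :
    (forall i, phi (ux a b i) = psi (ux a b i)) ->
    (forall i, phi (uy a b i) = psi (uy a b i)) ->
  phi =1 psi.
Proof.
move=> ex ey u; rewrite (sca_sum u) !linear_sum; apply: eq_bigr => k _.
rewrite !linearZ /= scb_pure pure_prod !rmorph_prod; congr (_ *: _).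
apply: eq_bigr => t _; rewrite -/(ub a b t (k t)).
have S3 : ub a b t (inord 3) = ub a b t (inord 1) * ub a b t (inord 2).
  apply/ffunP => m; rewrite cbM !ffunE /uconst -val_eqE /= !inordK //.
  by case: m => [[|[|[|[|//]]]] ?].
have -> : k t = inord (k t) by apply/val_inj; rewrite /= inordK.
case: (k t) => [[|[|[|[|//]]]] ?] /=.
- have -> : inord 0 = ord0 :> 'I_4 by apply/val_inj; rewrite /= inordK.
  have -> : ub a b t ord0 = 1 by [].
  by rewrite tinj1 !rmorph1.
- exact: ex.
- exact: ey.
- by rewrite S3 tinjM !rmorphM; congr (_ * _); [apply: ex | apply: ey].
Qed.

End TensU.

(** * Symbols, uniform parameters and criteria for a common slot *)

Section Params.
Variable K : fieldType.
Implicit Types p : K * K.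

(* [slot] and [mkq] translate between the symbols of the statement and the
   uniform parameters: [x^2 = alpha] becomes [x'^2 = x' + (alpha - 1) / 4] for
   [x' = (1 + x) / 2]. *)
Definition slot p : K := if char2 K then p.1 else (p.1 - 1) / 4.
Definition mkq (a b : K) : K * K := if char2 K then (a, b) else (1 + 4 * a, b).

Lemma char2_2 : char2 K = (2 == 0 :> K). Proof. by rewrite /char2 inE. Qed.

Lemma nchar2_4 : ~~ char2 K -> 4 != 0 :> K.
Proof. by rewrite char2_2 => h; rewrite (natrM K 2 2) mulf_neq0. Qed.

Lemma char2_4 : char2 K -> 4 = 0 :> K.
Proof. by rewrite char2_2 => /eqP h; rewrite (natrM K 2 2) h mul0r. Qed.

Lemma slot_mkq a b : slot (mkq a b) = a.
Proof.
rewrite /slot /mkq; have [//|/nchar2_4 h4] := boolP (char2 K).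
by rewrite /=; field.
Qed.

Lemma mkq2 a b : (mkq a b).2 = b. Proof. by rewrite /mkq; case: ifP. Qed.

Lemma mkq_ok a b : b != 0 -> 1 + 4 * a != 0 -> quat_ok (mkq a b).
Proof. by rewrite /quat_ok /mkq => b0 a0; have [//|_] := boolP (char2 K); apply/andP. Qed.

Lemma quat_ok2 p : quat_ok p -> p.2 != 0.
Proof. by rewrite /quat_ok; case: ifP => // _ /andP[]. Qed.

Lemma slot_neq0 p : quat_ok p -> 1 + 4 * slot p != 0.
Proof.
rewrite /quat_ok /slot; have [c2 _|c2 /andP[p0 _]] := boolP (char2 K); last have h4 := nchar2_4 c2.
  by rewrite char2_4 // mul0r addr0 oner_eq0.
by rewrite mulrC divfK // addrC subrK.
Qed.

Lemma slot_inj p p' : slot p = slot p' -> p.1 = p'.1.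
Proof.
rewrite /slot; have [//|/nchar2_4 h4] := boolP (char2 K); by move/(mulIf (invr_neq0 h4))/addIr.
Qed.

Section QuatPair.
Variables (n : nat) (Q : 'I_n -> K * K).

Let QA t := qconst_assoc (Q t).

Lemma quat_qpair t : exists x y : sca (calgA QA t), qpair (slot (Q t)) (Q t).2 x y.
Proof.
pose e k := cb QA t (inord k).
have i1 : inord 1 = 1 :> 'I_4 by apply/val_inj; rewrite /= inordK.
have i2 : inord 2 = 2 :> 'I_4 by apply/val_inj; rewrite /= inordK.
rewrite /slot; case: ifP => c2.
  have qE i j k : qconst (Q t) i j k = nth 0 (qtab2 (Q t).1 (Q t).2 i j) k.
    by rewrite /qconst c2.
  exists (e 1), (e 2); split; rewrite ?mulrBl ?mul1r ?cbM; apply/ffunP => m;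
    rewrite !ffunE !qE !inordK //= -?val_eqE /= ?inordK //;
    case: m => [[|[|[|[|//]]]] ?]; rewrite /= /GRing.scale /= ?oppr_pchar2 //=; ring.
have h2 : 2 != 0 :> K by rewrite -char2_2 c2.
pose h : K := 2^-1; have hh : h + h = 1 by rewrite /h; field.
have [e11 e22 e21] : [/\ e 1 * e 1 = (Q t).1%:A, e 2 * e 2 = (Q t).2%:A &
    e 2 * e 1 = - (e 1 * e 2)].
  have qE i j k : qconst (Q t) i j k = nth 0 (qtab (Q t).1 (Q t).2 i j) k.
    by rewrite /qconst c2.
  by split; rewrite ?cbM; apply/ffunP => m; rewrite !ffunE !qE !inordK //=;
    case: m => [[|[|[|[|//]]]] ?]; rewrite /= /GRing.scale /=; ring.
exists (h *: (1 + e 1)), (e 2); split=> //.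
  rewrite -scalerAl -scalerAr !mulrDl !mulrDr !mul1r !mulr1 e11.
  rewrite !scalerDr !scalerA; set a := (Q t).1.
  apply/ffunP => m; rewrite !ffunE /GRing.scale /=; move: (e 1 m) ((m == ord0)%:R) => u v.
  by rewrite /h; field; rewrite ?nchar2_4 ?c2 // h2.
rewrite -scalerAr mulrDr e21 mulr1 mulrBl mul1r -scalerAl mulrDl mul1r.
rewrite -[X in _ = X - _]scale1r -hh scalerDl !scalerDr scalerN opprD.
by rewrite addrA addrK.
Qed.

Definition tensA : nzscalg K := ctensA QA.

Lemma tens_qsys : exists x y : 'I_n -> sca tensA,
  qsys (fun i => slot (Q i)) (fun i => (Q i).2) x y.
Proof.
have [x hx] := fin_all_exists quat_qpair; have [y hxy] := fin_all_exists hx.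
exists (fun i => tinj (x i)), (fun i => tinj (y i)); split=> [i|i j|i j ij|i j].
- have [xx yy yx] := hxy i; split; rewrite -?tinjM ?xx ?yy ?yx.
  + by rewrite linearD linearZ /= tinj1.
  + by rewrite linearZ /= tinj1.
  by rewrite tinjM linearB /= tinj1.
- by have [->|ij] := eqVneq i j; last exact: tinj_comm.
- exact: tinj_comm.
- by have [->|ij] := eqVneq i j; last exact: tinj_comm.
Qed.

End QuatPair.

Lemma tensU_iso (B : nzscalg K) n (a b : 'I_n -> K) (x y : 'I_n -> sca B) :
    qsys a b x y -> (forall i, b i != 0) -> (forall i, 1 + 4 * a i != 0) ->
    #|sc_basis B| = (4 ^ n)%N ->
  sc_iso (tensU a b) B.
Proof.
move=> xy b0 a0 dB; have [phi [_ _ phi0]] := tensU_map xy.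
apply: lrmorphism_iso (phi0 b0 a0) _.
by rewrite dB /= card_ffun !card_ord.
Qed.

(** The recognition tool for tensor products: the same [tensU] maps injectively to [B] and to
    [tens Q], and all three have dimension [4 ^ n]. *)
Lemma tens_iso (B : nzscalg K) n (Q : 'I_n -> K * K) (x y : 'I_n -> sca B) :
    (forall i, quat_ok (Q i)) ->
    qsys (fun i => slot (Q i)) (fun i => (Q i).2) x y ->
    #|sc_basis B| = (4 ^ n)%N ->
  sc_iso (tens Q) B.
Proof.
move=> Qok xy dB; have [x' [y' xy']] := tens_qsys Q.
have Q2 i := quat_ok2 (Qok i); have Qs i := slot_neq0 (Qok i).
apply: sc_iso_trans (sc_iso_sym _) (tensU_iso xy Q2 Qs dB).
by apply: (tensU_iso (B := tensA Q) xy') => //=; rewrite card_ffun !card_ord.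
Qed.

Definition quatA p : nzscalg K := NzSCAlg (calg_ok (qconst_assoc p)) (calg_nz (qconst p)).

Lemma quatA_qpair p : exists x y : sca (quatA p), qpair (slot p) p.2 x y.
Proof. exact: (quat_qpair (fun _ : 'I_1 => p) ord0). Qed.

Lemma qpair_tens_iso (B : nzscalg K) (Q : 'I_1 -> K * K) (x y : sca B) :
    quat_ok (Q ord0) -> qpair (slot (Q ord0)) (Q ord0).2 x y ->
    #|sc_basis B| = 4 -> sc_iso (tens Q) B.
Proof.
move=> Qok xy dB; apply: (@tens_iso B 1 Q (fun=> x) (fun=> y)) => // [i|].
  by rewrite ord1.
by split=> // [i|i j]; rewrite ?ord1.
Qed.

Lemma tens1_iso (Q : 'I_1 -> K * K) : quat_ok (Q ord0) -> sc_iso (tens Q) (quat (Q ord0)).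
Proof.
move=> Qok; have [x [y xy]] := quatA_qpair (Q ord0).
by apply: (qpair_tens_iso (B := quatA (Q ord0)) Qok xy); rewrite /= card_ord.
Qed.

Lemma quat_iso (B : nzscalg K) p (x y : sca B) : quat_ok p ->
  qpair (slot p) p.2 x y -> #|sc_basis B| = 4 -> sc_iso (quat p) B.
Proof.
move=> pok xy dB; apply: sc_iso_trans (sc_iso_sym (@tens1_iso (fun=> p) pok)) _.
exact: (@qpair_tens_iso B (fun=> p)) xy dB.
Qed.

Lemma quat_swap (a b : K) : ~~ char2 K -> quat_ok (a, b) ->
  sc_iso (quat (a, b)) (quat (b, a)).
Proof.
move=> c2; rewrite /quat_ok (negbTE c2) /= => /andP[a0 b0].
have h4 := nchar2_4 c2; have h2 : 2 != 0 :> K by rewrite -char2_2.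
have [x [y [xx yy yx]]] := quatA_qpair (b, a).
rewrite /slot (negbTE c2) /= in xx yy.
pose h : K := 2^-1; have hh : h + h = 1 by rewrite /h; field.
(* The generators exchange roles: [2 x - 1] squares to [b], and [(1 + y) / 2] turns [y^2 = a] into
   the uniform equation with slot [(a - 1) / 4]. *)
apply: (@quat_iso (quatA (b, a)) _ (h *: (1 + y)) (x + x - 1)); rewrite /= ?card_ord //.
  by rewrite /quat_ok (negbTE c2) /= a0.
rewrite /slot (negbTE c2) /=; split.
- rewrite -scalerAl -scalerAr !mulrDl !mulrDr !mul1r !mulr1 yy.
  apply/ffunP => m; rewrite !ffunE /GRing.scale /=; move: (y m) ((m == ord0)%:R) => u v.
  by rewrite /h; field; rewrite ?h4 // h2.
- rewrite !mulrDl !mulrDr !xx !mulrN !mulNr !mulr1 !mul1r.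
  apply/ffunP => m; rewrite !ffunE /GRing.scale /=; move: (x m) ((m == ord0)%:R) => u v.
  by field; rewrite ?h4 // h2.
have yx' : (x + x - 1) * y = - (y * (x + x - 1)).
  rewrite mulrBr mulrDr yx mulr1 !mulrDl !mulNr !mul1r.
  move: (x * y) => u; apply/ffunP => m; rewrite !ffunE.
  by move: (u m) (y m) => v w; ring.
move: (x + x - 1) yx' => w yx'.
rewrite -scalerAr mulrDr mulr1 yx' mulrBl mul1r -scalerAl mulrDl mul1r.
rewrite -[X in _ = X - _]scale1r -hh scalerDl !scalerDr scalerN opprD.
by rewrite addrA addrK.
Qed.

Lemma common_slot_fst p p' : quat_ok p -> quat_ok p' -> slot p = slot p' ->
  common_slot p p'.
Proof.
move=> pok pok' /slot_inj E; rewrite /common_slot.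
case: p p' pok pok' E => [a b] [a' c] /= pok pok' E; subst a'.
by case: ifP => _; exists a, b, c; [left|]; do ![split => //]; exact: sc_iso_refl.
Qed.

(** Away from characteristic 2 the definition compares first entries, so both symbols are swapped
    there. *)
Lemma common_slot_snd p p' : quat_ok p -> quat_ok p' -> p.2 = p'.2 ->
  common_slot p p'.
Proof.
case: p p' => [a b] [c b'] /= pok pok' E; subst b'; rewrite /common_slot.
case: ifP => c2.
  by exists a, b, c; right; do ![split => //]; exact: sc_iso_refl.
exists b, a, c; have sw d : quat_ok (d, b) = quat_ok (b, d).
  by rewrite /quat_ok c2 /= andbC.
by do ![split]; rewrite -?sw //; apply: quat_swap; rewrite ?c2.
Qed.

Lemma common_slot_iso p p' : quat_ok p -> sc_iso (quat p) (quat p') ->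
  common_slot p p'.
Proof.
move=> pok /sc_iso_sym I; rewrite /common_slot; case: p pok I => a b pok I.
by case: ifP => _; exists a, b, b; [left|]; do ![split => //]; exact: sc_iso_refl.
Qed.

End Params.

(** * Clifford relations and half-spin representations *)

Section Clifford.
Variables (K : fieldType) (D : algType K).

(* For [s = false] these are commuting quaternion pairs; for [s = true] the
   [y i] anticommute with each other. *)
Record gsys (s : bool) n (a b : 'I_n -> K) (x y : 'I_n -> D) : Prop := GSys {
  gsys_pair : forall i, qpair (a i) (b i) (x i) (y i);
  gsys_xx : forall i j, x i * x j = x j * x i;
  gsys_xy : forall i j, i != j -> x i * y j = y j * x i;
  gsys_yy : forall i j, i != j -> y i * y j = (-1) ^+ s * (y j * y i) }.

Lemma qsys_gsys n (a b : 'I_n -> K) (x y : 'I_n -> D) :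
  qsys a b x y <-> gsys false a b x y.
Proof.
split=> [] [h1 h2 h3 h4]; split=> // i j; first by rewrite mul1r h4.
by have [->|/h4] := eqVneq i j; rewrite ?mul1r.
Qed.

(** The element [1 - 2 x] of square [1 + 4 a] anticommutes with [y]. In characteristic 2 it is [1],
    and the twists below are trivial, as commuting and anticommuting agree. *)
Definition zt (x : D) : D := 1 - x - x.

Lemma zt_comm (x y : D) : x * y = y * x -> zt x * y = y * zt x.
Proof. by move=> xy; rewrite /zt !mulrBl !mulrBr mul1r mulr1 xy. Qed.

Lemma zt_anti (a b : K) (x y : D) : qpair a b x y -> zt x * y = - (y * zt x).
Proof.
case=> _ _ yx; rewrite /zt !mulrBr mulr1 yx !mulrBl mul1r.
by rewrite subKr opprB.
Qed.

Lemma zt_sqr (a b : K) (x y : D) : qpair a b x y -> zt x * zt x = (1 + 4 * a)%:A.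
Proof.
case=> xx _ _; have -> : zt x = - (x *+ 2 - 1) by rewrite opprB /zt mulr2n opprD addrA.
rewrite mulrNN -expr2 sqrrB1 exprMn_n expr2 xx mulrnDl -mulrnA.
by rewrite [X in X - _ + _]addrC addrK addrC scalerDl scale1r -scalerA scaler_nat.
Qed.

Section Twist.
Variables (s : bool) (n : nat) (a b : 'I_n -> K) (x y : 'I_n -> D).
Hypothesis xy : gsys s a b x y.

(** The string of a Jordan-Wigner transformation. It is empty at [i = 0], which later leaves the
    second slot of the first factor free of correction. *)
Definition ztw (i : nat) : D := \prod_(j < n | (j < i)%N) zt (x j).

Lemma ztw_comm i w : (forall j : 'I_n, (j < i)%N -> x j * w = w * x j) ->
  ztw i * w = w * ztw i.
Proof.
move=> xw; apply/esym/commr_prod => j ji; by apply/esym/zt_comm/xw.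
Qed.

Lemma ztw_x (i : nat) (j : 'I_n) : ztw i * x j = x j * ztw i.
Proof. by apply: ztw_comm => k _; apply: (gsys_xx xy). Qed.

Lemma ztw_ztw i j : ztw i * ztw j = ztw j * ztw i.
Proof. by apply: ztw_comm => k _; rewrite ztw_x. Qed.

Lemma ztw_y_ge (i : nat) (j : 'I_n) : (i <= j)%N -> ztw i * y j = y j * ztw i.
Proof.
move=> ij; apply: ztw_comm => k ki; apply: (gsys_xy xy).
by apply: contraTneq ki => ->; rewrite -leqNgt.
Qed.

Lemma ztw_y_lt (i : nat) (j : 'I_n) : (j < i)%N -> ztw i * y j = - (y j * ztw i).
Proof.
(* [F] collects the signs; the factor of index [j] is the one that contributes [-1]. *)
move=> ji; pose F k := if k == j then (-1 : D) else 1.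
have -> : ztw i * y j = \prod_(k < n | (k < i)%N) F k * (y j * ztw i).
  rewrite /ztw.
  elim: (index_enum _) => [|k r IH]; first by rewrite !big_nil mulr1 !mul1r.
  rewrite !big_cons; case: ifP => // _; rewrite -mulrA IH !mulrA.
  have zF : zt (x k) * \prod_(l <- r | (l < i)%N) F l =
     \prod_(l <- r | (l < i)%N) F l * zt (x k).
    apply: commr_prod => l _; rewrite /F; case: ifP => _.
      exact/commrN1.
    exact/commr1.
  rewrite zF -!mulrA; rewrite [RHS]mulrA.
  have -> : zt (x k) * (y j * \prod_(l <- r | (l < i)%N) zt (x l)) =
      F k * (y j * (zt (x k) * \prod_(l <- r | (l < i)%N) zt (x l))).
    rewrite !mulrA; congr (_ * _); rewrite /F; case: eqVneq => [->|kj].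
      by rewrite mulN1r (zt_anti (gsys_pair xy j)) mulNr.
    by rewrite mul1r zt_comm // (gsys_xy xy).
  rewrite !mulrA; congr (_ * _ * _ * _).
  by rewrite /F; case: ifP => _; rewrite ?mulr1 ?mul1r // mulrN1 mulN1r.
rewrite (big_only1 j) //; first by rewrite /F eqxx mulN1r.
by move=> k /negbTE kj _; rewrite /F kj.
Qed.

Definition dtw (d : 'I_n -> K) i : K := \prod_(j < n | (j < i)%N) (1 + 4 * d j).

Lemma ztw_sqr i : ztw i * ztw i = (dtw a i)%:A.
Proof.
rewrite /ztw /dtw.
elim: (index_enum _) => [|k r IH]; first by rewrite !big_nil mul1r scale1r.
rewrite !big_cons; case: ifP => // _.
have zC : \prod_(l <- r | (l < i)%N) zt (x l) * zt (x k) =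
    zt (x k) * \prod_(l <- r | (l < i)%N) zt (x l).
  apply/esym/commr_prod => l _; apply/zt_comm/esym/zt_comm.
  exact: (gsys_xx xy).
rewrite mulrA -[_ * _ * zt _]mulrA zC mulrA (zt_sqr (gsys_pair xy k)) -mulrA IH.
by rewrite -scalerAl mul1r scalerA.
Qed.

(** For [j < i] the string of [y i] contains [zt (x j)], which anticommutes with [y j], while the
    string of [y j] commutes with [y i]. Exactly one sign appears, so the same transformation leads
    from commuting to anticommuting generators and back. *)
Lemma gsys_twist : gsys (~~ s) a (fun i => b i * dtw a i) x (fun i => ztw i * y i).
Proof.
split=> [i|i j|i j ij|i j ij].
- have [xx yy yx] := gsys_pair xy i; split=> //.
  + rewrite mulrA -[ztw i * y i * _]mulrA -ztw_y_ge // mulrA ztw_sqr.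
    by rewrite -mulrA yy -scalerAl mul1r scalerA mulrC.
  + by rewrite -mulrA yx !mulrA; congr (_ * _); rewrite mulrBr mulrBl mul1r mulr1 ztw_x.
- exact: (gsys_xx xy).
- by rewrite mulrA -ztw_x -!mulrA (gsys_xy xy).
wlog ji : i j ij / (j < i)%N => [H|].
  have := ij; rewrite -val_eqE neq_ltn => /orP[] lt_ij; last exact: H.
  rewrite [in RHS](H j i) // 1?eq_sym //.
  by case: (s); rewrite /= ?expr1 ?expr0 ?mul1r ?mulN1r ?opprK.
have -> : ztw i * y i * (ztw j * y j) = ztw i * ztw j * (y i * y j).
  by rewrite mulrA -[ztw i * y i * _]mulrA -ztw_y_ge 1?ltnW // !mulrA.
have -> : ztw j * y j * (ztw i * y i) = - (ztw i * ztw j * (y j * y i)).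
  rewrite mulrA -[ztw j * y j * _]mulrA -[y j * ztw i]opprK -ztw_y_lt //.
  by rewrite mulrN mulNr mulrA -ztw_ztw !mulrA.
rewrite (gsys_yy xy ij).
by case: (s); rewrite /= ?expr1 ?expr0 ?mulN1r ?mul1r ?mulrN ?opprK.
Qed.

End Twist.

Lemma gsys_scale s n (a b l : 'I_n -> K) (x y : 'I_n -> D) : gsys s a b x y ->
  gsys s a (fun i => b i * l i ^+ 2) x (fun i => l i *: y i).
Proof.
case=> xy xx xCy yy; split=> // [i|i j ij|i j ij].
- have [ixx iyy iyx] := xy i; split=> //.
    by rewrite -scalerAl -scalerAr iyy !scalerA [RHS]/=; congr (_ *: _); ring.
  by rewrite -scalerAl iyx scalerAr.
- by rewrite -scalerAr xCy // scalerAl.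
- rewrite -!scalerAr -!scalerAl -!scalerAr yy // !scalerA; congr (_ *: _).
  by rewrite mulrC.
Qed.

(** Clifford relations between the images of the basis vectors of the orthogonal sum of the forms
    [c i (u^2 + u v - d i v^2)]. *)
Record csys n (c d : 'I_n -> K) (e f : 'I_n -> D) : Prop := CSys {
  csys_ee : forall i, e i * e i = (c i)%:A;
  csys_ff : forall i, f i * f i = (- (c i * d i))%:A;
  csys_ef : forall i, e i * f i + f i * e i = (c i)%:A;
  csys_eeN : forall i j, i != j -> e i * e j = - (e j * e i);
  csys_efN : forall i j, i != j -> e i * f j = - (f j * e i);
  csys_ffN : forall i j, i != j -> f i * f j = - (f j * f i) }.

Lemma gsys_csys n (a b : 'I_n -> K) (x y : 'I_n -> D) : gsys true a b x y ->
  csys b a y (fun i => x i * y i).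
Proof.
case=> xy xx xCy yy; have yyN i j : i != j -> y i * y j = - (y j * y i).
  by move=> ij; rewrite yy // expr1 mulN1r.
split=> // [i|i|i|i j ij|i j ij].
- by case: (xy i).
- have [ixx iyy iyx] := xy i; rewrite mulrA -[x i * y i * _]mulrA iyx -!mulrA iyy.
  rewrite mulrA mulrBr mulr1 ixx opprD addNKr mulNr -scalerAl mul1r scalerA mulrC.
  by rewrite scaleNr.
- have [ixx iyy iyx] := xy i.
  by rewrite mulrA iyx -!mulrDl subrK mul1r.
- by rewrite mulrA -xCy 1?eq_sym // -mulrA yyN // mulrN mulrA.
- rewrite mulrA -[x i * y i * _]mulrA -xCy 1?eq_sym // mulrA xx -!mulrA yyN //.
  by rewrite !mulrN; congr (- _); rewrite !mulrA; congr (_ * _); rewrite -!mulrA xCy.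
Qed.

(** Converse of [gsys_csys]: there [f = x e] with [e = y], and [e^2 = c] gives back [x] as
    [c^-1 f e]. *)
Lemma csys_gsys n (c d : 'I_n -> K) (e f : 'I_n -> D) :
    csys c d e f -> (forall i, c i != 0) ->
  gsys true d c (fun i => (c i)^-1 *: (f i * e i)) e.
Proof.
case=> ee ff ef eeN efN ffN c0.
have feN i j : i != j -> f i * e j = - (e j * f i).
  by move=> ij; rewrite efN 1?eq_sym // opprK.
have fee i j : i != j -> f i * e i * e j = e j * (f i * e i).
  by move=> ij; rewrite -mulrA eeN // mulrN [in LHS]mulrA (feN _ _ ij) mulNr opprK mulrA.
have fef i j : i != j -> f i * e i * f j = f j * (f i * e i).
  by move=> ij; rewrite -mulrA efN // mulrN [in LHS]mulrA (ffN _ _ ij) mulNr opprK mulrA.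
have efE i : e i * f i = (c i)%:A - f i * e i by rewrite -(ef i) addrK.
split=> [i|i j|i j ij|i j ij] //.
- split=> //; last first.
    rewrite -scalerAr mulrA efE mulrBl mulrBl scalerBr -!scalerAl !mul1r scalerA.
    by rewrite mulVf // scale1r.
  rewrite -scalerAl -scalerAr mulrA -[f i * e i * f i]mulrA efE mulrBr mulrBl.
  rewrite -scalerAr mulr1 -scalerAl mulrA ff -scalerAl mul1r -scalerAl ee.
  rewrite scaleNr opprK !scalerDr !scalerA; congr (_ *: _ + _ *: _); by field.
- have [->//|ij] := eqVneq i j; rewrite -!scalerAl -!scalerAr !scalerA mulrC.
  congr (_ *: _); rewrite mulrA fef // -mulrA fee //.
  by rewrite !mulrA.
- by rewrite -scalerAl -scalerAr fee.
- by rewrite eeN // expr1 mulN1r.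
Qed.

Lemma csys_qsys n (c d : 'I_n -> K) (e f : 'I_n -> D) :
    csys c d e f -> (forall i, c i != 0) ->
  let x i := (c i)^-1 *: (f i * e i) in
  qsys d (fun i => c i * dtw d i) x (fun i => ztw x i * e i).
Proof. by move=> ef c0 x; apply/qsys_gsys; exact: (gsys_twist (csys_gsys ef c0)). Qed.

(** The twist multiplies [b i] by [dtw a i]; rescaling changes this to [b i / dtw a i], so that
    [csys_qsys] leads back to the second slot [b i]. *)
Lemma qsys_csys n (a b : 'I_n -> K) (x y : 'I_n -> D) :
    qsys a b x y -> (forall i, 1 + 4 * a i != 0) ->
  let e (i : 'I_n) := (dtw a i)^-1 *: (ztw x i * y i) in
  csys (fun i => b i / dtw a i) a e (fun i => x i * e i).
Proof.
move=> /qsys_gsys/gsys_twist/(gsys_scale (fun i => (dtw a i)^-1)) xy a0 e.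
have d0 i : dtw a i != 0 by apply/prodf_neq0 => j _.
have := gsys_csys xy; case=> ee ff ef eeN efN ffN.
have bE i : b i * dtw a i * (dtw a i)^-1 ^+ 2 = b i / dtw a i by field.
by split=> [i|i|i|i j|i j|i j]; rewrite -?bE;
  [exact: ee | exact: ff | exact: ef | exact: eeN | exact: efN | exact: ffN].
Qed.

End Clifford.

(** * Quadratic forms and sums of binary norm forms *)

Section QForm.
Variable K : fieldType.

Lemma qfD m (A : 'M[K]_m) u v : qf A (u + v) = qf A u + qf A v + polar A u v.
Proof.
have addE (X Y : 'M[K]_1) : (X + Y) 0 0 = X 0 0 + Y 0 0 by rewrite mxE.
rewrite /qf /polar !mulmxDl linearD /= !mulmxDr !mulmxDl !addE.
have -> : (u *m A^T *m v^T) 0 0 = (v *m A *m u^T) 0 0.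
  by rewrite -[in RHS](trmxK (v *m A *m u^T)) [in RHS]mxE !trmx_mul trmxK mulmxA.
by ring.
Qed.

Lemma polarE m (A : 'M[K]_m) u v : polar A u v = qf A (u + v) - qf A u - qf A v.
Proof. by rewrite qfD; ring. Qed.

Lemma polarC m (A : 'M[K]_m) u v : polar A u v = polar A v u.
Proof. by rewrite !polarE [v + u]addrC; ring. Qed.

Lemma qfZ m (A : 'M[K]_m) a u : qf A (a *: u) = a ^+ 2 * qf A u.
Proof. by rewrite /qf linearZ /= -!scalemxAl -scalemxAr scalerA mxE expr2. Qed.

Lemma qf0 m (A : 'M[K]_m) : qf A 0 = 0.
Proof. by rewrite /qf !mul0mx mxE. Qed.

Lemma polarDl m (A : 'M[K]_m) u v w : polar A (u + v) w = polar A u w + polar A v w.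
Proof. by rewrite /polar !mulmxDl mxE. Qed.

Lemma polarZl m (A : 'M[K]_m) a u w : polar A (a *: u) w = a * polar A u w.
Proof. by rewrite /polar -!scalemxAl mxE. Qed.

Lemma polarDr m (A : 'M[K]_m) u v w : polar A w (u + v) = polar A w u + polar A w v.
Proof. by rewrite polarC polarDl !(polarC A w). Qed.

Lemma polarZr m (A : 'M[K]_m) a u w : polar A w (a *: u) = a * polar A w u.
Proof. by rewrite polarC polarZl polarC. Qed.

Lemma polar0l m (A : 'M[K]_m) w : polar A 0 w = 0.
Proof. by rewrite /polar !mul0mx mxE. Qed.

Lemma polarxx m (A : 'M[K]_m) u : polar A u u = 2 * qf A u.
Proof. by rewrite polarE -mulr2n -scaler_nat qfZ; ring. Qed.

(** Orthogonal sum of the [c i] times the norm forms of [K[x]/(x^2 - x - d i)]. The upper triangular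
    Gram matrix retains the cross terms in characteristic 2. All first coordinates precede all
    second ones. *)
Definition blockform r (c d : 'I_r -> K) : 'M[K]_(r + r) :=
  block_mx (diag_mx (\row_i c i)) (diag_mx (\row_i c i))
    0 (diag_mx (\row_i - (c i * d i))).

Definition bval (c d u v : K) : K := c * (u ^+ 2 + u * v - d * v ^+ 2).

Lemma qf_blockform r (c d : 'I_r -> K) w :
  qf (blockform c d) w =
  \sum_i bval (c i) (d i) (w 0 (lshift r i)) (w 0 (rshift r i)).
Proof.
rewrite -{1}(hsubmxK w) /qf /blockform mul_row_block tr_row_mx mul_row_col !mulmx0 addr0.
rewrite mxE [X in X + _]mxE [X in _ + X]mxE -big_split /=; apply: eq_bigr => i _.
by rewrite !mul_mx_diag !mxE /bval; ring.
Qed.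

End QForm.

Section AltSum.
Variable V : zmodType.

Lemma alt_sum n (G : 'I_n -> 'I_n -> V) :
    (forall i j, i != j -> G i j + G j i = 0) ->
  \sum_i \sum_j G i j = \sum_i G i i.
Proof.
elim: n G => [|n IH] G G0; first by rewrite !big_ord0.
pose w := widen_ord (leqnSn n).
rewrite !big_ord_recr /= -(IH (fun i j => G (w i) (w j))) => [|i j ij]; last exact: G0.
under eq_bigr => i _ do rewrite big_ord_recr /=.
rewrite big_split /= -addrA; congr (_ + _); rewrite addrA; rewrite -big_split /=.
by rewrite big1 ?add0r // => i _; apply: G0; rewrite -val_eqE /= ltn_eqF.
Qed.

End AltSum.

(** * Half-spin pairs *)

Section HalfSpin.
Variables (K : fieldType) (D : algType K).

(** Polarised form of [s v * t v = q v] on the basis vectors of a block form: [e], [f] are the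
    values of [s] and [e'], [f'] those of [t]. *)
Record hsys r (c d : 'I_r -> K) (e f e' f' : 'I_r -> D) : Prop := HSys {
  hsys_ee : forall i, e i * e' i = (c i)%:A;
  hsys_ff : forall i, f i * f' i = (- (c i * d i))%:A;
  hsys_ef : forall i, e i * f' i + f i * e' i = (c i)%:A;
  hsys_eeN : forall i j, i != j -> e i * e' j + e j * e' i = 0;
  hsys_efN : forall i j, i != j -> e i * f' j + f j * e' i = 0;
  hsys_ffN : forall i j, i != j -> f i * f' j + f j * f' i = 0 }.

Definition spin r (e f : 'I_r -> D) (w : 'rV[K]_(r + r)) : D :=
  \sum_i (w 0 (lshift r i) *: e i + w 0 (rshift r i) *: f i).

Lemma spin_linear r (e f : 'I_r -> D) : linear (spin e f).
Proof.
move=> a u v; rewrite /spin scaler_sumr -big_split; apply: eq_bigr => i _ /=.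
by rewrite !mxE !scalerDl scalerDr !scalerA addrACA.
Qed.

HB.instance Definition _ r (e f : 'I_r -> D) :=
  GRing.isLinear.Build K _ _ _ (spin e f) (spin_linear e f).

Lemma spinM r c d (e f e' f' : 'I_r -> D) w : hsys c d e f e' f' ->
  spin e f w * spin e' f' w = (qf (blockform c d) w)%:A.
Proof.
case=> ee ff ef eeN efN ffN; rewrite /spin mulr_suml.
under eq_bigr => i _ do rewrite mulr_sumr.
rewrite alt_sum => [|i j ij].
  rewrite qf_blockform scaler_suml; apply: eq_bigr => i _.
  move: (w 0 (rshift r i)) (w 0 (lshift r i)) => v u.
  rewrite mulrDl !mulrDr -!scalerAl -!scalerAr ee ff !scalerA.
  rewrite addrA -[_ + (u * v) *: _ + _]addrA [v * u]mulrC -scalerDr ef !scalerA.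
  by rewrite -!scalerDl; congr (_ *: _); rewrite /bval; ring.
have ji : j != i by rewrite eq_sym.
move: (w 0 (rshift r j)) (w 0 (lshift r j)) (w 0 (rshift r i)) (w 0 (lshift r i)).
move=> v' u' v u.
rewrite !mulrDl !mulrDr -!scalerAl -!scalerAr !scalerA.
rewrite ![u' * _]mulrC ![v' * _]mulrC.
rewrite !addrA [LHS](ACl ((1*5)*(4*8)*(2*7)*(3*6)))/= -!scalerDr.
by rewrite eeN // ffN // efN // [f i * _ + _]addrC efN // !scaler0 !addr0.
Qed.

Lemma csys_hsys n c d (e f : 'I_n -> D) : csys c d e f -> hsys c d e f e f.
Proof.
case=> ee ff ef eeN efN ffN; split=> // i j ij.
- by rewrite eeN // addNr.
- by rewrite efN // addNr.
- by rewrite ffN // addNr.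
Qed.

Section Hat.
Variables (n : nat) (a b : 'I_n -> K) (x y : 'I_n -> D).
Hypothesis xy : gsys true a b x y.

(* [omega] multiplies the discriminants: [1 - 2 omega] is the product of the
   [1 - 2 x i], so it anticommutes with every [y i]. *)
Definition omega (r : seq 'I_n) : D :=
  foldr (fun i w => w + x i - (w * x i) *+ 2) 0 r.
Definition alpha (r : seq 'I_n) : K :=
  foldr (fun i u => u + a i + 4 * u * a i) 0 r.

Lemma alphaE r : 1 + 4 * alpha r = \prod_(i <- r) (1 + 4 * a i).
Proof.
elim: r => [|i r IH]; first by rewrite big_nil mulr0 addr0.
by rewrite big_cons -IH /=; ring.
Qed.

Lemma omega_comm r w : (forall i, i \in r -> x i * w = w * x i) ->
  omega r * w = w * omega r.
Proof.
elim: r => [|i r IH] H /=; first by rewrite mul0r mulr0.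
have xi := H i (mem_head _ _).
have IH' : omega r * w = w * omega r by apply: IH => j jr; apply: H; rewrite inE jr orbT.
rewrite mulrBl mulrBr mulrDl mulrDr IH' xi mulrnAl mulrnAr; congr (_ - _ *+ 2).
by rewrite -mulrA xi mulrA IH' mulrA.
Qed.

Lemma omega_sqr r : omega r * omega r = omega r + (alpha r)%:A.
Proof.
elim: r => [|i r IH] /=; first by rewrite mulr0 scale0r add0r.
have [xx _ _] := gsys_pair xy i.
have wz : omega r * x i = x i * omega r by apply: omega_comm => j _; apply: (gsys_xx xy).
move: (omega r) (alpha r) (x i) (a i) xx wz IH => w u z v zz wz ww.
pose W := 1 - w; pose Z := 1 - z.
have WE : w + W = 1 by rewrite addrC subrK.
have ZE : z + Z = 1 by rewrite addrC subrK.
have sub1 (t : D) k : t * t = t + k%:A -> t * (1 - t) = (- k)%:A.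
  by move=> tt; rewrite mulrBr mulr1 tt opprD addNKr scaleNr.
have sub2 (t : D) k : t * t = t + k%:A -> (1 - t) * (1 - t) = 1 - t + k%:A.
  by move=> tt; rewrite mulrBl mul1r (sub1 _ k) // scaleNr opprK.
have sub3 (t : D) : t * (1 - t) = (1 - t) * t by rewrite mulrBr mulrBl mul1r mulr1.
have wW : w * W = (- u)%:A := sub1 _ _ ww.
have zZ : z * Z = (- v)%:A := sub1 _ _ zz.
have Ww : W * w = (- u)%:A by rewrite -wW [RHS]sub3.
have Zz : Z * z = (- v)%:A by rewrite -zZ [RHS]sub3.
have WW : W * W = W + u%:A := sub2 _ _ ww.
have ZZ : Z * Z = Z + v%:A := sub2 _ _ zz.
have wZ : Z * w = w * Z by rewrite mulrBr mulrBl mulr1 mul1r wz.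
have zW : W * z = z * W by rewrite mulrBr mulrBl mulr1 mul1r wz.
(* In terms of the conjugates [W = 1 - w] and [Z = 1 - z] the element is [w Z + z W]. Its square
   splits into four products, evaluated from [w W = - u] and [z Z = - v] without dividing by 2. *)
have -> : w + z - (w * z) *+ 2 = w * Z + z * W.
  by rewrite /W /Z !mulrBr !mulr1 -wz mulr2n opprD addrACA.
clearbody W Z.
have h1 : w * Z * (w * Z) = w * Z + v *: w + (u *: Z + (u * v)%:A).
  rewrite mulrA -[w * Z * w]mulrA wZ mulrA ww -mulrA ZZ mulrDl !mulrDr.
  by rewrite -!scalerAr !mulr1 -scalerAl mul1r scalerA mulrC.
have h2 : z * W * (z * W) = z * W + u *: z + (v *: W + (u * v)%:A).
  rewrite mulrA -[z * W * z]mulrA zW mulrA zz -mulrA WW mulrDl !mulrDr.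
  by rewrite -!scalerAr !mulr1 -scalerAl mul1r scalerA.
have h3 : w * Z * (z * W) = (u * v)%:A.
  by rewrite mulrA -[w * Z * z]mulrA Zz -scalerAr mulr1 -scalerAl wW scalerA mulrNN mulrC.
have h4 : z * W * (w * Z) = (u * v)%:A.
  by rewrite mulrA -[z * W * w]mulrA Ww -scalerAr mulr1 -scalerAl zZ scalerA mulrNN.
rewrite mulrDl !mulrDr h1 h2 h3 h4.
have -> : (u + v + 4 * u * v)%:A =
   (u *: Z + u *: z) + (v *: w + v *: W) + ((u * v)%:A + (u * v)%:A + ((u * v)%:A + (u * v)%:A)).
  rewrite -[u *: Z + _]scalerDr -[v *: w + _]scalerDr WE [Z + z]addrC ZE -!scalerDl; congr (_ *: _); ring.
move: (w * Z) (z * W) (u *: Z) (u *: z) (v *: w) (v *: W) ((u * v)%:A).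
move=> p1 p2 p3 p4 p5 p6 p7.
by rewrite !addrA [LHS](ACl (1*7*3*8*2*9*4*5*6*10)).
Qed.

(** Moving [v] across replaces one [x i] by [1 - x i] and fixes the others. This negates one factor
    [1 - 2 x i], hence the product [1 - 2 omega]; the induction verifies the corresponding additive
    identity, which is meaningful in characteristic 2 as well. *)
Lemma omega_anti r v : uniq r -> forall i, i \in r ->
    v * x i = (1 - x i) * v -> (forall j, j != i -> x j * v = v * x j) ->
  v * omega r = (1 - omega r) * v.
Proof.
elim: r => [//|k r IH] /= /andP[kr ur] i; rewrite inE => ikr vx vC.
have wx : omega r * x k = x k * omega r by apply: omega_comm => j _; apply: (gsys_xx xy).
have [ik|ik] := eqVneq i k.
  have wv : omega r * v = v * omega r.
    by apply: omega_comm => j jr; apply: vC; apply: contraNneq kr => ji; rewrite -ik -ji.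
  subst k; rewrite mulrBr mulrDr -wv vx mulrnAr mulrA -wv -mulrA vx.
  rewrite !(mulrBl, mulrBr, mulrDl, mul1r, mulr1, mulrnAl) mulrA mulr2n.
  move: (omega r * v) (omega r * x i * v) (x i * v) => p q t.
  by rewrite !opprD !opprK !addrA [LHS](ACl ((1*4)*2*6*3*5*7))/= subrr add0r.
have wv : v * omega r = (1 - omega r) * v.
  by apply: IH vx vC => //; rewrite (negbTE ik) in ikr.
have xv : v * x k = x k * v by rewrite vC // eq_sym.
rewrite mulrBr mulrDr wv xv mulrnAr mulrA wv -mulrA xv.
rewrite !(mulrBl, mulrBr, mulrDl, mul1r, mulr1, mulrnAl) mulrA !mulr2n.
move: (omega r * v) (omega r * x k * v) (x k * v) => p q t.
by rewrite !opprD !opprK !addrA [LHS](ACl ((3*4)*1*2*6*5*7))/= subrr add0r.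
Qed.

Let om := omega (enum 'I_n).
Let al := alpha (enum 'I_n).

Definition hat (T : Type) (z0 : T) (z : 'I_n -> T) (k : 'I_n.+1) : T :=
  oapp z z0 (unlift ord0 k).

Lemma hat0 T (z0 : T) z : hat z0 z ord0 = z0. Proof. by rewrite /hat unlift_none. Qed.
Lemma hatS T (z0 : T) z i : hat z0 z (lift ord0 i) = z i.
Proof. by rewrite /hat liftK. Qed.

(* The quadratic form is [v + z |-> N z - v ^ 2], as
   [(v + z) (- v + zbar) = N z - v ^ 2] for [z] in [K[omega]]. *)
Lemma hat_hsys : let e := hat 1 y in let f := hat om (fun i => x i * y i) in
  let e' := hat 1 (fun i => - y i) in
  let f' := hat (1 - om) (fun i => - (x i * y i)) in
  let c := hat 1 (fun i => - b i) in let d := hat al a in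
  hsys c d e f e' f' /\ hsys c d e' f' e f.
Proof.
move=> e f e' f' c d; have [ee ff ef eeN efN ffN] := gsys_csys xy.
have oo : om * (1 - om) = (- al)%:A.
  by rewrite mulrBr mulr1 omega_sqr opprD addNKr scaleNr.
have oo' : (1 - om) * om = (- al)%:A.
  by rewrite mulrBl mul1r omega_sqr opprD addNKr scaleNr.
have yo i : y i * om = (1 - om) * y i.
  have [_ _ yx] := gsys_pair xy i.
  apply: omega_anti (enum_uniq _) _ (mem_enum _ i) yx _ => j ji.
  exact: (gsys_xy xy).
have xo i : x i * om = om * x i.
  by rewrite -/om omega_comm // => j _; apply: (gsys_xx xy).
have fo i : x i * y i * om = (1 - om) * (x i * y i).
  by rewrite -mulrA yo mulrA mulrBr mulr1 xo -[X in X - _]mul1r -mulrBl mulrA.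
have yo' i : y i * (1 - om) = om * y i.
  by rewrite mulrBr mulr1 yo mulrBl mul1r subKr.
have fo' i : x i * y i * (1 - om) = om * (x i * y i).
  by rewrite mulrBr mulr1 fo mulrBl mul1r subKr.
have all_k (P : 'I_n.+1 -> Prop) : P ord0 -> (forall i, P (lift ord0 i)) -> forall i, P i.
  by move=> P0 PS i; have [j ->|->//] := unliftP ord0 i.
have cases2 (P : 'I_n.+1 -> 'I_n.+1 -> Prop) :
    (forall i, P ord0 (lift ord0 i)) -> (forall i, P (lift ord0 i) ord0) ->
    (forall i j, i != j -> P (lift ord0 i) (lift ord0 j)) ->
    forall i j, i != j -> P i j.
  move=> P0 P0' PS; apply: (all_k) => [|i]; apply: (all_k) => [|j]; rewrite ?eqxx //.
  by rewrite (inj_eq lift_inj) => /PS.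
split; split; rewrite /e /f /e' /f' /c /d.
all: try (apply: (cases2) => [i|i|i j ij]; rewrite ?hat0 ?hatS).
all: try (apply: (all_k) => [|i]; rewrite ?hat0 ?hatS).
all: rewrite ?mul1r ?mulr1 ?oo ?oo' ?mulrN ?mulNr ?opprK ?ee ?ff ?scale1r -?scaleNr
  ?addrN ?addNr ?subrK ?addrK ?opprK ?mulNr //.
all: rewrite ?yo' ?fo' ?yo ?fo ?subrr ?addNr //.
all: try by rewrite -opprD ef scaleNr.
all: try by rewrite ?(eeN _ _ ij) ?(efN _ _ ij) ?(ffN _ _ ij) opprK subrr.
by rewrite addrC subrK.
Qed.

End Hat.
End HalfSpin.

Lemma spin_polar (K : fieldType) (D : algType K) m (A : 'M[K]_m)
    (s t : {linear 'rV[K]_m -> D}) u v :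
    (forall u, s u * t u = (qf A u)%:A) ->
  s u * t v + s v * t u = (polar A u v)%:A.
Proof.
move=> st; have := st (u + v).
rewrite qfD !linearD /= mulrDl !mulrDr !st !scalerDl.
by rewrite [s v * t u + _]addrC addrACA => /addrI.
Qed.

Section Blocks.
Variables (K : fieldType) (m : nat) (A : 'M[K]_m).

Record blocks n (c d : 'I_n -> K) (v w : 'I_n -> 'rV[K]_m) : Prop := Blocks {
  blocks_v : forall i, qf A (v i) = c i;
  blocks_w : forall i, qf A (w i) = - (c i * d i);
  blocks_vw : forall i, polar A (v i) (w i) = c i;
  blocks_vvN : forall i j, i != j -> polar A (v i) (v j) = 0;
  blocks_vwN : forall i j, i != j -> polar A (v i) (w j) = 0;
  blocks_wwN : forall i j, i != j -> polar A (w i) (w j) = 0 }.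

Variables (D : algType K) (s t : {linear 'rV[K]_m -> D}).
Hypothesis st : forall u, s u * t u = (qf A u)%:A.
Hypothesis ts : forall u, t u * s u = (qf A u)%:A.

(** If [u'] is orthogonal to [g], then [t g * s u' = - (t u' * s g)], so that [(s u * t g) * (s u' *
    t g) = - q g * (s u * t u')]. Polarising [s v * t v = q v] then gives the relations of the
    blocks scaled by [- q g]. *)
Lemma blocks_csys n (c d : 'I_n -> K) (v w : 'I_n -> 'rV[K]_m) g :
    blocks c d v w -> (forall i, polar A g (v i) = 0) ->
    (forall i, polar A g (w i) = 0) ->
  csys (fun i => - (qf A g * c i)) d (fun i => s (v i) * t g) (fun i => s (w i) * t g).
Proof.
case=> bv bw bvw vvN vwN wwN gv gw.
have tgs u : polar A g u = 0 -> t g * s u = - (t u * s g).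
  move=> gu; apply/eqP; rewrite -addr_eq0; apply/eqP.
  by rewrite (spin_polar _ _ ts) gu scale0r.
have E u u' : polar A g u' = 0 -> s u * t g * (s u' * t g) = - (qf A g *: (s u * t u')).
  move=> gu; rewrite mulrA -[s u * t g * _]mulrA tgs // mulrN mulNr.
  by rewrite -!mulrA st -!scalerAr mulr1.
split=> [i|i|i|i j ij|i j ij|i j ij]; rewrite !E ?gv ?gw ?st //.
- by rewrite scalerA bv -scaleNr.
- by rewrite scalerA bw -scaleNr; congr (_ *: _); ring.
- by rewrite -opprD -scalerDr (spin_polar _ _ st) bvw scalerA -scaleNr.
all: apply/eqP; rewrite -addr_eq0 -opprD -scalerDr (spin_polar _ _ st).
- by rewrite vvN // scale0r scaler0 oppr0.
- by rewrite vwN // scale0r scaler0 oppr0.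
- by rewrite wwN // scale0r scaler0 oppr0.
Qed.

End Blocks.

(** * The Clifford invariant *)

Section StdBlocks.
Variables (K : fieldType) (r : nat) (c d : 'I_r -> K).

Definition stde (i : 'I_r) : 'rV[K]_(r + r) := delta_mx 0 (lshift r i).
Definition stdf (i : 'I_r) : 'rV[K]_(r + r) := delta_mx 0 (rshift r i).

Lemma polar_blockform u v : polar (blockform c d) u v =
  \sum_i c i * (2 * u 0 (lshift r i) * v 0 (lshift r i)
    + (u 0 (lshift r i) * v 0 (rshift r i) + u 0 (rshift r i) * v 0 (lshift r i))
    - 2 * d i * u 0 (rshift r i) * v 0 (rshift r i)).
Proof.
rewrite polarE !qf_blockform -!sumrB; apply: eq_bigr => i _.
by rewrite /bval !mxE; ring.
Qed.

Lemma std_coord i j : [/\ stde i 0 (lshift r j) = (j == i)%:R,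
  stde i 0 (rshift r j) = 0, stdf i 0 (lshift r j) = 0
  & stdf i 0 (rshift r j) = (j == i)%:R].
Proof. by rewrite !mxE !eqxx /= eq_lrshift eq_rlshift eq_lshift eq_rshift. Qed.

Lemma qf_std i : qf (blockform c d) (stde i) = c i /\
  qf (blockform c d) (stdf i) = - (c i * d i).
Proof.
rewrite !qf_blockform; split; rewrite (bigD1 i) //= big1 ?addr0 => [|j /negbTE ji].
- by have [-> -> _ _] := std_coord i i; rewrite eqxx /bval /=; ring.
- by have [-> -> _ _] := std_coord i j; rewrite ji /bval /=; ring.
- by have [_ _ -> ->] := std_coord i i; rewrite eqxx /bval /=; ring.
- by have [_ _ -> ->] := std_coord i j; rewrite ji /bval /=; ring.
Qed.

Lemma polar_stde i u : polar (blockform c d) (stde i) u =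
  c i * (2 * u 0 (lshift r i) + u 0 (rshift r i)).
Proof.
rewrite polar_blockform (bigD1 i) //= big1 ?addr0 => [|j /negbTE ji].
- by have [-> -> _ _] := std_coord i i; rewrite eqxx /=; ring.
- by have [-> -> _ _] := std_coord i j; rewrite ji /=; ring.
Qed.

Lemma polar_stdf i u : polar (blockform c d) (stdf i) u =
  c i * (u 0 (lshift r i) - 2 * d i * u 0 (rshift r i)).
Proof.
rewrite polar_blockform (bigD1 i) //= big1 ?addr0 => [|j /negbTE ji].
- by have [_ _ -> ->] := std_coord i i; rewrite eqxx /=; ring.
- by have [_ _ -> ->] := std_coord i j; rewrite ji /=; ring.
Qed.

Lemma std_blocks : blocks (blockform c d) c d stde stdf.
Proof.
split=> [i|i|i|i j ij|i j ij|i j ij]; rewrite ?polar_stde ?polar_stdf.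
- by case: (qf_std i).
- by case: (qf_std i).
- by have [_ _ -> ->] := std_coord i i; rewrite eqxx /=; ring.
- by have [-> -> _ _] := std_coord j i; rewrite (negbTE ij) /=; ring.
- by have [_ _ -> ->] := std_coord j i; rewrite (negbTE ij) /=; ring.
- by have [_ _ -> ->] := std_coord j i; rewrite (negbTE ij) /=; ring.
Qed.

Lemma std_sum (w : 'rV[K]_(r + r)) :
  w = \sum_i (w 0 (lshift r i) *: stde i + w 0 (rshift r i) *: stdf i).
Proof. by rewrite [LHS]row_sum_delta big_split_ord [RHS]big_split. Qed.

Hypothesis c0 : forall i, c i != 0.
Hypothesis d0 : forall i, 1 + 4 * d i != 0.

Lemma blockform_nondeg u : (forall v, polar (blockform c d) u v = 0) -> u = 0.
Proof.
move=> u0.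
have H i : u 0 (lshift r i) = 0 /\ u 0 (rshift r i) = 0.
  have := u0 (stde i); rewrite polarC polar_stde => /eqP.
  rewrite mulf_eq0 (negbTE (c0 i)) /= => /eqP e1.
  have := u0 (stdf i); rewrite polarC polar_stdf => /eqP.
  rewrite mulf_eq0 (negbTE (c0 i)) /= => /eqP e2.
  have e3 : u 0 (rshift r i) = 0.
    apply/eqP; have : (1 + 4 * d i) * u 0 (rshift r i) == 0.
      (* This combination eliminates the first coordinate; the polar form of a block has determinant
         [- c^2 (1 + 4 d)]. *)
      apply/eqP; transitivity (2 * u 0 (lshift r i) + u 0 (rshift r i) -
        2 * (u 0 (lshift r i) - 2 * d i * u 0 (rshift r i))); first by ring.
      by rewrite e1 e2; ring.
    by rewrite mulf_eq0 (negbTE (d0 i)).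
  by split=> //; move: e2; rewrite e3 mulr0 subr0.
rewrite (std_sum u) big1 // => i _; case: (H i) => -> ->.
by rewrite !scale0r addr0.
Qed.

Lemma blockform_nonsingular : nonsingular (blockform c d).
Proof.
rewrite /nonsingular -unitfE -[_ \is a _]/(_ + _ \in unitmx) -row_free_unit -kermx_eq0.
apply/eqP/row_matrixP => i; rewrite row0; apply: blockform_nondeg => v.
by rewrite /polar -row_mul mulmx_ker row0 mul0mx mxE.
Qed.

End StdBlocks.

Section SpinStd.
Variables (K : fieldType) (D : algType K) (r : nat) (e f : 'I_r -> D).

Lemma spin_stde i : spin e f (stde K i) = e i.
Proof.
rewrite /spin /= (bigD1 i) //= big1 ?addr0 => [|k /negbTE ki].
  by have [-> -> _ _] := std_coord K i i; rewrite eqxx scale1r scale0r addr0.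
by have [-> -> _ _] := std_coord K i k; rewrite ki !scale0r addr0.
Qed.

Lemma spin_stdf i : spin e f (stdf K i) = f i.
Proof.
rewrite /spin /= (bigD1 i) //= big1 ?addr0 => [|k /negbTE ki].
  by have [_ _ -> ->] := std_coord K i i; rewrite eqxx scale1r scale0r add0r.
by have [_ _ -> ->] := std_coord K i k; rewrite ki !scale0r addr0.
Qed.

End SpinStd.

Section CliffMap.
Variables (K : fieldType) (D : algType K) (r : nat) (c d : 'I_r -> K).
Variable j : {linear 'rV[K]_(r + r) -> D}.
Hypothesis j2 : forall w, j w * j w = (qf (blockform c d) w)%:A.

Lemma cliff_csys : csys c d (fun i => j (stde _ i)) (fun i => j (stdf _ i)).
Proof.
have [bv bw bvw vvN vwN wwN] := std_blocks c d.
split=> [i|i|i|i k ik|i k ik|i k ik].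
- by rewrite j2 bv.
- by rewrite j2 bw.
- by rewrite (spin_polar _ _ j2) bvw.
all: apply/eqP; rewrite -addr_eq0 (spin_polar _ _ j2).
- by rewrite vvN // scale0r.
- by rewrite vwN // scale0r.
- by rewrite wwN // scale0r.
Qed.

End CliffMap.

Section MatAlg.
Variables (K : fieldType) (N : nat).

Definition mx_sc (M : 'M[K]_N) : sc_elt K (matalg K N) := [ffun p => M p.1 p.2].
Definition sc_mx (u : sc_elt K (matalg K N)) : 'M[K]_N := \matrix_(i, j) u (i, j).

Lemma sc_mxK : cancel sc_mx mx_sc.
Proof. by move=> u; apply/ffunP=> [[i j]]; rewrite ffunE mxE. Qed.

Lemma mx_scM M1 M2 : mx_sc (M1 *m M2) = sc_mul (mx_sc M1) (mx_sc M2).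
Proof.
apply/ffunP=> [[i j]]; rewrite !ffunE mxE /=.
transitivity (\sum_a \sum_b \sum_q mx_sc M1 (a, b) * mx_sc M2 q *
   ((b == q.1) && (i == a) && (j == q.2))%:R); last first.
  by rewrite pair_bigA; apply: eq_bigr => [[a b] _].
apply/esym.
rewrite (bigD1 i) //= [X in _ + X]big1 ?addr0; last first.
  move=> a ai; apply: big1 => b _; apply: big1 => q _.
  by rewrite [i == a]eq_sym (negbTE ai) andbF mulr0.
apply: eq_bigr => b _.
rewrite (bigD1 (b, j)) //= big1 ?addr0; last first.
  move=> [a b'] /=; rewrite xpair_eqE eq_sym [b' == j]eq_sym => /negbTE E.
  by rewrite eqxx andbT E mulr0.
by rewrite !ffunE !eqxx mulr1.
Qed.

Lemma mx_sc1 : mx_sc 1%:M = sc_one (matalg K N).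
Proof. by apply/ffunP=> [[i j]]; rewrite !ffunE mxE. Qed.

Lemma matalg_ok : sc_ok (matalg K N).
Proof.
split=> [x y z|x].
  by rewrite -(sc_mxK x) -(sc_mxK y) -(sc_mxK z) -!mx_scM mulmxA.
by rewrite -(sc_mxK x) -mx_sc1 -!mx_scM mul1mx mulmx1.
Qed.

Lemma matalg_nz : (0 < N)%N -> sc_one (matalg K N) != 0.
Proof.
move=> N0; apply/eqP => /ffunP/(_ (Ordinal N0, Ordinal N0))/eqP.
by rewrite !ffunE eqxx oner_eq0.
Qed.

End MatAlg.

Section CliffordTrivial.
Variables (K : fieldType) (r : nat) (c d : 'I_r -> K).
Hypothesis c0 : forall i, c i != 0.
Hypothesis d0 : forall i, 1 + 4 * d i != 0.

Lemma dtw_neq0 i : dtw d i != 0.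
Proof. by apply/prodf_neq0 => j _. Qed.

(** The Clifford algebra is realised as the tensor product with slots [d i] and [c i * dtw d i].
    Undoing the twist gives the Clifford map [spin e f]; conversely any Clifford map yields
    commuting quaternion pairs, to which [tensU_map] applies. *)
Lemma blockform_clifford_pair : let T := tensU d (fun i => c i * dtw d i) in
  exists j : {linear 'rV[K]_(r + r) -> sca T}, clifford_pair (blockform c d) T j.
Proof.
move=> T; pose b i := c i * dtw d i.
pose X := ux d b; pose Y := uy d b.
have XYs := tensU_qsys d b.
pose e (i : 'I_r) := (dtw d i)^-1 *: (ztw X i * Y i).
pose f i := X i * e i.
have ef : csys (fun i => b i / dtw d i) d e f := qsys_csys XYs d0.
have bE i : b i / dtw d i = c i by rewrite /b mulfK // dtw_neq0.
have hef : hsys c d e f e f.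
  have [h1 h2 h3 h4 h5 h6] := csys_hsys ef.
  by split=> // i; rewrite -bE.
have gXY : gsys false d b X Y by apply/qsys_gsys.
have fe i : X i = (c i)^-1 *: (f i * e i).
  have [ee _ _ _ _ _] := ef.
  by rewrite /f -mulrA ee bE -scalerAr mulr1 scalerA mulVf // scale1r.
have eY i : Y i = ztw X i * e i.
  rewrite /e -scalerAr mulrA (ztw_sqr gXY) -scalerAl mul1r scalerA mulVf ?scale1r //.
  exact: dtw_neq0.
exists (spin e f); split; first by case: (T).
split; first exact: (linearP (spin e f)).
split=> [v|D j' okD j'L j'2]; first exact: (spinM v hef).
(* The universal property also ranges over the zero algebra, which is not an [nzscalg]; all maps
   into it agree. *)
have [D1|D1] := eqVneq (sc_one D) 0.
  have D0 (z : sc_elt K D) : z = 0.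
    case: okD => _ /(_ z)[<- _]; rewrite D1; apply/ffunP=> k; rewrite !ffunE.
    by apply: big1 => i _; apply: big1 => l _; rewrite ffunE !mul0r.
  have D00 (u v : sc_elt K D) : u = v by rewrite (D0 u) (D0 v).
  by exists (fun=> 0); split=> [|psi _ _ x]; [do ![split] => *|]; apply: D00.
pose DA := NzSCAlg okD D1.
have j'l : linear (j' : _ -> sca DA) by [].
pose J : {linear 'rV[K]_(r + r) -> sca DA} :=
  HB.pack (j' : _ -> sca DA) (GRing.isLinear.Build K _ _ _ (j' : _ -> sca DA) j'l).
have J2 w : J w * J w = (qf (blockform c d) w)%:A by apply: j'2.
have Jc := cliff_csys J2.
have [phi [phix' phiy' _]] := tensU_map (csys_qsys Jc c0).
have phix i : phi (X i) = _ := phix' i.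
have phiy i : phi (Y i) = _ := phiy' i.
have gJ := csys_gsys Jc c0.
have phiz i : phi (ztw X i) = ztw (fun i => (c i)^-1 *: (J (stdf K i) * J (stde K i))) i.
  rewrite /ztw rmorph_prod; apply: eq_bigr => k _.
  by rewrite /zt !rmorphB /= rmorph1 phix.
have phie i : phi (e i) = J (stde K i).
  rewrite /e linearZ /= rmorphM /= phiz phiy mulrA (ztw_sqr gJ) -scalerAl mul1r scalerA.
  by rewrite mulVf ?scale1r // dtw_neq0.
have phif i : phi (f i) = J (stdf K i).
  rewrite /f rmorphM /= phie phix -scalerAl -mulrA; have [-> _ _ _ _ _] := Jc.
  by rewrite -scalerAr mulr1 scalerA mulVf // scale1r.
clearbody e f.
have phij v : phi (spin e f v) = J v.
  rewrite [in RHS](std_sum v) !linear_sum; apply: eq_bigr => i _.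
  by rewrite !linearD !linearZ /= phie phif.
exists phi; split; first by split; [exact: (@lrmorphism_hom _ T DA phi) | exact: phij].
move=> psi0 /(@hom_lrmorphism _ T DA)[psi psiE] psij x; rewrite -psiE.
have psiJ v : psi (spin e f v) = J v := etrans (psiE _) (psij v).
have psije i : psi (e i) = phi (e i) by rewrite phie -psiJ spin_stde.
have psijf i : psi (f i) = phi (f i) by rewrite phif -psiJ spin_stdf.
(* Uniqueness: the [e i] and [f i] generate, since [X i] is a multiple of [f i * e i] and
   [Y i = ztw X i * e i]. *)
have psix i : psi (X i) = phi (X i) by rewrite fe !linearZ /= !rmorphM /= psije psijf.
suff E : psi =1 phi by apply: E.
apply: tensU_hom_eq => // i; rewrite -/(Y i) eY !rmorphM /= psije; congr (_ * _).
rewrite /ztw !rmorph_prod; apply: eq_bigr => k _.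
by rewrite /zt !rmorphB /= !rmorph1 psix.
Qed.

Lemma expn_gt0_2 : (0 < 2 ^ r)%N. Proof. by rewrite expn_gt0. Qed.

Definition matA : nzscalg K := NzSCAlg (matalg_ok K (2 ^ r)) (matalg_nz K expn_gt0_2).

(** A Clifford map into matrices of size [2 ^ r] induces an injective homomorphism from an algebra
    of dimension [4 ^ r], which is also the dimension of the matrix algebra. *)
Lemma blockform_clifford_trivial (j : 'rV[K]_(r + r) -> 'M[K]_(2 ^ r)) :
    linear j -> (forall w, j w *m j w = (qf (blockform c d) w)%:M) ->
  clifford_trivial (blockform c d).
Proof.
move=> jL j2; have [j0 j0P] := blockform_clifford_pair.
exists (tensU d (fun i => c i * dtw d i)), j0; split=> //.
have -> : ((r + r)./2 = r)%N by rewrite addnn doubleK.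
have scL : linear (fun w => mx_sc (j w) : sca matA).
  by move=> a u v; apply/ffunP=> p; rewrite !ffunE jL !mxE.
pose J : {linear 'rV[K]_(r + r) -> sca matA} :=
  HB.pack (fun w => mx_sc (j w) : sca matA) (GRing.isLinear.Build K _ _ _ _ scL).
have J2 w : J w * J w = (qf (blockform c d) w)%:A.
  rewrite -[LHS]mx_scM j2; apply/ffunP=> p; rewrite !ffunE mxE.
  by rewrite /GRing.scale /= mulr_natr.
apply: (tensU_iso (B := matA) (csys_qsys (cliff_csys J2) c0)) => //.
  by move=> i; rewrite mulf_neq0 // dtw_neq0.
by rewrite /= card_prod !card_ord -expnMn.
Qed.

End CliffordTrivial.

(** * Discriminant and Arf invariant of a block form *)

Section Disc.
Variables (K : fieldType) (r : nat) (c d : 'I_r -> K).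

Lemma det_block0 (X Y Z : 'M[K]_r) :
  \det (block_mx 0 X Y Z) = (-1) ^+ r * (\det X * \det Y).
Proof.
(* [J] is the quarter turn of the two halves, written as a product of three unipotent matrices so
   that its determinant is visibly [1]. *)
pose U : 'M[K]_(r + r) := block_mx 1%:M (- 1%:M) 0 1%:M.
pose J : 'M[K]_(r + r) := U *m block_mx 1%:M 0 1%:M 1%:M *m U.
have detJ : \det J = 1 by rewrite !det_mulmx !det_ublock det_lblock !det1 !mulr1.
have JE : J = block_mx 0 (- 1%:M) 1%:M 0.
  rewrite /J /U !mulmx_block !(mulmx1, mul1mx, mulmx0, mul0mx, add0r, addr0).
  by rewrite !(mulmxN, mulmx1, subrr, addNr, oppr0, add0r, mul0mx).
transitivity (\det (block_mx 0 X Y Z *m J)); first by rewrite det_mulmx detJ mulr1.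
rewrite JE mulmx_block !(mul0mx, mulmx0, mulmx1, mulmxN, oppr0, add0r, addr0).
by rewrite det_lblock -scaleN1r detZ mulrCA.
Qed.

Lemma det_blockform : \det (blockform c d + (blockform c d)^T) =
  (-1) ^+ r * \prod_i (c i ^+ 2 * (1 + 4 * d i)).
Proof.
pose C : 'M[K]_r := diag_mx (\row_i c i).
pose D : 'M[K]_r := diag_mx (\row_i - (c i * d i)).
(* [T] subtracts twice the second block column from the first, which clears the corner [2 C]. *)
pose T : 'M[K]_(r + r) := block_mx 1%:M 0 (- 2)%:M 1%:M.
have detT : \det T = 1 by rewrite det_lblock !det1 mulr1.
transitivity (\det ((blockform c d + (blockform c d)^T) *m T)).
  by rewrite det_mulmx detT mulr1.
have -> : (blockform c d + (blockform c d)^T) *m T =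
    block_mx 0 C (C - 2 *: (D + D)) (D + D).
  rewrite /blockform tr_block_mx add_block_mx !tr_diag_mx trmx0 addr0 add0r.
  rewrite mulmx_block !mulmx0 !mulmx1 !add0r !mul_mx_scalar !scaleNr.
  by rewrite [2 *: diag_mx (\row_i c i)]scaler_nat mulr2n subrr.
rewrite det_block0; congr (_ * _).
have -> : C - 2 *: (D + D) = diag_mx (\row_i (c i * (1 + 4 * d i))).
  apply/matrixP=> i j; rewrite !mxE; case: eqVneq => _; rewrite ?mulr1n ?mulr0n.
    by ring.
  by rewrite addr0 mulr0 subr0.
rewrite !det_diag -big_split; apply: eq_bigr => i _; rewrite !mxE /=; ring.
Qed.

Lemma disc_blockform (s : K) : (forall i, c i != 0) ->
    \prod_i (1 + 4 * d i) = s ^+ 2 -> (char2 K -> \sum_i d i = 0) ->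
  disc_trivial (blockform c d).
Proof.
move=> c0 ds dsum; rewrite /disc_trivial.
have E : ((r + r)./2 = r)%N by rewrite addnn doubleK.
move: (r + r)./2 E => h E; subst h; case: ifP => c2.
  have two0 : 2 = 0 :> K by apply/eqP; rewrite -char2_2.
  have [bv bw bvw vvN vwN wwN] := std_blocks c d.
  (* After this scaling the basis is symplectic, and the products of values are [- d i]: the Arf
     invariant is the sum of the [d i]. *)
  exists (fun i => (c i)^-1 *: stde K i), (fun i => stdf K i); split=> [i j|].
    rewrite polarZl; have [->|ij] := eqVneq i j; first by rewrite bvw mulVf.
    by rewrite vwN // mulr0.
  split=> [i j|].
    rewrite polarZl polarZr; have [->|ij] := eqVneq i j.
      by rewrite polarxx two0 mul0r !mulr0.
    by rewrite vvN // !mulr0.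
  split=> [i j|].
    have [->|ij] := eqVneq i j; first by rewrite polarxx two0 mul0r.
    by rewrite wwN.
  exists 0; rewrite expr0n addr0 /=; transitivity (- \sum_i d i).
    by rewrite -sumrN; apply: eq_bigr => i _; rewrite qfZ bv bw; field.
  by rewrite dsum // oppr0.
(* The sign [(-1) ^+ r] of the determinant cancels the sign in the discriminant. *)
exists ((\prod_i c i) * s); rewrite det_blockform mulrA -expr2 -exprM mulnC exprM.
by rewrite sqrrN expr1n expr1n mul1r big_split /= exprMn -ds prodrXl.
Qed.

End Disc.

(** * Left and right multiplications as matrices *)

Section Regular.
Variables (K : fieldType) (B : nzscalg K).

Let N := #|sc_basis B|.

(** Matrices act on coordinate rows from the right, hence [lreg] reverses products and [rreg]
    preserves them. *)
Definition lreg (a : sca B) : 'M[K]_N :=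
  \matrix_(i, j) (a * scb (enum_val i)) (enum_val j).
Definition rreg (a : sca B) : 'M[K]_N :=
  \matrix_(i, j) (scb (enum_val i) * a) (enum_val j).

Lemma sca_sum_enum (u : sca B) (phi : {linear sca B -> sca B}) k :
  (phi u) k = \sum_(i < N) u (enum_val i) * (phi (scb (enum_val i))) k.
Proof.
rewrite {1}(sca_sum u) linear_sum sum_ffunE (reindex (fun i : 'I_N => enum_val i)) /=; last first.
  by exists enum_rank => i _; rewrite ?enum_rankK ?enum_valK.
by apply: eq_bigr => i _; rewrite linearZ !ffunE.
Qed.

Lemma lregM a b : lreg a *m lreg b = lreg (b * a).
Proof.
apply/matrixP=> i j; rewrite !mxE -mulrA.
rewrite [RHS](sca_sum_enum _ (GRing.mull_fun b idfun)).
by apply: eq_bigr => k _; rewrite !mxE.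
Qed.

Lemma rregM a b : rreg a *m rreg b = rreg (a * b).
Proof.
apply/matrixP=> i j; rewrite !mxE mulrA.
rewrite [RHS](sca_sum_enum _ (GRing.mulr_fun b idfun)).
by apply: eq_bigr => k _; rewrite !mxE.
Qed.

Lemma lrregC a b : lreg a *m rreg b = rreg b *m lreg a.
Proof.
apply/matrixP=> i j; rewrite !mxE.
transitivity ((a * scb (enum_val i) * b) (enum_val j)).
  rewrite [RHS](sca_sum_enum _ (GRing.mulr_fun b idfun)).
  by apply: eq_bigr => k _; rewrite !mxE.
rewrite -mulrA [LHS](sca_sum_enum _ (GRing.mull_fun a idfun)).
by apply: eq_bigr => k _; rewrite !mxE.
Qed.

Lemma lreg_linear : linear lreg.
Proof. by move=> k a b; apply/matrixP=> i j; rewrite !mxE mulrDl -scalerAl !ffunE. Qed.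

Lemma rreg_linear : linear rreg.
Proof. by move=> k a b; apply/matrixP=> i j; rewrite !mxE mulrDr -scalerAr !ffunE. Qed.

HB.instance Definition _ := GRing.isLinear.Build K _ _ _ lreg lreg_linear.
HB.instance Definition _ := GRing.isLinear.Build K _ _ _ rreg rreg_linear.

Lemma lregA a : lreg a%:A = a%:M.
Proof.
apply/matrixP=> i j; rewrite !mxE -scalerAl mul1r !ffunE (inj_eq enum_val_inj).
by rewrite /GRing.scale /= mulr_natr eq_sym.
Qed.

Lemma rregA a : rreg a%:A = a%:M.
Proof.
apply/matrixP=> i j; rewrite !mxE -scalerAr mulr1 !ffunE (inj_eq enum_val_inj).
by rewrite /GRing.scale /= mulr_natr eq_sym.
Qed.

(* [B ^ 4] as a module over the Clifford algebra of [q perp - q'], through left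
   multiplications for [q] and right multiplications for [q']. *)
Definition dspin (s t s' t' : sca B) : 'M[K]_((N + N) + (N + N)) :=
  let J := block_mx 0 (lreg s) (lreg t) 0 in
  let X u := block_mx (rreg u) 0 0 (- rreg u) in
  block_mx J (X s') (- X t') J.

(** [J] exchanges two copies of [B] and squares to [a]. Left and right multiplications commute, so
    the sign inside [X u] makes it anticommute with [J]; the minus sign in front of [X t'] produces
    [- a']. *)
Lemma dspin_sqr s t s' t' (a a' : K) :
    s * t = a%:A -> t * s = a%:A -> s' * t' = a'%:A -> t' * s' = a'%:A ->
  dspin s t s' t' *m dspin s t s' t' = (a - a')%:M.
Proof.
move=> st ts st' ts'; rewrite /dspin.
set J := block_mx 0 (lreg s) _ _; set X := block_mx (rreg s') _ _ _.
set Y := block_mx (rreg t') _ _ _.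
have JJ : J *m J = a%:M.
  rewrite mulmx_block !mulmx0 !mul0mx !addr0 !add0r !lregM st ts lregA.
  by rewrite -scalar_mx_block.
have XY : X *m Y = a'%:M.
  rewrite mulmx_block !mulmx0 !mul0mx !addr0 !add0r mulmxN mulNmx opprK !rregM st' rregA.
  by rewrite -scalar_mx_block.
have YX : Y *m X = a'%:M.
  rewrite mulmx_block !mulmx0 !mul0mx !addr0 !add0r mulmxN mulNmx opprK !rregM ts' rregA.
  by rewrite -scalar_mx_block.
have JX u : J *m block_mx (rreg u) 0 0 (- rreg u) =
    - (block_mx (rreg u) 0 0 (- rreg u) *m J).
  rewrite !mulmx_block !mulmx0 !mul0mx !addr0 !add0r opp_block_mx !oppr0.
  by rewrite !mulmxN !mulNmx !lrregC opprK.
have JX' : J *m X = - (X *m J) := JX s'; have JY' : J *m Y = - (Y *m J) := JX t'.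
rewrite mulmx_block !(mulmxN, mulNmx) JJ XY YX JX' JY' opprK !addNr ?addrN.
rewrite [- a'%:M + _]addrC.
by rewrite -[a%:M - a'%:M]raddfB -scalar_mx_block.
Qed.

Lemma dspin_linear m (s t s' t' : 'rV[K]_m -> sca B) :
    linear s -> linear t -> linear s' -> linear t' ->
  linear (fun w => dspin (s w) (t w) (s' w) (t' w)).
Proof.
move=> sL tL sL' tL' k u v; rewrite /dspin sL tL sL' tL' !linearP.
rewrite !scale_block_mx !opp_block_mx !add_block_mx.
rewrite !(scaler0, addr0, oppr0, scale_block_mx, add_block_mx).
by congr (block_mx _ (block_mx _ _ _ _) (block_mx _ _ _ _) _);
  rewrite ?opprD ?scalerN ?opprK.
Qed.

End Regular.

(* Once [F] is unpacked, its regular extension [F^o] is definitionally [F]. *)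
Lemma cd2_le2_I3 (F : fieldType) : cd2_le2 F -> I3_zero F.
Proof.
move=> h; have {h} : I3_zero (F^o : fieldExtType F) by exact: h.
by case: F => T cl; case: cl => *.
Qed.

Section Difference.
Variables (K : fieldType) (k : nat).

Definition catf (u v : 'I_k -> K) (i : 'I_(k + k)) : K :=
  match split i with inl a => u a | inr a => v a end.

Lemma catfl u v i : catf u v (lshift k i) = u i.
Proof. by rewrite /catf (unsplitK (inl i)). Qed.

Lemma catfr u v i : catf u v (rshift k i) = v i.
Proof. by rewrite /catf (unsplitK (inr i)). Qed.

(** Since [blockform] lists first coordinates before second ones, a vector for the form built with
    [catf] is [(u, u', v, v')]; [proj1] extracts [(u, v)] and [proj2] extracts [(u', v')]. *)
Definition proj1 (w : 'rV[K]_((k + k) + (k + k))) : 'rV[K]_(k + k) :=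
  row_mx (lsubmx (lsubmx w)) (lsubmx (rsubmx w)).
Definition proj2 (w : 'rV[K]_((k + k) + (k + k))) : 'rV[K]_(k + k) :=
  row_mx (rsubmx (lsubmx w)) (rsubmx (rsubmx w)).

Lemma proj1_linear : linear proj1.
Proof. by move=> a u v; rewrite /proj1 !linearP scale_row_mx add_row_mx. Qed.
Lemma proj2_linear : linear proj2.
Proof. by move=> a u v; rewrite /proj2 !linearP scale_row_mx add_row_mx. Qed.
HB.instance Definition _ := GRing.isLinear.Build K _ _ _ proj1 proj1_linear.
HB.instance Definition _ := GRing.isLinear.Build K _ _ _ proj2 proj2_linear.

Lemma proj_eq0 w : proj1 w = 0 -> proj2 w = 0 -> w = 0.
Proof.
rewrite /proj1 /proj2 -!row_mx0 => /eq_row_mx[a1 a2] /eq_row_mx[b1 b2].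
by rewrite -(hsubmxK w) -(hsubmxK (lsubmx w)) -(hsubmxK (rsubmx w)) a1 a2 b1 b2 !row_mx0.
Qed.

Lemma qf_catf c d c' d' w :
  qf (blockform (catf c (fun i => - c' i)) (catf d d')) w =
  qf (blockform c d) (proj1 w) - qf (blockform c' d') (proj2 w).
Proof.
rewrite !qf_blockform big_split_ord /= -sumrN; congr (_ + _); apply: eq_bigr => i _.
  by rewrite !catfl /proj1 row_mxEl row_mxEr !mxE.
by rewrite !catfr /proj2 row_mxEl row_mxEr !mxE /bval; ring.
Qed.

End Difference.

Lemma halfspin_witt (K : fieldType) (B : nzscalg K) n (c d c' d' : 'I_n.+1 -> K)
    (D D' : K) (s t s' t' : {linear 'rV[K]_(n.+1 + n.+1) -> sca B}) :
    I3_zero K -> #|sc_basis B| = (4 ^ n)%N ->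
    (forall i, c i != 0) -> (forall i, c' i != 0) ->
    (forall i, 1 + 4 * d i != 0) -> (forall i, 1 + 4 * d' i != 0) ->
    \prod_i (1 + 4 * d i) = D ^+ 2 -> \prod_i (1 + 4 * d' i) = D' ^+ 2 ->
    (char2 K -> \sum_i d i = 0) -> (char2 K -> \sum_i d' i = 0) ->
    (forall w, s w * t w = (qf (blockform c d) w)%:A) ->
    (forall w, t w * s w = (qf (blockform c d) w)%:A) ->
    (forall w, s' w * t' w = (qf (blockform c' d') w)%:A) ->
    (forall w, t' w * s' w = (qf (blockform c' d') w)%:A) ->
  witt_zero (blockform (catf c (fun i => - c' i)) (catf d d')).
Proof.
move=> I3 dB c0 c0' d0 d0' pd pd' sd sd' st ts st' ts'.
have cc0 i : catf c (fun i => - c' i) i != 0.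
  by rewrite /catf; case: split => a; rewrite ?oppr_eq0.
have dd0 i : 1 + 4 * catf d d' i != 0 by rewrite /catf; case: split.
apply: I3; first by rewrite addnn odd_double.
- exact: blockform_nonsingular.
- apply: (@disc_blockform _ _ _ _ (D * D')) => //.
    rewrite big_split_ord exprMn -pd -pd'.
    by congr (_ * _); apply: eq_bigr => i _; rewrite ?catfl ?catfr.
  move=> c2; transitivity (\sum_i d i + \sum_i d' i); last by rewrite sd // sd' // addr0.
  rewrite big_split_ord /=; by congr (_ + _); apply: eq_bigr => i _; rewrite ?catfl ?catfr.
(* Four copies of [B] have dimension [4 * 4 ^ n], exactly the degree of the Clifford algebra of a
   form of dimension [4 n + 4]. *)
have E : (2 ^ (n.+1 + n.+1) = (#|sc_basis B| + #|sc_basis B|) + (#|sc_basis B| + #|sc_basis B|))%N.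
  by rewrite dB [in LHS]addnn -mul2n expnM expnS -[(2 ^ 2)%N]/4%N; lia.
suff [j jL j2] : exists2 j : 'rV[K]_((n.+1 + n.+1) + (n.+1 + n.+1)) ->
    'M[K]_(2 ^ (n.+1 + n.+1)), linear j & forall w, j w *m j w =
    (qf (blockform (catf c (fun i => - c' i)) (catf d d')) w)%:M.
  exact: (blockform_clifford_trivial cc0 dd0 jL j2).
rewrite E.
exists (fun w => dspin (s (proj1 w)) (t (proj1 w)) (s' (proj2 w)) (t' (proj2 w))).
  by apply: dspin_linear => a u v; rewrite !linearP.
by move=> w; rewrite qf_catf; apply: dspin_sqr.
Qed.

(** * Totally isotropic subspaces and orthogonal blocks *)

Section Isotropic.
Variable K : fieldType.

(** For [N = 2 k] the rows of [evmx] and [odmx] span two complementary Lagrangians of the hyperbolic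
    form. *)
Definition evmx k N : 'M[K]_(k, N) := \matrix_(i, j) (j == i.*2 :> nat)%:R.
Definition odmx k N : 'M[K]_(k, N) := \matrix_(i, j) (j == i.*2.+1 :> nat)%:R.

Section EvenOdd.
Variables (k N : nat) (NE : N = k.*2).
Let Ev := evmx k N.
Let Od := odmx k N.

Lemma hypmxE : hypmx K N = Ev^T *m Od.
Proof.
apply/matrixP=> i j; rewrite !mxE; have iN := ltn_ord i.
have i2 : (i./2 < k)%N by lia.
rewrite (bigD1 (Ordinal i2)) //= big1 ?addr0 => [|l /negbTE li]; last first.
  rewrite !mxE; case: eqP => [il|_]; last by rewrite mul0r.
  by move: li; rewrite -val_eqE /= il doubleK eqxx.
rewrite !mxE /=; case: (boolP (odd i)) => io /=.
  have -> : (i == i./2.*2 :> nat) = false by lia.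
  by rewrite /= mul0r.
have -> : (i == i./2.*2 :> nat) by lia.
by rewrite mul1r; congr (_%:R); lia.
Qed.

Lemma evmx_tr : Ev *m Ev^T = 1%:M.
Proof.
apply/matrixP=> i j; rewrite !mxE; have ik := ltn_ord i.
have i2 : (i.*2 < N)%N by lia.
rewrite (bigD1 (Ordinal i2)) //= big1 ?addr0 => [|l /negbTE li]; last first.
  by move: li; rewrite -val_eqE !mxE /= => ->; rewrite mul0r.
by rewrite !mxE /= eqxx mul1r; congr (_%:R); rewrite -val_eqE /=; lia.
Qed.

Lemma evodmx : Ev *m Od^T = 0.
Proof.
apply/matrixP=> i j; rewrite !mxE big1 // => l _; rewrite !mxE.
case: eqP => [->|_]; last by rewrite mul0r.
have -> : (i.*2 == j.*2.+1) = false by lia.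
by rewrite mulr0.
Qed.

Lemma evod_sum : Ev^T *m Ev + Od^T *m Od = 1%:M.
Proof.
apply/matrixP=> i j; rewrite !mxE; have iN := ltn_ord i.
have i2 : (i./2 < k)%N by lia.
rewrite (bigD1 (Ordinal i2)) //= [X in _ + X + _]big1 ?addr0; last first.
  move=> l /negbTE li; rewrite !mxE; case: eqP => [il|_]; last by rewrite mul0r.
  by move: li; rewrite -val_eqE /= il doubleK eqxx.
rewrite [X in _ + X](bigD1 (Ordinal i2)) //= [X in _ + (_ + X)]big1 ?addr0; last first.
  move=> l /negbTE li; rewrite !mxE; case: eqP => [il|_]; last by rewrite mul0r.
  by move: li; rewrite -val_eqE /= il /= uphalf_double eqxx.
rewrite !mxE /= -natrM -natrM -natrD -val_eqE; congr (_%:R).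
case: (boolP (odd i)) => io.
  have -> : (i == i./2.*2 :> nat) = false by lia.
  have -> : (i == i./2.*2.+1 :> nat) by lia.
  by rewrite mul0n mul1n add0n /=; lia.
have -> : (i == i./2.*2 :> nat) by lia.
have -> : (i == i./2.*2.+1 :> nat) = false by lia.
by rewrite mul0n mul1n addn0 /=; lia.
Qed.

End EvenOdd.

Lemma qf_block m p (A : 'M[K]_m) (B : 'M[K]_p) u v :
  qf (block_mx A 0 0 B) (row_mx u v) = qf A u + qf B v.
Proof.
rewrite /qf mul_row_block !mulmx0 addr0 add0r tr_row_mx mul_row_col.
by rewrite [LHS]mxE.
Qed.

(** Lagrangian reduction in place of Witt cancellation. A Lagrangian [L] of [A] plus [r0] hyperbolic
    planes has dimension [r + r0]. Restrict to the vectors whose odd hyperbolic coordinates, given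
    by [Ho], vanish: there the planes contribute nothing to the form. Then project to [A]. On the
    kernel [N0] of this projection [He] is injective, with image orthogonal to the rows of [Ho]; so
    [rank N0 + rank Ho <= r0], and rank at least [r] survives. *)
Lemma witt_zero_isotropic r (A : 'M[K]_(r + r)) : witt_zero A ->
  exists p (T : 'M[K]_(p, r + r)), (r <= \rank T)%N /\
    forall u, (u <= T)%MS -> qf A u = 0.
Proof.
case=> r0 [_ [P [Pu PE]]].
set N := (r + r + (r0 + r0))%N in P Pu PE *; set G := block_mx A 0 0 _ in PE.
pose k := (r + r0)%N; have NE : N = k.*2 by rewrite /N /k; lia.
pose L : 'M[K]_(k, r + r + (r0 + r0)) := evmx k N *m P.
have Liso x : qf G (x *m L) = 0.
  rewrite mulmxA PE (hypmxE NE) /qf !mulmxA -[x *m _ *m _]mulmxA (evmx_tr NE) mulmx1.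
  by rewrite trmx_mul -!mulmxA [odmx _ _ *m _]mulmxA -[odmx k N *m _]trmxK trmx_mul
    trmxK (evodmx NE) trmx0 mul0mx mulmx0 mxE.
have Linj x : x *m L = 0 -> x = 0.
  rewrite /L mulmxA => /(congr1 (mulmx^~ (invmx P))); rewrite mulmxK // mul0mx.
  by move/(congr1 (mulmx^~ (evmx k N)^T)); rewrite -mulmxA (evmx_tr NE) mulmx1 mul0mx.
have rE : (r0 + r0 = r0.*2)%N by rewrite addnn.
pose La := lsubmx L; pose Lh := rsubmx L.
pose He := Lh *m (evmx r0 (r0 + r0))^T; pose Ho := Lh *m (odmx r0 (r0 + r0))^T.
have LhE x : x *m He = 0 -> x *m Ho = 0 -> x *m Lh = 0.
  move=> xe xo; rewrite -[LHS]mulmx1 -(evod_sum rE) mulmxDr !mulmxA.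
  by rewrite -[x *m Lh *m _]mulmxA -[x *m Lh *m _]mulmxA xe xo !mul0mx addr0.
have LE x : x *m L = row_mx (x *m La) (x *m Lh) by rewrite -mul_mx_row hsubmxK.
have qhyp x : qf (hypmx K (r0 + r0)) (x *m Lh) = ((x *m He) *m (x *m Ho)^T) 0 0.
  by rewrite /qf (hypmxE rE) !mulmxA /He /Ho !trmx_mul trmxK !mulmxA.
have qA x : qf A (x *m La) + ((x *m He) *m (x *m Ho)^T) 0 0 = 0.
  by rewrite -qhyp -qf_block -LE Liso.
pose N0 := (kermx Ho :&: kermx La)%MS.
have N0o : N0 *m Ho = 0 by apply/sub_kermxP; rewrite capmxSl.
have N0a : N0 *m La = 0 by apply/sub_kermxP; rewrite capmxSr.
(* Compare the isotropy identity at [y + x] and at [x], for [y] in [N0]: the cross term is what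
   remains. *)
have orth : N0 *m He *m Ho^T = 0.
  apply/row_matrixP => i; rewrite row0; apply/rowP=> j; rewrite [RHS]mxE.
  pose y := row i N0; pose x : 'rV[K]_k := delta_mx 0 j.
  have yo : y *m Ho = 0 by rewrite -row_mul N0o row0.
  have ya : y *m La = 0 by rewrite -row_mul N0a row0.
  have := qA (y + x); rewrite !mulmxDl ya yo !add0r.
  rewrite [X in _ + X]mxE addrCA qA addr0 => h0.
  rewrite -[RHS]h0 /y /x [(_ *m Ho)^T]trmx_mul -!row_mul [in RHS]mulmxA trmx_delta -colE.
  by rewrite [LHS]mxE [RHS]mxE [RHS]mxE.
have rN0 : (\rank N0 + \rank Ho <= r0)%N.
  have /eqP k0 : (N0 :&: kermx He)%MS == 0.
    apply/eqP/row_matrixP => i; rewrite row0.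
    set y := row i _; have yN : (y <= N0 :&: kermx He)%MS by apply: row_sub.
    have yo : y *m Ho = 0.
      by apply/sub_kermxP/(submx_trans yN)/(submx_trans (capmxSl _ _))/capmxSl.
    have ya : y *m La = 0.
      by apply/sub_kermxP/(submx_trans yN)/(submx_trans (capmxSl _ _))/capmxSr.
    have ye : y *m He = 0.
      by apply/sub_kermxP/(submx_trans yN)/capmxSr.
    by apply: Linj; rewrite LE ya LhE // row_mx0.
  have := mulmx0_rank_max orth; rewrite mxrank_tr.
  by have := mxrank_mul_ker N0 He; rewrite k0 mxrank0 addn0 => ->.
exists k, (kermx Ho *m La); split.
  have := mxrank_mul_ker (kermx Ho) La; rewrite -/N0 mxrank_ker.
  move: rN0; move: (\rank N0) (\rank Ho) (\rank (kermx Ho *m La)) => a b c'.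
  by rewrite /k; lia.
move=> u /submxP[z ->]; rewrite mulmxA.
have := qA (z *m kermx Ho).
rewrite -[z *m _ *m Ho]mulmxA mulmx_ker mulmx0 trmx0 mulmx0 => h.
by rewrite -[RHS]h [X in _ + X]mxE addr0 mulmxA.
Qed.

End Isotropic.

(** * Growing families of orthogonal blocks *)

Section Geometry.
Variables (K : fieldType) (m : nat) (A : 'M[K]_m).
Hypothesis ndA : nonsingular A.
Let B := A + A^T.

Let q := qf A.
Let b := polar A.

Definition orthv (u : 'rV[K]_m) p (S : 'M[K]_(p, m)) : Prop :=
  forall w, (w <= S)%MS -> b u w = 0.

Definition ndspace p (S : 'M[K]_(p, m)) : Prop :=
  forall u, (u <= S)%MS -> orthv u S -> u = 0.

Lemma BT : B^T = B. Proof. by rewrite linearD /= trmxK addrC. Qed.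

Lemma B_unit : B \in unitmx. Proof. by rewrite unitmxE unitfE. Qed.

Lemma perp_rank p (S : 'M[K]_(p, m)) : exists T : 'M[K]_m,
  (m - \rank S <= \rank T)%N /\ forall u, (u <= T)%MS -> orthv u S.
Proof.
exists (kermx (B *m S^T)); split.
  rewrite mxrank_ker leq_sub2l // -[X in (_ <= X)%N](mxrank_tr S).
  exact: mxrankM_maxr.
move=> u /sub_kermxP uT w /submxP[z ->]; rewrite /b /polar -/B trmx_mul !mulmxA.
by rewrite -[u *m B *m _]mulmxA uT mul0mx mxE.
Qed.

(** A column of the cokernel of [S] is a functional that kills [S], and some column does not kill
    [v]. Nonsingularity represents it by a vector, which is then normalised. *)
Lemma separate p (S : 'M[K]_(p, m)) v : ~~ (v <= S)%MS ->
  exists2 z, orthv z S & b z v = 1.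
Proof.
rewrite submxE => /matrix0Pn[i [j vj]]; rewrite (ord1 i) in vj => {i}.
pose y := col j (cokermx S); pose z := (invmx B *m y)^T.
have zE w : b z w = (w *m y) 0 0.
  rewrite /b /polar -/B -[z *m B *m w^T]trmxK [LHS]mxE !trmx_mul !trmxK BT.
  by rewrite mulKVmx // B_unit.
have vy : (v *m y) 0 0 = (v *m cokermx S) 0 j.
  by rewrite /y colE mulmxA -colE mxE.
exists (((v *m cokermx S) 0 j)^-1 *: z) => [w /submxP[x ->]|].
  rewrite /b polarZl -/b zE /y colE -mulmxA [S *m _]mulmxA mulmx_coker mul0mx mulmx0.
  by rewrite [X in _ * X]mxE mulr0.
by rewrite /b polarZl -/b zE vy mulVf.
Qed.

Lemma ndspace_notin p (S : 'M[K]_(p, m)) v : ndspace S -> orthv v S -> v != 0 ->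
  ~~ (v <= S)%MS.
Proof. by move=> nd vS; apply: contraNN => /nd/(_ vS) ->. Qed.

Lemma orthv_adds u p1 p2 (S1 : 'M[K]_(p1, m)) (S2 : 'M[K]_(p2, m)) :
  orthv u S1 -> orthv u S2 -> orthv u (S1 + S2)%MS.
Proof.
move=> u1 u2 w /sub_addsmxP[[x y] /= ->]; rewrite /b polarDr.
by rewrite [polar _ _ _]u1 ?submxMl // [polar _ _ _]u2 ?submxMl // addr0.
Qed.

Lemma orthv_vec u v : b u v = 0 -> orthv u v.
Proof. by move=> uv w /sub_rVP[a ->]; rewrite /b polarZr [polar _ _ _]uv mulr0. Qed.

Lemma orthv_sub u p1 p2 (S1 : 'M[K]_(p1, m)) (S2 : 'M[K]_(p2, m)) :
  (S1 <= S2)%MS -> orthv u S2 -> orthv u S1.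
Proof. by move=> S12 u2 w w1; apply: u2; apply: submx_trans S12. Qed.

Lemma orthvD u v p (S : 'M[K]_(p, m)) a : orthv u S -> orthv v S -> orthv (u + a *: v) S.
Proof.
by move=> uS vS w wS; rewrite /b polarDl polarZl [polar _ u _]uS // [polar _ v _]vS // mulr0 addr0.
Qed.

Lemma orthvZ u p (S : 'M[K]_(p, m)) a : orthv u S -> orthv (a *: u) S.
Proof. by move=> uS w wS; rewrite /b polarZl [polar _ u _]uS // mulr0. Qed.

Lemma ndspace_adds p1 p2 (S1 : 'M[K]_(p1, m)) (S2 : 'M[K]_(p2, m)) :
    ndspace S1 -> ndspace S2 -> (forall v, (v <= S2)%MS -> orthv v S1) ->
  ndspace (S1 + S2)%MS.
Proof.
move=> nd1 nd2 S12 u /sub_addsmxP[[x y] /= ->] uo.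
have s1 := submxMl x S1; have s2 := submxMl y S2.
have -> : x *m S1 = 0.
  apply: nd1 => // w w1; have := uo w (submx_trans w1 (addsmxSl _ _)).
  by rewrite /b polarDl [polar _ (y *m _) _]S12 // addr0.
rewrite add0r; apply: nd2 => // w w2; have := uo w (submx_trans w2 (addsmxSr _ _)).
by rewrite /b polarDl [polar _ (x *m _) _]polarC [polar _ w _]S12 // add0r.
Qed.

Lemma ndspace_vec v : 2 * q v != 0 -> ndspace v.
Proof.
move=> qv u /sub_rVP[a ->] /(_ v (submx_refl _)) /eqP.
by rewrite /b polarZl polarxx mulf_eq0 (negbTE qv) orbF => /eqP ->; rewrite scale0r.
Qed.

(** Take [w] orthogonal to [S] and [z] orthogonal to [S] with [b z w = 1]; if both are isotropic,
    then [q (z + w) = 1]. *)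
Lemma ex_anisotropic p (S : 'M[K]_(p, m)) : ndspace S -> (\rank S < m)%N ->
  exists2 u, orthv u S & q u != 0.
Proof.
move=> nd rS; have [T [rT TS]] := perp_rank S.
have T0 : T != 0 by rewrite -mxrank_eq0; lia.
have [w wT w0] := rowV0Pn T0; have wS := TS _ wT.
have [z zS zw] := separate (ndspace_notin nd wS w0).
have [qw|] := eqVneq (q w) 0; last by exists w.
have [qz|] := eqVneq (q z) 0; last by exists z.
exists (z + 1 *: w); first exact: orthvD.
by rewrite scale1r /q qfD -/q -/b qw qz zw !add0r oner_eq0.
Qed.

(** The condition [4 * q z != q v] makes the plane of [v] and [z] nondegenerate. In characteristic 2
    it reads [0 != q v], and a rescaled dual of [v] works. Otherwise [v / 2] has the right polar
    value but violates this condition, so it is shifted by an anisotropic [w] orthogonal to [S] and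
    [v]. *)
Lemma ex_partner p (S : 'M[K]_(p, m)) v :
    ~~ (v <= S)%MS -> orthv v S -> q v != 0 ->
    (~~ char2 K -> ndspace S) -> (\rank S + 1 < m)%N ->
  exists z, [/\ orthv z S, b v z = q v & 4 * q z != q v].
Proof.
move=> vS vo qv nd rS; have [c2|c2] := boolP (char2 K).
  have [z zS zv] := separate vS; exists (q v *: z); split.
  - exact: orthvZ.
  - by rewrite /b polarZr polarC -/b zv mulr1.
  - by rewrite char2_4 // mul0r eq_sym.
have h2 : 2 != 0 :> K by rewrite -char2_2.
have qv2 : 2 * q v != 0 by rewrite mulf_neq0.
have nd' : ndspace (S + v)%MS.
  apply: ndspace_adds (nd c2) (ndspace_vec qv2) _ => w /sub_rVP[a ->].
  exact: orthvZ.
have [|w wo qw] := ex_anisotropic nd'.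
  have := mxrank_adds_leqif S v; case=> + _.
  have := rank_leq_row v; lia.
have wv : b w v = 0 by apply: wo; apply: addsmxSr.
exists (w + 2^-1 *: v); split.
- by apply: orthvD => //; apply: orthv_sub wo; apply: addsmxSl.
- by rewrite /b polarDr polarZr polarxx polarC -/b wv add0r mulKf.
rewrite /q qfD qfZ polarZr -/q -/b wv mulr0 addr0.
have h4 := nchar2_4 c2; rewrite -subr_eq0.
have -> : 4 * (q w + 2^-1 ^+ 2 * q v) - q v = 4 * q w by field.
by rewrite mulf_neq0.
Qed.

Notation vpair := ('rV[K]_m * 'rV[K]_m)%type.

(** A basis [(v, w)] normalised so that the plane is [q v] times the norm form with parameter
    [d = - q w / q v], called [dpar]; the last condition is [1 + 4 d != 0]. *)
Definition isblk (p : vpair) : bool :=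
  [&& q p.1 != 0, b p.1 p.2 == q p.1 & 4 * q p.2 != q p.1].
Definition orthp (p p' : vpair) : bool :=
  [&& b p.1 p'.1 == 0, b p.1 p'.2 == 0, b p.2 p'.1 == 0 & b p.2 p'.2 == 0].
Definition goodb (L : seq vpair) : bool := all isblk L && pairwise orthp L.
Definition dpar (p : vpair) : K := - (q p.2 / q p.1).
Definition bspan (L : seq vpair) : 'M[K]_m :=
  foldr (fun p S => S + (p.1 + p.2))%MS 0 L.

Lemma orthpC p p' : orthp p p' = orthp p' p.
Proof.
rewrite /orthp /b ![polar A p.1 _]polarC ![polar A p.2 _]polarC.
by congr (_ && _); rewrite andbCA.
Qed.

Lemma orthv_bspan u L : (forall p, p \in L -> b u p.1 = 0 /\ b u p.2 = 0) ->
  orthv u (bspan L).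
Proof.
elim: L => [|p L IH] H /=.
  by move=> w; rewrite submx0 => /eqP ->; rewrite /b polarC polar0l.
apply: orthv_adds; first by apply: IH => p' p'L; apply: H; rewrite inE p'L orbT.
have [h1 h2] := H p (mem_head _ _).
by apply: orthv_adds; apply: orthv_vec.
Qed.

Lemma bspan_mem L p : p \in L -> (p.1 <= bspan L)%MS /\ (p.2 <= bspan L)%MS.
Proof.
elim: L => //= p' L IH; rewrite inE => /orP[/eqP ->|/IH[h1 h2]].
  split; apply: submx_trans (addsmxSr _ _); [exact: addsmxSl | exact: addsmxSr].
by split; apply: submx_trans (addsmxSl _ _).
Qed.

Lemma orthv_bspanE u L p : orthv u (bspan L) -> p \in L -> b u p.1 = 0 /\ b u p.2 = 0.
Proof. by move=> uL /bspan_mem[h1 h2]; split; apply: uL. Qed.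

Lemma rank_bspan L : (\rank (bspan L) <= (size L).*2)%N.
Proof.
elim: L => [|p L IH] /=; first by rewrite mxrank0.
have [+ _] := mxrank_adds_leqif (bspan L) (p.1 + p.2)%MS.
have [+ _] := mxrank_adds_leqif p.1 p.2.
have := rank_leq_row p.1; have := rank_leq_row p.2; lia.
Qed.

Lemma ndspace_blk p : isblk p -> ndspace (p.1 + p.2)%MS.
Proof.
case/and3P=> q0 /eqP bq d0 u /sub_addsmxP[[x y] /= ->].
have [a ->] : exists a, x *m p.1 = a *: p.1 by apply/sub_rVP; apply: submxMl.
have [e ->] : exists e, y *m p.2 = e *: p.2 by apply/sub_rVP; apply: submxMl.
move=> uo.
have E1 := uo _ (addsmxSl _ _); have E2 := uo _ (addsmxSr _ _).
move: E1 E2; rewrite /b !polarDl !polarZl !polarxx (polarC A p.2) -/b -/q bq.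
move: (q p.1) (q p.2) q0 d0 => c g c0 d0 E1 E2.
have e0 : e = 0.
  apply/eqP; have : e * (4 * g - c) == 0.
    apply/eqP; transitivity (2 * (a * c + e * (2 * g)) - (a * (2 * c) + e * c)).
      by ring.
    by rewrite E1 E2 mulr0 subr0.
  by rewrite mulf_eq0 subr_eq0 (negbTE d0) orbF.
have a0 : a = 0.
  move: E2; rewrite e0 mul0r addr0 => /eqP.
  by rewrite mulf_eq0 (negbTE c0) orbF => /eqP.
by rewrite a0 e0 !scale0r addr0.
Qed.

Lemma goodb_cons p L : goodb (p :: L) = [&& isblk p, all (orthp p) L & goodb L].
Proof. by rewrite /goodb /=; case: (isblk p) => //=; rewrite andbCA. Qed.

Lemma ndspace_bspan L : goodb L -> ndspace (bspan L).
Proof.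
elim: L => [_ u|p L IH]; first by rewrite submx0 => /eqP.
rewrite goodb_cons => /and3P[bp /allP oL gL] /=.
apply: ndspace_adds (IH gL) (ndspace_blk bp) _ => v /sub_addsmxP[[x y] /= ->].
have [a ->] : exists a, x *m p.1 = a *: p.1 by apply/sub_rVP; apply: submxMl.
have [e ->] : exists e, y *m p.2 = e *: p.2 by apply/sub_rVP; apply: submxMl.
apply: orthvD; first apply: orthvZ.
all: apply: orthv_bspan => p' /oL/and4P[/eqP h11 /eqP h12 /eqP h21 /eqP h22] //.
Qed.

Lemma goodb_mem L p : goodb L -> p \in L -> isblk p.
Proof. by case/andP=> /allP H _; apply: H. Qed.

Lemma goodb_extend1 L v : goodb L -> orthv v (bspan L) -> q v != 0 ->
    ((size L).*2 + 1 < m)%N ->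
  exists z, goodb ((v, z) :: L).
Proof.
move=> gL vL qv sL; have nd := ndspace_bspan gL; have rL := rank_bspan L.
have v0 : v != 0 by apply: contraNneq qv => ->; rewrite /q qf0.
have [//||z [zo vz z4]] := ex_partner (ndspace_notin nd vL v0) vL qv; first by lia.
exists z; rewrite goodb_cons gL andbT; apply/andP; split.
  by rewrite /isblk /= qv vz eqxx z4.
apply/allP => p pL; have [v1 v2] := orthv_bspanE vL pL; have [z1 z2] := orthv_bspanE zo pL.
by rewrite /orthp /= v1 v2 z1 z2 eqxx.
Qed.

Lemma goodb_extend L : goodb L -> ((size L).*2 + 1 < m)%N -> exists p, goodb (p :: L).
Proof.
move=> gL sL; have rL := rank_bspan L.
have [|v vL qv] := ex_anisotropic (ndspace_bspan gL); first by lia.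
by have [z gz] := goodb_extend1 gL vL qv sL; exists (v, z).
Qed.

Lemma goodb_extend_to L k : goodb L -> ((k + size L).*2 <= m)%N ->
  exists2 L', size L' = k & goodb (L' ++ L).
Proof.
move=> gL; elim: k => [|k IH] sk; first by exists [::].
have [|L' sL' gL'] := IH; first by lia.
have [|p gp] := goodb_extend gL'; first by rewrite size_cat; lia.
by exists (p :: L'); rewrite //= sL'.
Qed.

Section OneBlock.
Variable B1 : vpair.
Hypothesis B1blk : isblk B1.
Hypothesis m6 : (6 <= m)%N.

Let orthB (u : 'rV[K]_m) : Prop := b u B1.1 = 0 /\ b u B1.2 = 0.

Lemma goodb1 : goodb [:: B1]. Proof. by rewrite goodb_cons B1blk. Qed.

Lemma orthB_bspan u : orthB u -> orthv u (bspan [:: B1]).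
Proof. by move=> uB; apply: orthv_bspan => p; rewrite inE => /eqP ->. Qed.

(** In these triples [G] supplies the auxiliary vector, [B1] is the block to be preserved, and [P2]
    will carry the new slot. *)
Lemma goodb_swap G P2 : goodb [:: P2; B1] -> isblk G -> orthp G B1 -> orthp G P2 ->
  goodb [:: G; B1; P2].
Proof.
rewrite !goodb_cons /= !andbT => /and3P[-> o12 ->] -> -> ->.
by rewrite orthpC o12.
Qed.

Lemma any_pair : exists G P2, goodb [:: G; B1; P2].
Proof.
have [|[//|G [//|P2 [|//]]] _] := @goodb_extend_to [:: B1] 2 goodb1; first by rewrite /=; lia.
rewrite !goodb_cons /= !andbT => /and3P[bG /andP[oGP oGB] /and3P[bP oPB _]].
exists G, P2; apply: goodb_swap => //; by rewrite !goodb_cons /= bP oPB B1blk.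
Qed.

(* An isotropic vector in [B1^perp] spans a hyperbolic plane, so the product of
   the values on an orthogonal pair can be prescribed. *)
Lemma isotropic_pair v pr : v != 0 -> q v = 0 -> orthB v -> pr != 0 ->
  exists G P2, goodb [:: G; B1; P2] /\ q G.1 * q P2.1 = pr.
Proof.
move=> v0 qv /orthB_bspan vB pr0; have nd1 := ndspace_bspan goodb1.
have [z zB zv] := separate (ndspace_notin nd1 vB v0).
(* In the plane of [z] and [v] the vector [h k] has value [k], and [k *: v] completes it to a block
   because [b (h k) v = 1]. *)
pose h (k : K) := z + (k - q z) *: v.
have hB k : orthv (h k) (bspan [:: B1]) by apply: orthvD.
have qh k : q (h k) = k by rewrite /q qfD qfZ polarZr -/q -/b zv qv; ring.
have hv k : b (h k) v = 1 by rewrite /b polarDl polarZl polarxx -/b -/q zv qv; ring.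
have gh k : k != 0 -> goodb [:: (h k, k *: v); B1].
  move=> k0; rewrite goodb_cons goodb1 /= !andbT; apply/andP; split.
    by rewrite /isblk /= qh k0 /b polarZr -/b hv /q qfZ -/q qv !mulr0 mulr1 eqxx eq_sym.
  have B1in : B1 \in [:: B1] by rewrite inE.
  have [h1 h2] := orthv_bspanE (hB k) B1in; have [v1 v2] := orthv_bspanE vB B1in.
  by rewrite /orthp /= h1 h2 /b !polarZl -/b v1 v2 mulr0 eqxx.
have g1 := gh 1 (oner_neq0 _).
(* [u] is chosen orthogonal to the block for [k = 1]; the plane is the same for all [k], so [k] may
   afterwards depend on [q u]. *)
have [|u uo qu] := ex_anisotropic (ndspace_bspan g1).
  by have := rank_bspan [:: (h 1, 1 *: v); B1]; rewrite /=; lia.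
have [uB1 uB2] : orthB u by apply: (orthv_bspanE uo); rewrite !inE eqxx orbT.
have [/= uh] := orthv_bspanE uo (mem_head _ _); rewrite scale1r => uv.
have uz : b u z = 0 by move: uh; rewrite /b /h polarDr polarZr -/b uv mulr0 addr0.
have uhk k : b u (h k) = 0 by rewrite /b /h polarDr polarZr -/b uv uz mulr0 addr0.
pose k := pr / q u; have k0 : k != 0 by rewrite mulf_neq0 ?invr_neq0.
have [||w gw] := goodb_extend1 (gh k k0) _ qu; last 1 first.
- exists (u, w), (h k, k *: v); split; last by rewrite qh /k mulrC divfK.
  move: gw; rewrite goodb_cons => /and3P[bu /= /and3P[ou1 ou2 _] g2].
  exact: goodb_swap.
- apply: orthv_bspan => p; rewrite !inE => /orP[/eqP -> /=|/eqP -> //].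
  by rewrite uhk /b polarZr -/b uv mulr0.
- by rewrite /=; lia.
Qed.

(** The partner of [v] must also be orthogonal to [u], which requires [v] outside the span of [B1]
    and [u]. In characteristic 2, where [b u u = 0], orthogonality does not prevent [v] from being a
    multiple of [u]. *)
Lemma orth_pair u v : orthB u -> orthB v -> b u v = 0 -> q u != 0 -> q v != 0 ->
    ~~ (v <= u)%MS ->
  exists G P2, [/\ goodb [:: G; B1; P2], G.1 = u & P2.1 = v].
Proof.
move=> uB vB uv qu qv vu; have nd1 := ndspace_bspan goodb1.
have uo := orthB_bspan uB; have vo := orthB_bspan vB.
have u0 : u != 0 by apply: contraNneq qu => ->; rewrite /q qf0.
have rB := rank_bspan [:: B1].
have v_notin : ~~ (v <= bspan [:: B1] + u)%MS.
  apply: contra vu => /sub_addsmxP[[x y] /= vE].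
  have [e yE] : exists e, y *m u = e *: u by apply/sub_rVP; apply: submxMl.
  have xB : x *m bspan [:: B1] = v + (- e) *: u by rewrite vE yE scaleNr addrK.
  have x0 : x *m bspan [:: B1] = 0.
    by apply: nd1; rewrite ?submxMl // xB; apply: orthvD.
  by rewrite vE x0 add0r submxMl.
have vS : orthv v (bspan [:: B1] + u)%MS.
  by apply: orthv_adds => //; apply: orthv_vec; rewrite /b polarC.
have [c2||z [zo vz z4]] := ex_partner v_notin vS qv.
- have h2 : 2 != 0 :> K by rewrite -char2_2.
  apply: ndspace_adds nd1 _ _; first by apply: ndspace_vec; rewrite mulf_neq0.
  by move=> w /sub_rVP[a ->]; apply: orthvZ.
- have [+ _] := mxrank_adds_leqif (bspan [:: B1]) u.
  by have := rank_leq_row u; move: rB; rewrite [size _]/=; lia.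
have zB := orthv_sub (addsmxSl _ _) zo.
have zu : b z u = 0 by apply: zo; apply: addsmxSr.
have B1in : B1 \in [:: B1] by rewrite inE.
have g2 : goodb [:: (v, z); B1].
  rewrite goodb_cons goodb1 /= !andbT /isblk /= qv vz eqxx z4 /=.
  have [v1 v2] := vB; have [z1 z2] := orthv_bspanE zB B1in.
  by rewrite /orthp /= v1 v2 z1 z2 eqxx.
have [||w gw] := goodb_extend1 g2 _ qu; last 1 first.
- exists (u, w), (v, z); split=> //.
  move: gw; rewrite goodb_cons => /and3P[bu /= /and3P[ou1 ou2 _] _].
  exact: goodb_swap.
- apply: orthv_bspan => p; rewrite !inE => /orP[/eqP -> /=|/eqP -> //].
  by rewrite uv /b polarC.
- by rewrite /=; lia.
Qed.

Lemma plane_pair u v : orthB u -> orthB v -> q u != 0 -> b u v != 0 ->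
    4 * (q u * q v) != b u v ^+ 2 ->
  exists G P2, goodb [:: G; B1; P2] /\ dpar P2 = - (q u * q v / b u v ^+ 2).
Proof.
(* [v] is rescaled so that [b u w = q u]; [nd] then says that the resulting block is
   nondegenerate. *)
move=> [u1 u2] [v1 v2] qu buv nd; pose w := (q u / b u v) *: v.
have qw : q w = q u * (q u * q v / b u v ^+ 2) by rewrite /q qfZ -/q; field.
have g2 : goodb [:: (u, w); B1].
  rewrite goodb_cons goodb1 /= !andbT /isblk /= qu /b polarZr -/b divfK // eqxx /=.
  rewrite /orthp /= u1 u2 /b !polarZl -/b v1 v2 mulr0 eqxx !andbT qw.
  apply: contra nd => /eqP E; apply/eqP.
  have E' : q u * (4 * (q u * q v) / b u v ^+ 2) = q u * 1 by rewrite mulr1 -[RHS]E; ring.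
  by move/(mulfI qu): E' => /(canRL (mulfVK _)) ->; rewrite ?mul1r // expf_neq0.
have [|G gG] := goodb_extend g2; first by rewrite /=; lia.
exists G, (u, w); split.
  move: gG; rewrite goodb_cons => /and3P[bG /= /and3P[oG1 oG2 _] _].
  exact: goodb_swap.
by rewrite /dpar /= qw; congr (- _); rewrite mulrC mulKf.
Qed.

End OneBlock.
End Geometry.

(** * Common slots *)

Lemma pairwise_rev (T : Type) (r : rel T) (L : seq T) : symmetric r ->
  pairwise r (rev L) = pairwise r L.
Proof.
move=> rC; elim: L => //= x L IH; rewrite rev_cons pairwise_rcons IH all_rev.
by congr (_ && _); apply: eq_all => y; rewrite rC.
Qed.

Section CommonPair.
Variables (K : fieldType) (m : nat).
Hypothesis m6 : (6 <= m)%N.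
Notation vpair := ('rV[K]_m * 'rV[K]_m)%type.

Definition common_pairs (A A' : 'M[K]_m) (B1 B1' : vpair) : Prop :=
  exists G P2 G' P2', [/\ goodb A [:: G; B1; P2], goodb A' [:: G'; B1'; P2'] &
    dpar A P2 = dpar A' P2' \/ qf A G.1 * qf A P2.1 = qf A' G'.1 * qf A' P2'.1].

Lemma common_pairs_sym A A' B1 B1' : common_pairs A A' B1 B1' -> common_pairs A' A B1' B1.
Proof.
move=> [G [P2 [G' [P2' [g g' E]]]]]; exists G', P2', G, P2; split=> //.
by case: E => ->; [left|right].
Qed.

(** Any triple will do for [A']; the isotropic vector lets [A] match its product of values. *)
Lemma isotropic_common A A' B1 B1' v :
    nonsingular A -> nonsingular A' -> isblk A B1 -> isblk A' B1' ->
    v != 0 -> qf A v = 0 -> polar A v B1.1 = 0 /\ polar A v B1.2 = 0 ->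
  common_pairs A A' B1 B1'.
Proof.
move=> ns ns' b1 b1' v0 qv vB.
have [G' [P2' g']] := any_pair ns' b1' m6.
have q0 (p : vpair) : p \in [:: G'; B1'; P2'] -> qf A' p.1 != 0.
  by move=> /(goodb_mem g')/and3P[].
have pr0 : qf A' G'.1 * qf A' P2'.1 != 0 by rewrite mulf_neq0 // q0 // !inE eqxx ?orbT.
have [G [P2 [g E]]] := isotropic_pair ns b1 m6 v0 qv vB pr0.
by exists G, P2, G', P2'; split=> //; right.
Qed.

(** A combination that vanishes on one side is a nonzero isotropic vector on the other, by joint
    independence. Otherwise the common binary form decides: [u] or [v] is isotropic; or they are
    orthogonal, giving equal products; or their plane is degenerate and contains an isotropic
    vector; or it is a block with the same parameter on both sides. *)
Lemma common_pair A A' B1 B1' u v u' v' :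
    nonsingular A -> nonsingular A' -> isblk A B1 -> isblk A' B1' ->
    polar A u B1.1 = 0 /\ polar A u B1.2 = 0 ->
    polar A v B1.1 = 0 /\ polar A v B1.2 = 0 ->
    polar A' u' B1'.1 = 0 /\ polar A' u' B1'.2 = 0 ->
    polar A' v' B1'.1 = 0 /\ polar A' v' B1'.2 = 0 ->
    (forall x y, qf A (x *: u + y *: v) = qf A' (x *: u' + y *: v')) ->
    (forall x y, x *: u + y *: v = 0 -> x *: u' + y *: v' = 0 -> x = 0 /\ y = 0) ->
  common_pairs A A' B1 B1'.
Proof.
move=> ns ns' b1 b1' uB vB uB' vB' qE ind.
have lin (C : 'M[K]_m) (p : vpair) w z x y : polar C w p.1 = 0 /\ polar C w p.2 = 0 ->
    polar C z p.1 = 0 /\ polar C z p.2 = 0 ->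
    polar C (x *: w + y *: z) p.1 = 0 /\ polar C (x *: w + y *: z) p.2 = 0.
  by move=> [w1 w2] [z1 z2]; rewrite !polarDl !polarZl w1 w2 z1 z2 !mulr0 addr0.
have isoL x y : x *: u + y *: v != 0 -> qf A (x *: u + y *: v) = 0 ->
    common_pairs A A' B1 B1'.
  by move=> w0 qw; apply: isotropic_common w0 qw (lin _ _ _ _ _ _ uB vB).
have isoR x y : x *: u' + y *: v' != 0 -> qf A' (x *: u' + y *: v') = 0 ->
    common_pairs A A' B1 B1'.
  move=> w0 qw; apply: common_pairs_sym.
  by apply: isotropic_common w0 qw (lin _ _ _ _ _ _ uB' vB').
have qu : qf A u = qf A' u' by have := qE 1 0; rewrite !scale1r !scale0r !addr0.
have qv : qf A v = qf A' v' by have := qE 0 1; rewrite !scale1r !scale0r !add0r.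
have quv : polar A u v = polar A' u' v'.
  by rewrite !polarE; have := qE 1 1; rewrite !scale1r qu qv => ->.
have [[x [y [xy [w0|w0]]]]|free] :
    (exists x y, (x != 0) || (y != 0) /\ (x *: u + y *: v = 0 \/ x *: u' + y *: v' = 0)) \/
    [/\ u != 0, ~~ (v <= u)%MS, u' != 0 & ~~ (v' <= u')%MS].
- have [->|u0] := eqVneq u 0.
    by left; exists 1, 0; rewrite oner_eq0 scaler0 scale0r addr0; split; last left.
  have [->|u0'] := eqVneq u' 0.
    by left; exists 1, 0; rewrite oner_eq0 !scaler0 !scale0r !addr0; split; last right.
  have [/sub_rVP[a va]|vu] := boolP (v <= u)%MS.
    left; exists (- a), 1; rewrite oner_eq0 orbT va scale1r scaleNr addNr.
    by split; last left.
  have [/sub_rVP[a va]|vu'] := boolP (v' <= u')%MS; last by right.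
  left; exists (- a), 1; rewrite oner_eq0 orbT va !scale1r !scaleNr addNr.
  by split; last right.
- apply: (isoR x y); last by rewrite -qE w0 qf0.
  by apply/eqP => w0'; have [x0 y0] := ind _ _ w0 w0'; rewrite x0 y0 eqxx in xy.
- apply: (isoL x y); last by rewrite qE w0 qf0.
  by apply/eqP => w0'; have [x0 y0] := ind _ _ w0' w0; rewrite x0 y0 eqxx in xy.
have [u0 vu u0' vu'] := free.
have v0 : v != 0 by apply: contraNneq vu => ->; rewrite sub0mx.
have [qu0|qu0] := eqVneq (qf A u) 0.
  by apply: (isoL 1 0); rewrite scale1r scale0r addr0.
have [qv0|qv0] := eqVneq (qf A v) 0.
  by apply: (isoL 0 1); rewrite scale1r scale0r add0r.
have [b0|b0] := eqVneq (polar A u v) 0.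
  have [G [P2 [g Gu Pv]]] := orth_pair ns b1 m6 uB vB b0 qu0 qv0 vu.
  have [|||G' [P2' [g' Gu' Pv']]] := orth_pair ns' b1' m6 uB' vB' _ _ _ vu'.
  - by rewrite -quv.
  - by rewrite -qu.
  - by rewrite -qv.
  by exists G, P2, G', P2'; split=> //; right; rewrite Gu Pv Gu' Pv' qu qv.
have [disc0|disc0] := eqVneq (4 * (qf A u * qf A v)) (polar A u v ^+ 2).
  (* With [b] the polar value, [b u - 2 q(u) v] has value [q(u) (4 q(u) q(v) - b^2)]. It is nonzero
     because [b != 0] forces [2 q(u) != 0] and [v] is not a multiple of [u]. *)
  apply: (isoL (polar A u v) (- (2 * qf A u))).
    apply: contra vu => /eqP w0; have c0 : 2 * qf A u != 0.
      apply: contra b0 => /eqP c0; rewrite -sqrf_eq0 -disc0.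
      have -> : 4 * (qf A u * qf A v) = 2 * qf A u * (2 * qf A v) by ring.
      by rewrite c0 mul0r.
    apply/sub_rVP; exists ((2 * qf A u)^-1 * polar A u v).
    apply: (scalerI c0); rewrite scalerA mulVKf //.
    by apply/eqP; rewrite -subr_eq0 -oppr_eq0 opprB -scaleNr; apply/eqP.
  rewrite qfD !qfZ polarZl polarZr; transitivity
    (qf A u * (4 * (qf A u * qf A v) - polar A u v ^+ 2)); first by ring.
  by rewrite disc0 subrr mulr0.
have [G [P2 [g dP]]] := plane_pair ns b1 m6 uB vB qu0 b0 disc0.
have [|||G' [P2' [g' dP']]] := plane_pair ns' b1' m6 uB' vB'.
- by rewrite -qu.
- by rewrite -quv.
- by rewrite -qu -qv -quv.
by exists G, P2, G', P2'; split=> //; left; rewrite dP dP' qu qv quv.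
Qed.

End CommonPair.

Section Decomposition.
Variables (K : fieldType) (m n : nat) (A : 'M[K]_m) (B : nzscalg K).
Hypothesis nsA : nonsingular A.
Hypothesis dB : #|sc_basis B| = (4 ^ n)%N.
Hypothesis mE : m = n.+1.*2.
Hypothesis n2 : (2 <= n)%N.
Variables (s t : {linear 'rV[K]_m -> sca B}).
Hypothesis st : forall u, s u * t u = (qf A u)%:A.
Hypothesis ts : forall u, t u * s u = (qf A u)%:A.

(** From [G] the vector [g = G.1] is kept, and the [n] other blocks feed [blocks_csys]. [P2] comes
    first because [dtw] is an empty product there, so its second slot is exactly
    [- q g * q P2.1]. *)
Lemma goodb_decomposition G B1 P2 : goodb A [:: G; B1; P2] ->
  exists Q : 'I_n -> K * K,
    [/\ forall i, quat_ok (Q i), sc_iso (tens Q) B,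
      exists i, slot (Q i) = dpar A B1 &
      exists i, slot (Q i) = dpar A P2 /\ (Q i).2 = - (qf A G.1 * qf A P2.1)].
Proof.
move=> g3; have [|L' sL' gL] := @goodb_extend_to _ _ _ nsA [:: G; B1; P2] (n - 2) g3.
  by rewrite /=; lia.
(* The blocks [L'] were added in front; with this order [rev L] is a subsequence of the extended
   list, and [P2], [B1] get indices 0 and 1. *)
pose L := [:: P2; B1] ++ rev L'.
have sL : size L = n by rewrite size_cat size_rev sL' /=; lia.
have memL p : p \in L -> p \in L' ++ [:: G; B1; P2].
  rewrite !mem_cat mem_rev !inE => /orP[/orP[]->|->]; rewrite ?orbT //.
have symO : symmetric (orthp A) by move=> p p'; apply: orthpC.
have pL : pairwise (orthp A) L.
  have : pairwise (orthp A) (rev L).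
    rewrite /L rev_cat revK; have /andP[_] := gL; apply: subseq_pairwise.
    by apply: cat_subseq => //; apply: subseq_cons.
  by rewrite pairwise_rev.
have oG p : p \in L -> orthp A G p.
  have /andP[_] := gL; rewrite pairwise_cat pairwise_cons => /and3P[/allrelP oL _ /andP[oG _]].
  rewrite mem_cat mem_rev => /orP[|pL']; last by rewrite symO oL // mem_head.
  by move=> pP; apply: (allP oG); move: pP; rewrite !inE orbC.
pose p (i : 'I_n) := nth (0, 0) L i.
have pmem i : p i \in L by apply: mem_nth; rewrite sL.
have pblk i : isblk A (p i) by apply: goodb_mem gL (memL _ (pmem i)).
pose c i := qf A (p i).1; pose d i := dpar A (p i).
have c0 i : c i != 0 by have /and3P[] := pblk i.
have d0 i : 1 + 4 * d i != 0.
  have /and3P[q0 _ q4] := pblk i; rewrite /d /dpar.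
  have -> : 1 + 4 * - (qf A (p i).2 / qf A (p i).1) =
      (qf A (p i).1 - 4 * qf A (p i).2) / qf A (p i).1 by field.
  by rewrite mulf_neq0 ?invr_neq0 // subr_eq0 eq_sym.
have pO i j : i != j -> orthp A (p i) (p j).
  have H (i' j' : 'I_n) : (i' < j')%N -> orthp A (p i') (p j').
    by move=> ij; apply: (pairwiseP (0, 0) pL) => //; rewrite inE sL.
  by rewrite -val_eqE neq_ltn => /orP[/H|/H] //; rewrite symO.
have blk : blocks A c d (fun i => (p i).1) (fun i => (p i).2).
  split=> [i|i|i|i j /pO|i j /pO|i j /pO] //; last first.
  - by case/and4P=> _ _ _ /eqP.
  - by case/and4P=> _ /eqP.
  - by case/and4P=> /eqP.
  - by have /and3P[_ /eqP] := pblk i.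
  - by rewrite /d /dpar mulrN opprK mulrC divfK // c0.
have qG : qf A G.1 != 0.
  by have /and3P[] : isblk A G by apply: goodb_mem g3 (mem_head _ _).
have Gv i : polar A G.1 (p i).1 = 0 by have /and4P[/eqP] := oG _ (pmem i).
have Gw i : polar A G.1 (p i).2 = 0 by have /and4P[_ /eqP] := oG _ (pmem i).
have cs := blocks_csys st ts blk Gv Gw.
have c0' i : - (qf A G.1 * c i) != 0 by rewrite oppr_eq0 mulf_neq0.
pose Q i := mkq (d i) (- (qf A G.1 * c i) * dtw d i).
have Qok i : quat_ok (Q i) by apply: mkq_ok; rewrite ?mulf_neq0 ?dtw_neq0.
exists Q; split=> //.
- have [x [y xy]] : exists x y : 'I_n -> sca B,
      qsys d (fun i => - (qf A G.1 * c i) * dtw d i) x y.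
    by do 2!eexists; apply: csys_qsys cs c0'.
  apply: (@tens_iso _ B n Q x y Qok _ dB).
  case: xy => xyp xx xyC yy; split=> // i; rewrite /Q slot_mkq mkq2.
  exact: xyp.
- have i1 : (1 < n)%N by [].
  by exists (Ordinal i1); rewrite /Q slot_mkq /d /p.
have i0 : (0 < n)%N by lia.
exists (Ordinal i0); rewrite /Q slot_mkq mkq2 /d /p; split=> //.
by rewrite /dtw big_pred0 ?mulr1.
Qed.

End Decomposition.

Section HalfSpinExists.
Variables (K : fieldType) (n : nat) (Q : 'I_n -> K * K).
Hypothesis Qok : forall i, quat_ok (Q i).

Lemma tens_halfspin : exists (c d : 'I_n.+1 -> K) (D : K)
    (s t : {linear 'rV[K]_(n.+1 + n.+1) -> sca (tensA Q)}),
  [/\ forall i, c i != 0, forall i, 1 + 4 * d i != 0,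
      \prod_i (1 + 4 * d i) = D ^+ 2, char2 K -> \sum_i d i = 0 &
      [/\ forall w, s w * t w = (qf (blockform c d) w)%:A,
          forall w, t w * s w = (qf (blockform c d) w)%:A &
          forall i, d (lift ord0 i) = slot (Q i)]].
Proof.
have [x [y /qsys_gsys/gsys_twist xy]] := tens_qsys Q.
have [h1 h2] := hat_hsys xy; set c := hat _ (fun i => - _) in h1 h2.
set a := fun i => slot (Q i) in h1 h2; set al := alpha a (enum 'I_n) in h1 h2.
have a0 i : 1 + 4 * a i != 0 by apply: slot_neq0.
have alE : 1 + 4 * al = \prod_i (1 + 4 * a i) by rewrite alphaE big_enum.
have al0 : 1 + 4 * al != 0 by rewrite alE; apply/prodf_neq0 => i _.
move: h1 h2; move: (hat (1 - _) _) (hat (omega _ _) _) => f' f.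
move: (hat 1 (fun i => - (_ * y _))) (hat 1 (fun i => _ * y _)) => e' e h1 h2.
have ord_cases (P : 'I_n.+1 -> Prop) : P ord0 -> (forall i, P (lift ord0 i)) -> forall i, P i.
  by move=> P0 PS i; have [j ->|->//] := unliftP ord0 i.
(* The extra block has discriminant [1 + 4 al], the product of all the other discriminants, so the
   total is the square of that product. *)
exists c, (hat al a), (\prod_i (1 + 4 * a i)), (spin e f), (spin e' f'); split.
- apply: (ord_cases) => [|i]; rewrite /c ?hat0 ?hatS ?oner_eq0 // oppr_eq0 mulf_neq0 //.
    exact: quat_ok2.
  exact: dtw_neq0.
- by apply: (ord_cases) => [|i]; rewrite ?hat0 ?hatS.
- rewrite big_ord_recl hat0 alE expr2; congr (_ * _).
  by apply: eq_bigr => i _; rewrite hatS.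
- move=> c2; rewrite big_ord_recl hat0.
  under eq_bigr => i _ do rewrite hatS.
  (* When [4 = 0] the law defining [alpha] is addition; the extra parameter repeats the sum of the
     others, and the total is twice it. *)
  have -> : al = \sum_i a i.
    rewrite /al -big_enum; elim: (enum _) => [|i r IH] /=; first by rewrite big_nil.
    by rewrite big_cons -IH char2_4 // !mul0r addr0 addrC.
  by rewrite addrr_pchar2.
split=> [w|w|i]; [exact: (spinM w h1)|exact: (spinM w h2)|by rewrite hatS].
Qed.

End HalfSpinExists.

Section StdBlock.
Variables (K : fieldType) (r : nat) (c d : 'I_r -> K) (i : 'I_r).
Hypothesis c0 : c i != 0.
Hypothesis d0 : 1 + 4 * d i != 0.

Lemma std_isblk : isblk (blockform c d) (stde K i, stdf K i).
Proof.
have [bv bw bvw _ _ _] := std_blocks c d.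
rewrite /isblk /= bv bw bvw c0 eqxx /= eq_sym -subr_eq0.
have -> : c i - 4 * - (c i * d i) = c i * (1 + 4 * d i) by ring.
by rewrite mulf_neq0.
Qed.

Lemma std_dpar : dpar (blockform c d) (stde K i, stdf K i) = d i.
Proof.
have [bv bw _ _ _ _] := std_blocks c d.
by rewrite /dpar /= bv bw mulNr opprK mulrAC divff // mul1r.
Qed.

Lemma std_orth (u : 'rV[K]_(r + r)) : u 0 (lshift r i) = 0 -> u 0 (rshift r i) = 0 ->
  polar (blockform c d) u (stde K i) = 0 /\ polar (blockform c d) u (stdf K i) = 0.
Proof.
by move=> ul ur; rewrite !(polarC _ u) polar_stde polar_stdf ul ur !mulr0 subr0 addr0 mulr0.
Qed.

End StdBlock.

Lemma two_independent (K : fieldType) p m (X : 'M[K]_(p, m)) : (1 < \rank X)%N ->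
  exists u v : 'rV[K]_m, [/\ (u <= X)%MS, (v <= X)%MS &
    forall a b, a *: u + b *: v = 0 -> a = 0 /\ b = 0].
Proof.
move=> rX; have X0 : X != 0 by rewrite -mxrank_eq0; lia.
have [u uX u0] := rowV0Pn X0.
have : ~~ (X <= u)%MS.
  by apply/negP => /mxrankS; have := rank_leq_row u; lia.
case/row_subPn => i iu; exists u, (row i X); split=> // [|a b ab0]; first exact: row_sub.
have b0 : b = 0.
  apply/eqP; apply: contraNT iu => b0; apply/sub_rVP; exists (- (b^-1 * a)).
  apply: (scalerI b0); rewrite scalerA mulrN mulrA divff // mul1r scaleNr.
  by apply/eqP; rewrite -addr_eq0 addrC; apply/eqP.
split=> //; apply/eqP; move/eqP: ab0; rewrite b0 scale0r addr0 scaler_eq0.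
by rewrite (negbTE u0) orbF.
Qed.

Section Intersection.
Variables (K : fieldType) (k : nat) (c d c' d' : 'I_k -> K).
Hypothesis k3 : (3 <= k)%N.
Hypothesis c0 : forall i, c i != 0.
Hypothesis d0 : forall i, 1 + 4 * d i != 0.
Hypothesis c0' : forall i, c' i != 0.
Hypothesis d0' : forall i, 1 + 4 * d' i != 0.

(* Four linear conditions cut a maximal totally isotropic subspace of
   [q perp - q'], of dimension [2 k >= 6], down to dimension at least [2]. *)
Lemma witt_zero_common_pairs i i' :
    witt_zero (blockform (catf c (fun i => - c' i)) (catf d d')) ->
  common_pairs (blockform c d) (blockform c' d')
    (stde K i, stdf K i) (stde K i', stdf K i').
Proof.
move=> /witt_zero_isotropic[p [T [rT Tiso]]].
pose e j : 'cV[K]_((k + k) + (k + k)) := delta_mx j 0.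
pose C := row_mx
  (row_mx (e (lshift (k + k) (lshift k i))) (e (rshift (k + k) (lshift k i))))
  (row_mx (e (lshift (k + k) (rshift k i'))) (e (rshift (k + k) (rshift k i')))).
have rX : (1 < \rank (T :&: kermx C)%MS)%N.
  have := mxrank_mul_ker T C; have := rank_leq_col (T *m C).
  by move: (\rank _) (\rank _) => r1 r2; lia.
have [x1 [x2 [x1X x2X ind]]] := two_independent rX.
have TX w : (w <= T :&: kermx C)%MS -> [/\ qf (blockform c d) (proj1 w) =
      qf (blockform c' d') (proj2 w),
    proj1 w 0 (lshift k i) = 0 /\ proj1 w 0 (rshift k i) = 0 &
    proj2 w 0 (lshift k i') = 0 /\ proj2 w 0 (rshift k i') = 0].
  move=> wX; split.
  - apply/eqP; rewrite -subr_eq0 -qf_catf; apply/eqP/Tiso.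
    exact: submx_trans wX (capmxSl _ _).
  - have /sub_kermxP := submx_trans wX (capmxSr _ _).
    rewrite !mul_mx_row -!row_mx0 => /eq_row_mx[/eq_row_mx[h1 h2] _].
    rewrite /proj1 row_mxEl row_mxEr !mxE.
    by move: h1 h2; rewrite -!colE => /matrixP/(_ 0 0) + /matrixP/(_ 0 0); rewrite !mxE.
  - have /sub_kermxP := submx_trans wX (capmxSr _ _).
    rewrite !mul_mx_row -!row_mx0 => /eq_row_mx[_ /eq_row_mx[h1 h2]].
    rewrite /proj2 row_mxEl row_mxEr !mxE.
    by move: h1 h2; rewrite -!colE => /matrixP/(_ 0 0) + /matrixP/(_ 0 0); rewrite !mxE.
have comb x y : ((x *: x1 + y *: x2)%R <= T :&: kermx C)%MS.
  by apply: addmx_sub; apply: scalemx_sub.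
have [_ [p1l p1r] [p1l' p1r']] := TX _ x1X; have [_ [p2l p2r] [p2l' p2r']] := TX _ x2X.
apply: (@common_pair _ _ _ _ _ _ _ (proj1 x1) (proj1 x2) (proj2 x1) (proj2 x2)).
- by lia.
- exact: blockform_nonsingular.
- exact: blockform_nonsingular.
- exact: std_isblk.
- exact: std_isblk.
- exact: std_orth.
- exact: std_orth.
- exact: std_orth.
- exact: std_orth.
- by move=> x y; rewrite -!linearZ -!linearD /=; case: (TX _ (comb x y)).
- move=> x y; rewrite -!linearZ -!linearD /= => h1 h2; apply: ind.
  exact: proj_eq0.
Qed.

End Intersection.

Theorem theorem4p6 (F : fieldType) (h2 : two_field F) (hcd : cd2_le2 F)
    (n : nat) (hn : (0 < n)%N) (Q Q' : 'I_n -> F * F)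
    (hQ : forall i, quat_ok (Q i)) (hQ' : forall i, quat_ok (Q' i))
    (hiso : sc_iso (tens Q) (tens Q')) :
  exists Q2 Q3 : 'I_n -> F * F,
    (forall i, quat_ok (Q2 i)) /\ (forall i, quat_ok (Q3 i)) /\
    sc_iso (tens Q) (tens Q2) /\ sc_iso (tens Q2) (tens Q3) /\
    sc_iso (tens Q3) (tens Q') /\
    tens_common_slot Q Q2 /\ tens_common_slot Q2 Q3 /\ tens_common_slot Q3 Q'.
Proof.
have [n2|n1] := leqP 2 n; last first.
  have nE : n = 1%N by lia.
  (* For [n = 1] the two tensor products are isomorphic quaternion algebras, which share a slot at
     once. *)
  subst n; exists Q, Q; do 2!split=> //; do 2![split; first exact: sc_iso_refl].
  split=> //; have cQ : tens_common_slot Q Q.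
    by exists ord0, ord0; apply: common_slot_fst.
  do 2!split=> //; exists ord0, ord0; apply: common_slot_iso => //.
  apply: sc_iso_trans (sc_iso_sym (tens1_iso (hQ ord0))) _.
  exact: sc_iso_trans hiso (tens1_iso (hQ' ord0)).
have cardT (R : 'I_n -> F * F) : #|sc_basis (tensA R)| = (4 ^ n)%N.
  by rewrite /= card_ffun !card_ord.
(* The half-spin maps of [Q'] are carried along the isomorphism, so that both forms act on the
   algebra of [Q]. *)
have [g0 [g0hom _]] := sc_iso_sym hiso.
have [g _] := @hom_lrmorphism _ (tensA Q') (tensA Q) g0 g0hom.
have [c [d [D [s [t [c0 d0 pd sd [st ts dS]]]]]]] := tens_halfspin hQ.
have [c' [d' [D' [s1 [t1 [c0' d0' pd' sd' [st1 ts1 dS']]]]]]] := tens_halfspin hQ'.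
pose s' : {linear 'rV[F]_(n.+1 + n.+1) -> sca (tensA Q)} := g \o s1.
pose t' : {linear 'rV[F]_(n.+1 + n.+1) -> sca (tensA Q)} := g \o t1.
have st' w : s' w * t' w = (qf (blockform c' d') w)%:A.
  by rewrite /= -rmorphM st1; apply: (rmorph_alg g).
have ts' w : t' w * s' w = (qf (blockform c' d') w)%:A.
  by rewrite /= -rmorphM ts1; apply: (rmorph_alg g).
have wz := halfspin_witt (cd2_le2_I3 hcd) (cardT Q) c0 c0' d0 d0' pd pd' sd sd' st ts st' ts'.
pose i0 := Ordinal hn.
have k3 : (3 <= n.+1)%N by [].
(* Index [ord0] is the extra norm form, so [lift ord0 i0] is the block of the first quaternion
   factor, whose parameter is preserved. *)
have [G [P [G' [P' [gG gG' PP']]]]] := @witt_zero_common_pairs _ _ _ _ _ _ k3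
  c0 d0 c0' d0' (lift ord0 i0) (lift ord0 i0) wz.
have mE : (n.+1 + n.+1 = n.+1.*2)%N by rewrite addnn.
have [Q2 [ok2 iso2 [i1 s1Q2] [j1 [d2 p2]]]] :=
  goodb_decomposition (blockform_nonsingular c0 d0) (cardT Q) mE n2 st ts gG.
have [Q3 [ok3 iso3 [i2 s1Q3] [j2 [d3 p3]]]] :=
  goodb_decomposition (blockform_nonsingular c0' d0') (cardT Q) mE n2 st' ts' gG'.
rewrite std_dpar // dS in s1Q2; rewrite std_dpar // dS' in s1Q3.
exists Q2, Q3; do 2!split=> //; split; first exact: sc_iso_sym iso2.
split; first exact: sc_iso_trans iso2 (sc_iso_sym iso3).
split; first exact: sc_iso_trans iso3 hiso.
split; first by exists i0, i1; apply: common_slot_fst.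
split; last by exists i2, i0; apply: common_slot_fst.
exists j1, j2; case: PP' => E; first by apply: common_slot_fst; rewrite // d2 d3.
by apply: common_slot_snd; rewrite // p2 p3 E.
Qed.
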